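(* Let $G$ be a compact Polish group and $\Gamma,\Lambda<G$ countable dense subgroups. Consider the left-right translation action $\Gamma\times\Lambda\curvearrowright (G,m_G)$ given by $(g,h)\cdot x=gxh^{-1}$, for $g\in\Gamma$, $h\in\Lambda$, $x\in G$. Assume that the left translation action $\Gamma\curvearrowright (G,m_G)$ is strongly ergodic and that $\Lambda$ is finitely generated. Let $w:(\Gamma\times\Lambda)\times G\rightarrow\Delta$ be a cocycle for the left-right translation action with values in a countable group $\Delta$. Then the following hold: (1) Assume that $G$ is a profinite group and $\Gamma$ is finitely generated. Then there exists an open subgroup $G_0<G$ such that the restriction of $w$ to $(\Gamma_0\times\Lambda_0)\times G_0$ is cohomologous (as a cocycle for the left-right translation action $\Gamma_0\times\Lambda_0\curvearrowright(G_0,m_{G_0})$) to a homomorphism $\delta:\Gamma_0\times\Lambda_0\rightarrow\Delta$, where $\Gamma_0=\Gamma\cap G_0$ and $\Lambda_0=\Lambda\cap G_0$. (2) Assume that $G$ is connected and $\tilde G$ is a simply connected locally compact group together with a continuous onto homomorphism $p:\tilde G\rightarrow G$ such that $\ker(p)<\tilde G$ is discrete. Put $\tilde\Gamma=p^{-1}(\Gamma)$ and $\tilde\Lambda=p^{-1}(\Lambda)$. Then the ''lifted'' cocycle $\tilde w:(\tilde\Gamma\times\tilde\Lambda)\times\tilde G\rightarrow\Delta$, for the left-right translation action $\tilde\Gamma\times\tilde\Lambda\curvearrowright(\tilde G,m_{\tilde G})$, given by $\tilde w((g,h),x)=w((p(g),p(h)),p(x))$, is cohomologous to a homomorphism $\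delta:\tilde\Gamma\times\tilde\Lambda\rightarrow\Delta$.
   Context: For a locally compact Polish group $G$, $m_G$ denotes a fixed left invariant Haar measure (normalized to a probability measure when $G$ is compact). Simply connected groups are understood to be connected. Cocycles. Let $\Gamma\curvearrowright (X,\mu)$ be a nonsingular action of a countable group on a standard (finite or infinite) measure space, and $\Delta$ a countable (discrete) group. A measurable map $w:\Gamma\times X\rightarrow\Delta$ is a cocycle if $w(g_1g_2,x)=w(g_1,g_2x)w(g_2,x)$ for all $g_1,g_2\in\Gamma$ and almost every $x\in X$. A homomorphism $\delta:\Gamma\rightarrow\Delta$ is viewed as the cocycle $w(g,x)=\delta(g)$. Two cocycles $w_1,w_2:\Gamma\times X\rightarrow\Delta$ are cohomologous if there is a measurable map $\varphi:X\rightarrow\Delta$ such that $w_1(g,x)=\varphi(gx)w_2(g,x)\varphi(x)^{-1}$ for all $g\in\Gamma$ and almost every $x\in X$. Strong ergodicity. A nonsingular action $\Gamma\curvearrowright(X,\mu)$ on a probability space is strongly ergodic if any sequence of measurable sets $A_n\subseteq X$ such that $\mu(gA_n\triangle A_n)\rightarrow 0$ for all $g\in\Gamma$ satisfies $\mu(A_n)(1-\mu(A_n))\rightarrow 0$. *)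

(* Defs.v *)
From HB Require Import structures.
From mathcomp Require Import all_boot all_order all_algebra.
From mathcomp Require Import all_classical all_reals all_analysis.

Set Implicit Arguments.
Unset Strict Implicit.
Unset Printing Implicit Defensive.

Import Order.TTheory GRing.Theory Num.Theory.
Import numFieldTopology.Exports numFieldNormedType.Exports.

Local Open Scope classical_set_scope.
Local Open Scope ring_scope.
Local Open Scope group_scope.

HB.mixin Record isTopologicalGroup G & Group G & PointedTopological G := {
  mulg_continuous : continuous (fun x : G * G => x.1 * x.2 : G);
  invg_continuous : continuous (fun x : G => x^-1 : G)
}.

(* The distinguished point carries no information; it is included because the
   measurable structures of the library are built on pointed types. *)
#[short(type="topGroupType")]
HB.structure Definition TopologicalGroup :=
  {G of Group G & PointedTopological G & isTopologicalGroup G}.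

Notation borel G := (g_sigma_algebraType (@open G)).

Definition discrete_group (D : groupType) : Type := D.

HB.instance Definition _ (D : groupType) := Choice.on (discrete_group D).
HB.instance Definition _ (D : groupType) :=
  isPointed.Build (discrete_group D) (1 : D).
HB.instance Definition _ (D : groupType) := @isMeasurable.Build default_measure_display
  (discrete_group D) discrete_measurable discrete_measurable0
  discrete_measurableC discrete_measurableU.

Section topology.
Local Open Scope ring_scope.
Variables (R : realType) (T : topologicalType).

Definition is_metric (d : T -> T -> R) : Prop :=
  [/\ forall x y, d x y = 0 <-> x = y,
      forall x y, d x y = d y x &
      forall x y z, d x z <= d x y + d y z].

Definition metrizes (d : T -> T -> R) : Prop :=
  forall (x : T) (A : set T),
    nbhs x A <-> exists2 e : R, 0 < e & [set y | d x y < e] `<=` A.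

Definition complete_metric (d : T -> T -> R) : Prop :=
  forall u : nat -> T,
    (forall e : R, 0 < e -> exists N : nat,
       forall m n : nat, (N <= m)%N -> (N <= n)%N -> d (u m) (u n) < e) ->
    exists l : T, u @ \oo --> l.

Definition polish_space : Prop :=
  (exists2 A : set T, countable A & dense A) /\
  (exists d : T -> T -> R, [/\ is_metric d, metrizes d & complete_metric d]).

Definition path_connected_space : Prop :=
  forall x y : T, exists f : R -> T,
    [/\ {within `[0, 1], continuous f}, f 0 = x & f 1 = y].

(* In H (s, t), s is the homotopy parameter and t the loop parameter. *)
Definition nullhomotopic (f : R -> T) : Prop :=
  exists H : R * R -> T,
    [/\ {within (`[0, 1] `*` `[0, 1] : set (R * R)), continuous H},
        (forall t : R, 0 <= t <= 1 -> H (0, t) = f t /\ H (1, t) = f 0) &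
        (forall s : R, 0 <= s <= 1 -> H (s, 0) = f 0 /\ H (s, 1) = f 0)].

Definition simply_connected_space : Prop :=
  path_connected_space /\
  (forall f : R -> T, {within `[0, 1], continuous f} -> f 0 = f 1 ->
     nullhomotopic f).

End topology.

(* Intrinsic form of an inverse limit of finite discrete groups. *)
Definition profinite (G : topGroupType) : Prop :=
  [/\ compact [set: G], hausdorff_space G & totally_disconnected [set: G]].

Section groups.
Variable G : groupType.

Definition subgroup (H : set G) : Prop :=
  [/\ H 1, (forall x y, H x -> H y -> H (x * y)) & (forall x, H x -> H x^-1)].

Definition finitely_generated (H : set G) : Prop :=
  exists2 F : set G, finite_set F & H = smallest subgroup F.

Definition homomorphism_on (D : groupType) (H : set G) (f : G -> D) : Prop :=
  forall x y, H x -> H y -> f (x * y) = f x * f y.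

(* The left-right translation (g, h) . x = g x h^-1. *)
Definition lr_act (s : G * G) (x : G) : G := s.1 * x * s.2^-1.

End groups.

(* Left invariant Haar measure. On a second countable locally compact group,
   regularity follows from finiteness on compact sets, and positivity on
   nonempty open sets follows from invariance and non-triviality. *)
Definition haar_measure (R : realType) (G : topGroupType)
    (m : {measure set (borel G) -> \bar R}) : Prop :=
  [/\ forall (g : G) (A : set (borel G)),
        measurable A -> m [set g * x | x in (A : set G)] = m A,
      forall K : set G, compact K -> (m K < +oo)%E &
      m [set: borel G] <> 0%E].

Section actions.
(* A map act : T -> X -> X whose restriction to the subgroup S of T is an
   action of S. *)
Variables (R : realType) (T : groupType) (d : measure_display).
Variables (X : measurableType d) (S : set T) (act : T -> X -> X).

Definition strongly_ergodic (mu : probability X R) : Prop :=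
  forall A : nat -> set X, (forall n, measurable (A n)) ->
    (forall s, S s -> (fun n => mu ((act s @` A n) `+` A n)) @ \oo --> 0%E) ->
    (fun n => mu (A n) * (1 - mu (A n)))%E @ \oo --> 0%E.

(* Cocycles for the action of S on an S-invariant measurable subset Y of X,
   endowed with the restriction of mu or any nonzero finite multiple of it:
   only null sets matter. The values of w outside S and Y are irrelevant. *)
Variables (mu : {measure set X -> \bar R}) (Y : set X) (D : groupType).

Definition cocycle (w : T -> X -> D) : Prop :=
  (forall s, S s -> measurable_fun Y (w s : X -> discrete_group D)) /\
  (forall s1 s2, S s1 -> S s2 -> {ae mu, forall x, Y x ->
     w (s1 * s2) x = w s1 (act s2 x) * w s2 x}).

Definition cohomologous (w1 w2 : T -> X -> D) : Prop :=
  exists2 phi : X -> D, measurable_fun Y (phi : X -> discrete_group D) &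
    forall s, S s -> {ae mu, forall x, Y x ->
      w1 s x = phi (act s x) * w2 s x * (phi x)^-1}.

End actions.

(* Main.v *)
(* Write [a g = w (g, 1)] and [b h = w (1, h)]. Commutation of the two actions
   makes the sets [{x | b h (x * t) <> b h x}] almost [Gam]-invariant for [t]
   near 1, uniformly in [h] (small conjugation-invariant neighbourhoods exist as
   G is compact); strong ergodicity makes their measures close to 0 or 1, and
   since [Lam] is finitely generated they are all close to 0. Hence, for small
   [s], the cocycles [b h x] and [b h (s * x)] are uniformly close, and a convexity
   argument conjugates one to the other by some [phi (s, x)]. By density of [Lam]
   such [phi] is unique if it is mostly trivial, so it satisfies a cocycle
   identity in [s] and is equivariant under [a g] for [s] near 1 (depending on g).
   Therefore [psi_z x = phi (z * x^-1, x)], defined for x near a generic point z,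
   turns each [w s] into a locally constant function.

   If G is profinite, one psi_z serves on a small open normal subgroup. If G has a
   simply connected cover, the constants [psi_z^-1 * psi_z'] form a locally flat
   system on it, and its monodromy is trivial; this glues the local psi_z. *)

Require Import Defs.
From HB Require Import structures.
From mathcomp Require Import all_boot all_order all_algebra.
From mathcomp Require Import all_classical all_reals all_analysis.
From mathcomp Require Import measurable_realfun ring lra.

Set Implicit Arguments.
Unset Strict Implicit.
Unset Printing Implicit Defensive.

Import Order.TTheory GRing.Theory Num.Theory.
Import numFieldTopology.Exports numFieldNormedType.Exports.

Local Open Scope classical_set_scope.
Local Open Scope ring_scope.
Local Open Scope group_scope.

(** * Topological groups and Haar measure *)

(** Left translation by [s] commutes with the right action of [Lam], so [b h (s * x)] is again a
    cocycle. Stability, however, is first obtained for right translations [x * t], since these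
    commute with the left action of [Gam]. The measure preserving map (t, x) |-> (x t x^-1, x)
    passes from one to the other, but it mixes the values of [s]: the estimate survives only on
    average. The conjugating maps therefore exist at first for a set of [s] of positive measure, and
    Steinhaus' theorem spreads them to a neighbourhood of 1. Uniqueness comes from ergodicity: two
    solutions of one equation agree on a [Lam]-invariant set, so agreement on positive measure is
    agreement almost everywhere. The bounds 1/10 and 1/5 keep all disagreements below measure 1. For
    finitely generated [Gam], a normal open subgroup gives equivariance on one neighbourhood for all
    of [Gam]. In the connected case the neighbourhood depends on [g], and connectedness of the cover
    makes up for it. The cover is only given as a locally compact Hausdorff group, so countable
    covers, openness of [p] and local path connectedness have to be derived. *)

Lemma dense_nbhs (T : topologicalType) (D U : set T) (x : T) :
  dense D -> nbhs x U -> exists2 y, D y & U y.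
Proof.
move=> dD; rewrite nbhsE => -[V [oV Vx] VU].
have [y [Vy Dy]] := dD V (ex_intro _ x Vx) oV.
by exists y => //; exact: VU.
Qed.

Section topological_group.
Variable G : topGroupType.
Implicit Types (x y g : G) (U V A : set G).

Lemma continuous_mulg (T : topologicalType) (f f' : T -> G) :
  continuous f -> continuous f' -> continuous (fun t => f t * f' t).
Proof.
move=> cf cf' t; apply: (@cvg_comp _ _ _ (fun t => (f t, f' t)) (fun p : G * G => p.1 * p.2)
  _ _ _ _ (@mulg_continuous G (f t, f' t))).
by apply: cvg_pair; [exact: cf|exact: cf'].
Qed.

Lemma continuous_invg (T : topologicalType) (f : T -> G) :
  continuous f -> continuous (fun t => (f t)^-1).
Proof. by move=> cf t; apply: continuous_comp; [exact: cf|exact: invg_continuous]. Qed.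

Lemma continuous_lmul g : continuous (fun x => g * x).
Proof. by apply: continuous_mulg => [x|x]; [exact: cvg_cst|exact: cvg_id]. Qed.

Lemma continuous_rmul g : continuous (fun x => x * g).
Proof. by apply: continuous_mulg => [x|x]; [exact: cvg_id|exact: cvg_cst]. Qed.

Lemma continuous_conj g : continuous (fun x => g * x * g^-1).
Proof.
by apply: continuous_mulg => [|x]; [exact: continuous_lmul|exact: cvg_cst].
Qed.

Lemma nbhs_mul2 x y U : nbhs (x * y) U ->
  exists V1 V2, [/\ nbhs x V1, nbhs y V2 & forall u v, V1 u -> V2 v -> U (u * v)].
Proof.
move=> /(@mulg_continuous G (x, y)) [[V1 V2] /= [V1x V2y] sub].
by exists V1, V2; split => // u v V1u V2v; exact: (sub (u, v)).
Qed.

Lemma nbhs_lmul g x U : nbhs (g * x) U <-> nbhs x [set y | U (g * y)].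
Proof.
split; first exact: (@continuous_lmul g x).
have := @continuous_lmul g^-1 (g * x).
rewrite /continuous_at mulKg => H /H; rewrite nbhs_simpl /=; apply: filterS => y /=.
by rewrite mulVKg.
Qed.

Lemma nbhs_rmul g x U : nbhs (x * g) U <-> nbhs x [set y | U (y * g)].
Proof.
split; first exact: (@continuous_rmul g x).
have := @continuous_rmul g^-1 (x * g).
rewrite /continuous_at mulgK => H /H; rewrite nbhs_simpl /=; apply: filterS => y /=.
by rewrite mulgVK.
Qed.

Lemma nbhs_inv x U : nbhs x^-1 U <-> nbhs x [set y | U y^-1].
Proof.
split; first exact: (@invg_continuous G x).
have := @invg_continuous G x^-1.
rewrite /continuous_at invgK => H /H; rewrite nbhs_simpl /=; apply: filterS => y /=.
by rewrite invgK.
Qed.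

Lemma nbhs1_conj g U : nbhs 1 U -> nbhs 1 [set y | U (g * y * g^-1)].
Proof.
move=> U1; have := @continuous_conj g 1.
by rewrite /continuous_at mulg1 mulgV; apply.
Qed.

Lemma open_lmul g A : open A -> open [set x | A (g * x)].
Proof. by move=> oA; apply: (open_comp _ oA) => z _; exact: continuous_lmul. Qed.

Lemma open_rmul g A : open A -> open [set x | A (x * g)].
Proof. by move=> oA; apply: (open_comp _ oA) => z _; exact: continuous_rmul. Qed.

Lemma nbhs1_sym2 U : nbhs 1 U ->
  exists V, [/\ open V, V 1, forall x, V x -> V x^-1 &
                forall x y, V x -> V y -> U (x * y)].
Proof.
move=> U1; have := U1; rewrite -{1}(mulg1 1) => /nbhs_mul2[V1 [V2 [V1n V2n sub]]].
pose V := (V1 `&` V2)°; exists (V `&` [set x | V x^-1]).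
have V1' : nbhs 1 V by apply: nbhs_interior; exact: filterI.
split.
- apply: openI; first exact: open_interior.
  apply: (open_comp _ (@open_interior _ _)) => z _; exact: invg_continuous.
- by split; [exact: nbhs_singleton|rewrite /= invg1; exact: nbhs_singleton].
- by move=> x [Vx Vx']; split => //=; rewrite invgK.
- move=> x y [/interior_subset[Vx _] _] [/interior_subset[_ Vy] _]; exact: sub.
Qed.

Lemma nbhs1_sym U : nbhs 1 U ->
  exists V, [/\ open V, V 1, forall x, V x -> V x^-1 & V `<=` U].
Proof.
move=> /nbhs1_sym2[V [oV V1 Vi VU]]; exists V; split => // x Vx.
by rewrite -(mulg1 x); exact: VU.
Qed.

(** Joint continuity handles all conjugators near a given g; compactness then makes the
    neighbourhood of 1 independent of g. *)
Lemma nbhs1_conj_uniform U : compact [set: G] -> nbhs 1 U ->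
  nbhs 1 [set y | forall g, U (g * y * g^-1)].
Proof.
move=> cG U1; have := cG => /compact_near_coveringP.
move=> /(_ G (nbhs (1 : G)) (fun y g => U (g * y * g^-1)) _) H.
have {}H : \forall y \near (1 : G), [set: G] `<=` (fun g => U (g * y * g^-1)).
  apply: H => g _; near_simpl.
  have c : continuous (fun p : G * G => p.1 * p.2 * p.1^-1).
    apply: continuous_mulg; last by apply: continuous_invg => x; exact: cvg_fst.
    by apply: continuous_mulg => x; [exact: cvg_fst|exact: cvg_snd].
  by have := c (g, 1); rewrite /continuous_at /= mulg1 mulgV; apply.
by apply: filterS H => y H g; exact: H.
Qed.

Lemma compact_translates U : compact [set: G] -> nbhs 1 U ->
  exists s : seq G, forall x, exists2 c, c \in s & U (x * c^-1).
Proof.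
move=> cG /nbhs1_sym[V [oV V1 Vi VU]].
move: cG; rewrite compact_cover => /(_ G [set: G] (fun c => [set x | V (x * c^-1)])) [].
- by move=> c _; apply: open_rmul.
- by move=> x _; exists x => //=; rewrite mulgV.
move=> D _ cov; exists (finmap.enum_fset D) => x.
by have [c /= cD Vx] := cov x I; exists c => //; exact: VU.
Qed.

End topological_group.

(** The point [x0] allows an enumeration by all of [nat] even when [A] is finite, so that later
    unions can be indexed by [nat]. *)
Lemma countable_enum (T : Type) (A : set T) (x0 : T) : countable A -> A x0 ->
  exists f : nat -> T, (forall n, A (f n)) /\ forall a, A a -> exists n, f n = a.
Proof.
move=> cA Ax0; have /pfcard_geP[A0|[f]] := cA; first by rewrite A0 in Ax0.
exists f; split => [n|a Aa]; first exact: funS.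
by have [n _ fn] := @surj _ _ _ _ f a Aa; exists n.
Qed.

Section second_countable.
Variables (R : realType) (T : topologicalType).
Hypothesis polish_T : polish_space R T.

Lemma polish_basis : T -> exists B : nat -> set T,
  (forall n, open (B n)) /\
  forall x U, nbhs x U -> exists n, B n x /\ B n `<=` U.
Proof.
move=> x0; have [[A cA dA] [d [[d0 dC dT] md _]]] := polish_T.
have ob a (e : R) : open [set y | (d a y < e)%R].
  rewrite openE => y /= dy; apply/md; exists (e - d a y)%R.
    by rewrite subr_gt0.
  move=> z /= yz; apply: le_lt_trans (dT _ y _) _.
  by rewrite -ltrBrDl.
have bn x (e : R) : (0 < e)%R -> nbhs x [set y | (d x y < e)%R].
  by move=> e0; apply/md; exists e.
have d00 x : d x x = 0%R by apply/d0.
have [a0 [_ Aa0]] : exists a, (setT `&` A) a.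
  by apply: (dA setT); [exists x0|exact: openT].
have [a [_ sa]] := countable_enum cA Aa0.
pose B (p : nat * nat) := [set y | (d (a p.1) y < p.2.+1%:R^-1)%R].
have [e [_ se]] : exists e : nat -> nat * nat, (forall n, setT (e n)) /\
    forall p, setT p -> exists n, e n = p.
  by apply: (@countable_enum _ _ (0, 0)%N); first exact: countableP.
exists (B \o e); split => [n|x U /md[r r0 rU]]; first exact: ob.
(* A ball of radius below r / 2 that contains [x] stays in the ball of radius r around [x], wherever
   its centre is. *)
have [n nr] : exists n : nat, (n.+1%:R^-1 < r / 2)%R.
  have r2 : (0 < r / 2)%R by rewrite divr_gt0.
  exists (Num.Def.truncn (r / 2)^-1).
  rewrite invf_plt ?posrE//; exact: truncnS_gt.
have n0 : (0 < n.+1%:R^-1 :> R)%R by rewrite invr_gt0.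
have [b bA /= xb] := dense_nbhs dA (bn x _ n0).
have [m mb] := sa _ bA.
have [k ek] := se (m, n) I.
exists k; rewrite /= ek /B /= mb; split; first by rewrite dC.
move=> y /= by_; apply: rU => /=; apply: le_lt_trans (dT _ b _) _.
by rewrite (splitr r) ltrD //; apply: lt_trans nr.
Qed.

Lemma polish_hausdorff : hausdorff_space T.
Proof.
have [_ [d [[d0 dC dT] md _]]] := polish_T.
have d00 x : d x x = 0%R by apply/d0.
have dge u v : (0 <= d u v)%R.
  by have := dT u v u; rewrite d00 (dC v u); lra.
move=> x y cxy; apply/d0/eqP; rewrite eq_le dge andbT leNgt; apply/negP => xy.
have e0 : (0 < d x y / 2)%R by rewrite divr_gt0.
have bn z : nbhs z [set t | (d z t < d x y / 2)%R].
  by apply/md; exists (d x y / 2)%R.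
have [z [/= xz yz]] := cxy _ _ (bn x) (bn y).
have := lt_le_trans (ltrD xz yz).
rewrite -splitr (dC y z) => /(_ _ (dT x z y)).
by rewrite ltxx.
Qed.

End second_countable.

(** * Probabilities as real numbers, and null sets in products *)

Definition pr d (T : measurableType d) (R : realType) (P : probability T R)
  (A : set T) : R := fine (P A).

Section pr_theory.
Context d (T : measurableType d) (R : realType) (P : probability T R).
Implicit Types A B : set T.
Local Open Scope ring_scope.
Local Notation pr := (pr P).

Lemma prE A : measurable A -> ((pr A)%:E)%E = P A.
Proof. by move=> mA; rewrite fineK // fin_num_measure. Qed.

Lemma pr_ge0 A : 0 <= pr A.
Proof. by rewrite fine_ge0. Qed.

Lemma prT : pr setT = 1.
Proof. by rewrite /pr probability_setT. Qed.

Lemma pr0 : pr set0 = 0.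
Proof. by rewrite /pr measure0. Qed.

Lemma pr_le A B : measurable A -> measurable B -> A `<=` B -> pr A <= pr B.
Proof.
by move=> mA mB AB; rewrite -lee_fin !prE // le_measure // inE.
Qed.

Lemma prU A B : measurable A -> measurable B -> pr (A `|` B) <= pr A + pr B.
Proof.
move=> mA mB; rewrite -lee_fin EFinD !prE //; last exact: measurableU.
exact: measureU2.
Qed.

Lemma prUle A B (a b : R) : measurable A -> measurable B -> pr A <= a -> pr B <= b ->
  pr (A `|` B) <= a + b.
Proof. by move=> mA mB Aa Bb; apply: le_trans (prU mA mB) _; exact: lerD. Qed.

Lemma prU0 A B : measurable A -> measurable B -> A `&` B = set0 ->
  pr (A `|` B) = pr A + pr B.
Proof.
move=> mA mB AB; apply: EFin_inj.
by rewrite EFinD !prE ?measureU //; exact: measurableU.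
Qed.

Lemma prC A : measurable A -> pr (~` A) = 1 - pr A.
Proof.
move=> mA; apply: EFin_inj; rewrite EFinB !prE ?probability_setC //.
exact: measurableC.
Qed.

Lemma pr_eq0 A : measurable A -> pr A = 0 <-> P A = 0%E.
Proof. by move=> mA; rewrite -prE //; split => [->//|h]; exact: EFin_inj. Qed.

Lemma pr_aeP A : measurable A -> {ae P, forall x, A x} <-> pr A = 1.
Proof.
move=> mA; have mA' : measurable (~` A) by exact: measurableC.
have -> : {ae P, forall x, A x} <-> P (~` A) = 0%E.
  by rewrite -(negligibleP _ mA').
rewrite -(pr_eq0 mA') prC //; split; lra.
Qed.

Lemma pr_cup (F : nat -> set T) (e : R) : (forall n, measurable (F n)) ->
  {homo F : n m / (n <= m)%N >-> n `<=` m} -> 0 < e ->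
  exists n, pr (\bigcup_n F n) <= pr (F n) + e.
Proof.
move=> mF ndF e0.
have mcF : measurable (\bigcup_n F n) by exact: bigcupT_measurable.
have ndF' : nondecreasing_seq F by move=> n m nm; apply/subsetPset; exact: ndF.
have : (fun n => (pr (F n))%:E)%E @ \oo --> (pr (\bigcup_n F n))%:E%E.
  rewrite prE // (_ : (fun _ => _) = P \o F); last first.
    by apply/funext => n /=; rewrite prE.
  exact: nondecreasing_cvg_mu.
move=> /fine_cvgP[_ /=].
move=> /cvgrPdist_lt /(_ _ e0)[n _ /(_ n (leqnn n))] /= H.
by exists n; have := ler_norm (pr (\bigcup_n F n) - pr (F n)); lra.
Qed.

Lemma pr_cup0 (F : nat -> set T) : (forall n, measurable (F n)) -> (forall n, pr (F n) = 0) ->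
  pr (\bigcup_n F n) = 0.
Proof.
move=> mF F0; apply/pr_eq0; first exact: bigcupT_measurable.
apply/negligibleP; first exact: bigcupT_measurable.
apply: negligible_bigcup => n; apply/negligibleP => //; exact/pr_eq0.
Qed.

End pr_theory.

Section product_null.
Context d1 d2 (T1 : measurableType d1) (T2 : measurableType d2) (R : realType).
Variables (P1 : probability T1 R) (P2 : probability T2 R).
Local Open Scope ereal_scope.

Lemma prod_xE (A : set (T1 * T2)) : (P1 \x P2) A = \int[P1]_x P2 (xsection A x).
Proof. by []. Qed.

Lemma prod_yE (A : set (T1 * T2)) : measurable A ->
  (P1 \x P2) A = \int[P2]_y P1 (ysection A y).
Proof.
move=> mA; rewrite prod_xE.
have := indic_fubini_tonelli P1 P2 mA.
by rewrite indic_fubini_tonelli_FE // indic_fubini_tonelli_GE.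
Qed.

Lemma ae_xsection (A : set (T1 * T2)) : measurable A ->
  (P1 \x P2) A = 0 <-> {ae P1, forall x, P2 (xsection A x) = 0}.
Proof.
move=> mA; have mf := measurable_fun_xsection P2 mA.
have -> : (P1 \x P2) A = \int[P1]_x `|(P2 \o xsection A) x|.
  by rewrite prod_xE; apply: eq_integral => x _; rewrite gee0_abs.
rewrite (ae_eq_integral_abs P1 measurableT mf).
split; apply: filterS => x /=; first by move=> /(_ I).
by move=> + _.
Qed.

Lemma ae_ysection (A : set (T1 * T2)) : measurable A ->
  (P1 \x P2) A = 0 <-> {ae P2, forall y, P1 (ysection A y) = 0}.
Proof.
move=> mA; have mf := measurable_fun_ysection P1 mA.
have -> : (P1 \x P2) A = \int[P2]_x `|(P1 \o ysection A) x|.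
  by rewrite prod_yE //; apply: eq_integral => x _; rewrite gee0_abs.
rewrite (ae_eq_integral_abs P2 measurableT mf).
split; apply: filterS => x /=; first by move=> /(_ I).
by move=> + _.
Qed.

End product_null.

(** * Borel sets and the Haar measure of a compact group *)

Section borel.
Variable G : topGroupType.

Lemma open_borel (A : set G) : open A -> @measurable _ (borel G) A.
Proof. by move=> oA; exact: sub_sigma_algebra. Qed.

Lemma closed_borel (A : set G) : closed A -> @measurable _ (borel G) A.
Proof.
move=> cA; rewrite -(setCK A); apply: measurableC; apply: open_borel.
exact: closed_openC.
Qed.

Lemma continuous_borel (H : topGroupType) (f : G -> H) : continuous f ->
  @measurable_fun _ _ (borel G) (borel H) [set: borel G] f.
Proof.
move=> cf; apply: (@measurability _ _ (borel G) (borel H) _ f (@open H)) => //.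
move=> _ [A oA <-]; rewrite setTI; apply: sub_sigma_algebra.
by move/continuousP : cf; apply.
Qed.

Lemma continuous_preimage_borel (H : topGroupType) (f : G -> H) (A : set H) :
  continuous f -> @measurable _ (borel H) A -> @measurable _ (borel G) (f @^-1` A).
Proof.
by move=> cf mA; rewrite -(setTI (_ @^-1` _)); exact: (continuous_borel cf).
Qed.

Lemma measurable_lmul g (A : set G) : @measurable _ (borel G) A ->
  @measurable _ (borel G) [set x | A (g * x)].
Proof. by move=> mA; apply: (continuous_preimage_borel _ mA); exact: continuous_lmul. Qed.

Lemma measurable_rmul g (A : set G) : @measurable _ (borel G) A ->
  @measurable _ (borel G) [set x | A (x * g)].
Proof. by move=> mA; apply: (continuous_preimage_borel _ mA); exact: continuous_rmul. Qed.

Lemma measurable_inv (A : set G) : @measurable _ (borel G) A ->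
  @measurable _ (borel G) [set x | A x^-1].
Proof. by move=> mA; apply: (continuous_preimage_borel _ mA); exact: invg_continuous. Qed.

End borel.

Section second_countable_borel.
Variables (R : realType) (G : topGroupType).
Hypothesis pG : polish_space R G.

(** The source carries the product of the Borel sigma-algebras; the countable basis writes an open
    subset of the product space as a countable union of open rectangles. *)
Lemma continuous2_borel (f : G * G -> G) : continuous f ->
  measurable_fun [set: borel G * borel G] (f : borel G * borel G -> borel G).
Proof.
move=> cf; apply: (@measurability _ _ (borel G * borel G)%type (borel G) setT f (@open G)) => //.
move=> _ [A oA <-]; rewrite setTI.
have [B [oB Bb]] := polish_basis pG 1.
pose C n k := if `[< B n `*` B k `<=` f @^-1` A >] then B n `*` B k else set0.
rewrite (_ : _ @^-1` _ = \bigcup_n \bigcup_k C n k).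
  apply: bigcupT_measurable => n; apply: bigcupT_measurable => k.
  by rewrite /C; case: ifPn => // _; apply: measurableX; exact: open_borel.
apply/seteqP; split => [[x y] Axy|[x y] [n _ [k _]]].
- have : nbhs (x, y) (f @^-1` A) by apply: cf; exact: open_nbhs_nbhs.
  move=> [[U V] /= [/Bb[n [nx nU]] /Bb[k [ky kV]]] sub].
  exists n => //; exists k => //.
  rewrite /C asboolT // => -[u v] [/= nu kv].
  by apply: sub; split; [exact: nU|exact: kV].
- by rewrite /C; case: ifPn => // /asboolP sub /sub.
Qed.

Lemma measurable_preimage2 (f : G * G -> G) (A : set G) : continuous f ->
  @measurable _ (borel G) A -> measurable [set p : borel G * borel G | A (f p)].
Proof.
move=> cf mA; rewrite -(setTI [set _ | _]).
exact: (continuous2_borel cf measurableT mA).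
Qed.

Lemma measurable_mul2 (A : set G) : @measurable _ (borel G) A ->
  measurable [set p : borel G * borel G | A (p.1 * p.2 : G)].
Proof.
apply: measurable_preimage2.
by apply: continuous_mulg => x; [exact: cvg_fst|exact: cvg_snd].
Qed.

Lemma measurable_mul2C (A : set G) : @measurable _ (borel G) A ->
  measurable [set p : borel G * borel G | A (p.2 * p.1 : G)].
Proof.
apply: measurable_preimage2.
by apply: continuous_mulg => x; [exact: cvg_snd|exact: cvg_fst].
Qed.

Lemma measurable_pre1 d1 d2 (T1 : measurableType d1) (T2 : measurableType d2)
  (A : set T1) : measurable A -> measurable [set p : T1 * T2 | A p.1].
Proof.
by move=> mA; rewrite -(setTI [set _ | _]); exact: (@measurable_fst _ _ T1 T2 measurableT A mA).
Qed.

Lemma measurable_pre2 d1 d2 (T1 : measurableType d1) (T2 : measurableType d2)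
  (A : set T2) : measurable A -> measurable [set p : T1 * T2 | A p.2].
Proof.
by move=> mA; rewrite -(setTI [set _ | _]); exact: (@measurable_snd _ _ T1 T2 measurableT A mA).
Qed.

Lemma nbhs1_basis : exists V : nat -> set G,
  [/\ forall n, open (V n), forall n, V n 1,
      forall n k, (n <= k)%N -> V k `<=` V n &
      forall U, nbhs 1 U -> exists n, V n `<=` U].
Proof.
have [B [oB Bb]] := polish_basis pG 1.
pose C n := if `[< B n 1 >] then B n else setT.
have C1 n : C n 1 by rewrite /C; case: ifPn => // /asboolP.
have oC n : open (C n) by rewrite /C; case: ifPn => // _; exact: openT.
exists (fun n => \big[setI/setT]_(i < n.+1) C i); split.
- elim=> [|n IH]; first by rewrite big_ord_recr big_ord0 /= setTI.
  by rewrite big_ord_recr /=; exact: openI.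
- by move=> n; rewrite -bigcap_mkord => i _; exact: C1.
- move=> n k nk x; rewrite -!bigcap_mkord => H i /= ni; apply: H => /=.
  exact: leq_trans ni _.
- move=> U /Bb[n [n1 nU]]; exists n => x; rewrite -bigcap_mkord => /(_ n (ltnSn n)).
  by rewrite /C asboolT // => /nU.
Qed.

End second_countable_borel.

Section haar.
Variables (R : realType) (G : topGroupType) (mG : probability (borel G) R).
Hypotheses (cG : compact [set: G]) (pG : polish_space R G) (hG : haar_measure mG).
Local Notation m := (pr mG).
Local Notation M := (@measurable _ (borel G)).

Lemma haar_lmul g (A : set G) : M A -> mG [set x | A (g * x)] = mG A.
Proof.
move=> mA; case: hG => inv _ _; rewrite -(inv g) //; last exact: measurable_lmul.
congr (mG _); apply/seteqP; split => [_ [x Ax <-] //|x Ax].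
by exists (g^-1 * x); rewrite /= mulVKg.
Qed.

Lemma measurable_mulV (A : set G) : M A ->
  measurable [set p : borel G * borel G | A (p.1^-1 * p.2 : G)].
Proof.
move=> mA.
have c : continuous (fun p : G * G => p.1^-1 * p.2).
  by apply: continuous_mulg => [|x]; [apply: continuous_invg => x; exact: cvg_fst|exact: cvg_snd].
by rewrite -(setTI [set _ | _]); exact: (continuous2_borel pG c).
Qed.

(** Fubini on the pairs with x^-1 * y in [A]: the sections at fixed x are left translates of [A],
    those at fixed y are left translates of its inverse. *)
Lemma haar_inv (A : set G) : M A -> mG [set x | A x^-1] = mG A.
Proof.
move=> mA; have mE := measurable_mulV mA.
have := prod_yE mG mG mE; rewrite prod_xE.
rewrite (eq_integral (cst (mG A))); last first.
  by move=> x _ /=; rewrite -[RHS](haar_lmul x^-1 mA); congr (mG _); apply/seteqP; split => y; rewrite /xsection /= inE.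
rewrite [in RHS](eq_integral (cst (mG [set x | A x^-1]))); last first.
  move=> y _ /=; rewrite -[RHS](haar_lmul y^-1); last exact: measurable_inv.
  by congr (mG _); apply/seteqP; split => x; rewrite /ysection /= inE /= invgM invgK.
by rewrite !integral_cst //= !probability_setT !mule1.
Qed.

(** Right translation is left translation conjugated by the inverse, and both preserve the
    measure. *)
Lemma haar_rmul g (A : set G) : M A -> mG [set x | A (x * g)] = mG A.
Proof.
move=> mA; rewrite -(haar_inv (measurable_rmul g mA)) /=.
rewrite -[RHS](haar_inv mA) -(haar_lmul g^-1 (measurable_inv mA)).
by congr (mG _); apply/seteqP; split => x /=; rewrite invgM invgK.
Qed.

(** Finitely many right translates of a null neighbourhood would cover the compact group. *)
Lemma haar_open (U : set G) (x : G) : nbhs x U -> M U -> (0 < m U)%R.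
Proof.
move=> Ux mU; rewrite lt_neqAle pr_ge0 andbT eq_sym; apply/eqP => /pr_eq0 U0.
have U1 : nbhs 1 [set y | U (y * x)] by apply/nbhs_rmul; rewrite mul1g.
have [s sG] := compact_translates cG U1.
have : mG.-negligible (\big[setU/set0]_(c <- s) [set y | U (y * c^-1 * x)]).
  elim: s {sG} => [|c s IH]; first by rewrite big_nil; exact: negligible_set0.
  rewrite big_cons; apply: negligibleU => //.
  have mc : M [set y | U (y * c^-1 * x)].
    exact: (@measurable_rmul _ c^-1 [set y | U (y * x)] (measurable_rmul _ mU)).
  apply/negligibleP => //.
  apply: etrans (@haar_rmul c^-1 [set y | U (y * x)] (measurable_rmul _ mU)) _.
  by rewrite haar_rmul // U0.
rewrite -bigcup_seq (_ : \bigcup_(_ in _) _ = setT).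
  move=> /(negligibleP _ measurableT) h.
  by have := etrans (esym (probability_setT mG)) h => /eqP; rewrite onee_eq0.
by apply/seteqP; split => // y _; have [c cs Uc] := sG y; exists c.
Qed.

End haar.

(** * Functions with values in a countable group *)

(** For countable [D] this is measurability into the discrete space; testing fibres only avoids
    carrying a sigma-algebra on [D]. *)
Definition dmeas d (T : measurableType d) (D : Type) (f : T -> D) :=
  forall a, measurable [set x | f x = a].

Section dmeas.
Context d (T : measurableType d) (D : groupType).
Hypothesis cD : countable [set: D].
Implicit Types f g : T -> D.

Lemma countable_group_enum : exists e : nat -> D, forall a, exists n, e n = a.
Proof.
have [e [_ es]] := countable_enum cD (I : [set: D] 1).
by exists e => a; exact: es.
Qed.

Lemma dmeas_preimage f (A : set D) : dmeas f -> measurable [set x | A (f x)].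
Proof.
move=> mf; have [e es] := countable_group_enum.
rewrite (_ : [set _ | _] = \bigcup_n ([set x | f x = e n] `&` [set _ | A (e n)])).
  apply: bigcupT_measurable => n; apply: measurableI; first exact: mf.
  have [Ae|nAe] := pselect (A (e n)).
    by rewrite (_ : [set _ | _] = setT) //; apply/seteqP; split.
  by rewrite (_ : [set _ | _] = set0) //; apply/seteqP; split.
apply/seteqP; split => [x Ax|x [n _ /= [-> //]]].
by have [n en] := es (f x); exists n => //=; rewrite en.
Qed.

Lemma dmeas_op2 f g (h : D -> D -> D) : dmeas f -> dmeas g ->
  dmeas (fun x => h (f x) (g x)).
Proof.
move=> mf mg a; have [e es] := countable_group_enum.
rewrite (_ : [set _ | _] =
    \bigcup_n ([set x | f x = e n] `&` [set x | h (e n) (g x) = a])).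
  apply: bigcupT_measurable => n; apply: measurableI; first exact: mf.
  exact: (@dmeas_preimage g (fun b => h (e n) b = a) mg).
apply/seteqP; split => [x hx|x [n _ /= [-> //]]].
by have [n en] := es (f x); exists n => //=; rewrite en.
Qed.

Lemma dmeasM f g : dmeas f -> dmeas g -> dmeas (fun x => f x * g x).
Proof. exact: dmeas_op2. Qed.

Lemma dmeasV f : dmeas f -> dmeas (fun x => (f x)^-1).
Proof. by move=> mf; exact: (@dmeas_op2 f f (fun a _ => a^-1)). Qed.

Lemma dmeas_eq f g : dmeas f -> dmeas g -> measurable [set x | f x = g x].
Proof.
move=> mf mg; rewrite (_ : [set _ | _] = [set x | f x * (g x)^-1 = 1]).
  exact: (dmeasM mf (dmeasV mg)).
apply/seteqP; split => x /=; first by move=> ->; rewrite mulgV.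
exact: divg1_eq.
Qed.

Lemma dmeas_neq f g : dmeas f -> dmeas g -> measurable [set x | f x <> g x].
Proof. by move=> mf mg; apply: measurableC; exact: dmeas_eq. Qed.

Lemma dmeas_cst (a : D) : dmeas (fun _ : T => a).
Proof.
move=> b; have [->|ab] := pselect (a = b).
  by rewrite (_ : [set _ | _] = setT) //; apply/seteqP; split.
by rewrite (_ : [set _ | _] = set0) //; apply/seteqP; split.
Qed.

(** Measurable selection: take the first value, in an enumeration of [D], whose set contains the
    point, and 1 if there is none. *)
Lemma dmeas_pick (A : D -> set T) : (forall a, measurable (A a)) ->
  exists2 f, dmeas f & forall x a, A a x -> A (f x) x.
Proof.
move=> mA; have [e es] := countable_group_enum.
pose B n := A (e n) `\` \bigcup_(k < n) A (e k).
have mB n : measurable (B n).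
  apply: measurableD => //; apply: bigcup_measurable => k _; exact: mA.
have B1 x n n' : B n x -> B n' x -> n = n'.
  move=> [An nA] [An' nA']; have [nn'|nn'|//] := ltngtP n n'.
  - by exfalso; apply: nA'; exists n.
  - by exfalso; apply: nA; exists n'.
have fP x : {a | (forall n, B n x -> e n = a) /\ ((forall n, ~ B n x) -> a = 1)}.
  apply: cid; have [[n Bn]|/forallNP nB] := pselect (exists n, B n x).
    by exists (e n); split => [n' Bn'|/(_ n)//]; rewrite (B1 _ _ _ Bn Bn').
  by exists 1; split => // n /nB.
exists (fun x => sval (fP x)).
- move=> a.
  rewrite (_ : [set _ | _] = \bigcup_n (B n `&` [set _ | e n = a])
      `|` ((~` \bigcup_n B n) `&` [set _ | (1 : D) = a])).
    have mc (b : D) : measurable [set _ : T | b = a] by exact: dmeas_cst.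
    apply: measurableU.
      by apply: bigcupT_measurable => n; exact: measurableI.
    by apply: measurableI => //; apply: measurableC; exact: bigcupT_measurable.
  apply/seteqP; split => x /=; case: (fP x) => b /= [bB b1].
    move=> <-; have [[n Bn]|/forallNP nB] := pselect (exists n, B n x).
      by left; exists n => //; split => //=; exact: bB.
    by right; split => [[n _ /nB]//|/=]; rewrite b1.
  move=> [[n _ [/bB <-]] //|[nB /= <-]]; apply: b1 => n Bn; apply: nB; by exists n.
- move=> x a Aa; case: (fP x) => b /= [bB _].
  have [n Bn] : exists n, B n x.
    have [n en] := es a; have ex : exists n, `[< A (e n) x >].
      by exists n; apply/asboolP; rewrite en.
    have [k /asboolP Ak min] := ex_minnP ex; exists k; split => // -[j /= jk Aj].
    by have := min j; rewrite asboolT // => /(_ isT); rewrite leqNgt jk.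
  by rewrite -(bB _ Bn); case: Bn.
Qed.

End dmeas.

Lemma dmeas_comp d1 d2 (T1 : measurableType d1) (T2 : measurableType d2)
  (D : Type) (f : T2 -> D) (g : T1 -> T2) :
  measurable_fun setT g -> dmeas f -> dmeas (fun x => f (g x)).
Proof.
move=> mg mf a; rewrite -(setTI [set _ | _]).
exact: (mg measurableT [set y | f y = a] (mf a)).
Qed.

(** * Continuity of translation in measure, and ergodicity of dense subgroups *)

Section translation.
Variables (R : realType) (G : topGroupType) (mG : probability (borel G) R).
Hypotheses (cG : compact [set: G]) (pG : polish_space R G) (hG : haar_measure mG).
Local Notation m := (pr mG).
Local Notation M := (@measurable _ (borel G)).
Local Open Scope ring_scope.

Definition vanishes (S : G -> set G) :=
  (forall t, M (S t)) /\ forall e : R, 0 < e -> \forall t \near (1%g : G), m (S t) <= e.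

Lemma vanishesU S S' : vanishes S -> vanishes S' ->
  vanishes (fun t => S t `|` S' t).
Proof.
move=> [mS vS] [mS' vS']; split => [t|e e0]; first exact: measurableU.
have e2 : 0 < e / 2 by rewrite divr_gt0.
apply: filterS2 (vS _ e2) (vS' _ e2) => t h h'.
by rewrite (splitr e); exact: prUle.
Qed.

Lemma vanishes_sub S S' : (forall t, M (S t)) -> vanishes S' ->
  (forall t, S t `<=` S' t) -> vanishes S.
Proof.
move=> mS [mS' vS'] SS'; split => // e /vS'; apply: filterS => t.
by apply: le_trans; exact: pr_le.
Qed.

Definition moved (A : set G) t := [set x : G | ~ (A (x * t)%g <-> A x)].

Lemma movedE A t : moved A t =
  ((fun x => (x * t)%g) @^-1` A `\` A) `|` (A `\` (fun x => (x * t)%g) @^-1` A).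
Proof.
apply/seteqP; split => x; rewrite /moved /=; last tauto.
have [] := pselect (A x); have [] := pselect (A (x * t)%g); tauto.
Qed.

Lemma measurable_moved A t : M A -> M (moved A t).
Proof.
move=> mA; rewrite movedE; apply: measurableU; apply: measurableD => //;
exact: measurable_rmul.
Qed.

(** The sets [C n] of points x with [x * V n] inside [A] are closed and increase to [A]. If t and
    t^-1 are in [V n], a point moved into or out of [A] lies, itself or after translation by t, in
    the small remainder [A] minus [C n]. *)
Lemma open_moved (A : set G) : open A -> vanishes (moved A).
Proof.
move=> oA; split => [t|e e0]; first exact: measurable_moved (open_borel oA).
have [V [oV V1 Vd Vb]] := nbhs1_basis pG.
pose C n := [set x : G | forall u, V n u -> A (x * u)%g].
have cC n : closed (C n).
  rewrite (_ : C n = ~` (\bigcup_(y in ~` A) [set x | V n (x^-1 * y)%g])); last first.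
    apply/seteqP; split => x.
      by move=> Cx [y nAy /= /Cx]; rewrite mulVKg.
    move=> nx u Vu; apply: contrapT => nA; apply: nx; exists (x * u)%g => //=.
    by rewrite mulKg.
  apply: open_closedC; apply: bigcup_open => y _.
  apply: (open_comp _ (oV n)).
  move=> x _; apply: (@continuous_mulg G G (fun x => x^-1)%g (fun _ => y)).
    by move=> ?; exact: invg_continuous.
  by move=> ?; exact: cvg_cst.
have mC n : M (C n) by exact: closed_borel.
have CA n : C n `<=` A by move=> x /(_ 1%g (V1 n)); rewrite mulg1.
have Cup : \bigcup_n C n = A.
  apply/seteqP; split => [x [n _ /CA//]|x Ax].
  have /Vb[n nA] : nbhs 1%g [set u | A (x * u)%g].
    by apply/nbhs_lmul; rewrite mulg1; exact: open_nbhs_nbhs.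
  by exists n.
have mA := open_borel oA.
have e2 : 0 < e / 2 by rewrite divr_gt0.
have ndC i j : (i <= j)%N -> C i `<=` C j.
  by move=> ij x Cx u Vu; apply: Cx; exact: Vd Vu.
have [n] := pr_cup mG mC ndC e2.
rewrite Cup => nP.
have mD : M (A `\` C n) by exact: measurableD.
have Dle : m (A `\` C n) <= e / 2.
  have := prU0 mG (mC n) mD; rewrite setDIK setDUK //.
  move=> /(_ erefl); lra.
have Vn : nbhs 1%g (V n) by apply: open_nbhs_nbhs; split.
have Vn' : nbhs 1%g [set t | V n t^-1%g] by apply/nbhs_inv; rewrite invg1.
apply: filterS2 Vn Vn' => t Vt Vt'.
have mD' := measurable_rmul t mD.
have : m ((A `\` C n) `|` [set x | (A `\` C n) (x * t)%g]) <= e / 2 + e / 2.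
  by apply: prUle => //; rewrite /pr haar_rmul.
rewrite -splitr; apply: le_trans; apply: pr_le.
- exact: measurable_moved.
- exact: measurableU.
- move=> x; rewrite movedE => -[[/= Axt nAx]|[/= Ax nAxt]].
  + by right; split => // /(_ _ Vt'); rewrite mulgK.
  + by left; split => // /(_ _ Vt).
Qed.

(** The sets on which translation is continuous in measure form a sigma-algebra, and it contains the
    open sets. *)
Lemma measurable_vanishes (A : set G) : M A -> vanishes (moved A).
Proof.
pose C := [set A : set G | M A /\ vanishes (moved A)].
suff sub : M `<=` C by move=> /sub[].
have sgC : sigma_algebra setT C.
  have C0 : C set0.
    split => //; apply: vanishes_sub (_ : vanishes (fun _ => set0)) _.
    - by move=> t; exact: measurable_moved.
    - by split => // e e0; apply: nearW => t; rewrite pr0 ltW.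
    - by move=> t x; rewrite /moved /=; tauto.
  have CU X Y : C X -> C Y -> C (X `|` Y).
    move=> [mX vX] [mY vY]; split; first exact: measurableU.
    apply: vanishes_sub (vanishesU vX vY) _.
      by move=> t; apply: measurable_moved; exact: measurableU.
    move=> t x; rewrite /moved /=.
    have [] := pselect (X x); have [] := pselect (X (x * t)%g); tauto.
  split => //.
  - move=> X [mX vX]; rewrite setTD; split; first exact: measurableC.
    apply: vanishes_sub vX _.
      by move=> t; apply: measurable_moved; exact: measurableC.
    by move=> t x; rewrite /moved /=; tauto.
  - move=> F CF; have mF n : M (F n) by have [] := CF n.
    have mcF : M (\bigcup_n F n) by exact: bigcupT_measurable.
    split => //; split => [t|e e0]; first exact: measurable_moved.
    pose H n := \big[setU/set0]_(i < n) F i.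
    have CH n : C (H n).
      rewrite /H; elim: n => [|n IH]; first by rewrite big_ord0.
      by rewrite big_ord_recr; exact: CU.
    have Hc : \bigcup_n H n = \bigcup_n F n.
      apply/seteqP; split => x [n _]; rewrite /H.
        by rewrite -bigcup_mkord => -[k _ Fk]; exists k.
      by move=> Fn; exists n.+1 => //; rewrite -bigcup_mkord; exists n => /=.
    have e3 : 0 < e / 3 by rewrite divr_gt0.
    have ndH i j : (i <= j)%N -> H i `<=` H j.
      move=> ij x; rewrite /H -!bigcup_mkord => -[k /= ki Fk].
      by exists k => //=; exact: leq_trans ij.
    have [n] := pr_cup mG (fun n => (CH n).1) ndH e3.
    rewrite Hc => nP; have [mH [_ vH]] := CH n.
    have Hsub : H n `<=` \bigcup_n F n by rewrite -Hc => x Hx; exists n.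
    have mD : M (\bigcup_n F n `\` H n) by exact: measurableD.
    have Dle : m (\bigcup_n F n `\` H n) <= e / 3.
      have := prU0 mG mH mD; rewrite setDIK setDUK //.
      move=> /(_ erefl); lra.
    have {vH} := vH _ e3; apply: filterS => t tP.
    have mD' := measurable_rmul t mD.
    have mHt := measurable_moved t mH.
    have : m (moved (H n) t `|` (\bigcup_n F n `\` H n)
        `|` [set x | (\bigcup_n F n `\` H n) (x * t)%g]) <= e / 3 + e / 3 + e / 3.
      apply: prUle => //; [exact: measurableU|exact: prUle|].
      by rewrite /pr haar_rmul.
    rewrite (_ : e / 3 + e / 3 + e / 3 = e); last by field.
    apply: le_trans; apply: pr_le.
    + exact: measurable_moved.
    + by apply: measurableU => //; exact: measurableU.
    + move: (\bigcup_n F n) (H n) Hsub => U Hn sub x; rewrite /moved /setU /setD /=.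
      have [] := pselect (Hn x); have [] := pselect (Hn (x * t)%g);
      have [] := pselect (U x); have [] := pselect (U (x * t)%g);
      have := sub x; have := sub (x * t)%g; tauto.
apply: smallest_sub => // B oB; split; first exact: open_borel.
exact: open_moved.
Qed.

End translation.

Section translation2.
Variables (R : realType) (G : topGroupType) (mG : probability (borel G) R).
Hypotheses (cG : compact [set: G]) (pG : polish_space R G) (hG : haar_measure mG).
Local Notation m := (pr mG).
Local Notation M := (@measurable _ (borel G)).
Local Open Scope ring_scope.

Lemma measurable_lmoved (A : set G) t : M A -> M [set x | ~ (A (t * x)%g <-> A x)].
Proof.
move=> mA; rewrite (_ : [set _ | _] = ((fun x => (t * x)%g) @^-1` A `\` A)
    `|` (A `\` (fun x => (t * x)%g) @^-1` A)).
  by apply: measurableU; apply: measurableD => //; exact: measurable_lmul.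
apply/seteqP; split => x /=; last tauto.
have [] := pselect (A x); have [] := pselect (A (t * x)%g); tauto.
Qed.

Lemma measurable_lvanishes (A : set G) : M A ->
  vanishes mG (fun t => [set x : G | ~ (A (t * x)%g <-> A x)]).
Proof.
move=> mA; split => [t|e e0]; first exact: measurable_lmoved.
have mA' := measurable_inv mA.
have [_ /(_ e e0)] := measurable_vanishes pG hG mA'.
rewrite -{1}invg1 => /nbhs_inv; apply: filterS => t /=.
apply: le_trans; rewrite le_eqVlt; apply/orP; left; apply/eqP.
rewrite /pr -[in RHS](haar_inv pG hG); last exact: measurable_moved.
by congr (fine (mG _)); apply/seteqP; split => x; rewrite /moved /= invgM !invgK.
Qed.

Section discrete_valued.
Variable D : groupType.
Hypothesis cD : countable [set: D].
Variable f : G -> D.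
Hypothesis mf : @dmeas _ (borel G) D f.

Lemma dmeas_lmul t : @dmeas _ (borel G) D (fun x => f (t * x)%g).
Proof. by move=> a; exact: (@measurable_lmul _ t [set x | f x = a] (mf a)). Qed.

Lemma dmeas_rmul t : @dmeas _ (borel G) D (fun x => f (x * t)%g).
Proof. by move=> a; exact: (@measurable_rmul _ t [set x | f x = a] (mf a)). Qed.

(** Outside a set of measure e / 2 the function takes finitely many values, and each of these fibres
    is moved little. [act] stands for left or right translation. *)
Lemma vanishes_dmeas (act : G -> G -> G) :
  (forall t, M [set x | f (act t x) <> f x]) ->
  (forall A, M A -> vanishes mG (fun t => [set x : G | ~ (A (act t x)%g <-> A x)])) ->
  vanishes mG (fun t => [set x : G | f (act t x) <> f x]).
Proof.
move=> mS vact; split => // e e0.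
have [en es] := countable_group_enum cD.
pose F n := \bigcup_(i < n) [set x | f x = en i].
have mF n : M (F n) by apply: bigcup_measurable => i _; exact: mf.
have ndF i j : (i <= j)%N -> F i `<=` F j.
  by move=> ij x [k /= ki fk]; exists k => //=; exact: leq_trans ij.
have e2 : 0 < e / 2 by rewrite divr_gt0.
have [n] := pr_cup mG mF ndF e2.
rewrite (_ : \bigcup_n F n = setT); last first.
  apply/seteqP; split => // x _; have [k ek] := es (f x).
  by exists k.+1 => //; exists k => /=.
rewrite prT => Fn.
have [mvn vn] : vanishes mG (fun t => \bigcup_(i < n)
    [set x : G | ~ ([set y | f y = en i] (act t x)%g <-> [set y | f y = en i] x)]).
  elim: n {Fn} => [|n IH].
    split => [t|r r0]; first by apply: bigcup_measurable.
    by apply: nearW => t; rewrite bigcup_mkord big_ord0 pr0 ltW.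
  have := vanishesU IH (vact _ (mf (en n))).
  by under eq_fun do rewrite bigcup_mkord; under [X in _ -> vanishes _ X]eq_fun do
    rewrite bigcup_mkord big_ord_recr.
apply: filterS (vn _ e2) => t tn.
have mFC : M (~` F n) by exact: measurableC.
have : m ((\bigcup_(i < n) [set x : G | ~ ([set y | f y = en i] (act t x)%g <->
    [set y | f y = en i] x)]) `|` ~` F n) <= e / 2 + e / 2.
  by apply: prUle => //; rewrite prC //; lra.
rewrite -splitr; apply: le_trans; apply: pr_le => //; first exact: measurableU.
move=> x /= fx; have [[i /= ni fi]|nF] := pselect (F n x); last by right.
by left; exists i => //= -[_ /(_ fi)]; rewrite -fi.
Qed.

Lemma dmeas_rvanishes : vanishes mG (fun t => [set x : G | f (x * t)%g <> f x]).
Proof.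
apply: (@vanishes_dmeas (fun t x => x * t)%g) => [t|A mA].
  by apply: dmeas_neq => //; exact: dmeas_rmul.
exact: measurable_vanishes.
Qed.

Lemma dmeas_lvanishes : vanishes mG (fun t => [set x : G | f (t * x)%g <> f x]).
Proof.
apply: (@vanishes_dmeas (fun t x => t * x)%g) => [t|A mA].
  by apply: dmeas_neq => //; exact: dmeas_lmul.
exact: measurable_lvanishes.
Qed.

End discrete_valued.

(** For u near 1 at most half of the measure of [S] is moved, so [S] still meets its translate in
    positive measure. *)
Lemma steinhaus (S : set G) : M S -> 0 < m S ->
  \forall u \near (1%g : G), 0 < m [set s : G | S s /\ S (s * u)%g].
Proof.
move=> mS S0; have [mv vS] := measurable_vanishes pG hG mS.
have e0 : 0 < m S / 2 by rewrite divr_gt0.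
apply: filterS (vS _ e0) => u uP.
have mI : M [set s : G | S s /\ S (s * u)%g].
  by apply: measurableI => //; exact: measurable_rmul.
have := prU mG mI (mv u).
have : m S <= m ([set s | S s /\ S (s * u)%g] `|` moved S u).
  apply: pr_le => //; first exact: measurableU.
  move=> x Sx; rewrite /moved /setU /=; have [] := pselect (S (x * u)%g); tauto.
by lra.
Qed.

(** Continuity of translation extends the invariance from [L] to every t. Fubini then gives, unless
    [A] is conull, a point x outside [A] with x * t outside [A] for almost every t; by left
    invariance [A] is null. *)
Lemma dense_ergodic (L A : set G) : dense L -> M A ->
  (forall h, L h -> m (moved A h) = 0) -> m A = 0 \/ m A = 1.
Proof.
move=> dL mA AL.
have mA' : M (~` A) by exact: measurableC.
have At t : m (moved A t) = 0.
  apply/eqP; rewrite eq_le pr_ge0 andbT; apply/ler_addgt0Pl => e e0; rewrite addr0.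
  have [_ /(_ e e0) vA] := measurable_vanishes pG hG mA.
  have : nbhs t [set h | m (moved A (t * h^-1)%g) <= e].
    have : nbhs t^-1%g [set h | m (moved A (t * h)%g) <= e].
      by apply/(nbhs_lmul t _ [set u | m (moved A u) <= e]); rewrite mulgV.
    by move=> /nbhs_inv.
  move=> /(dense_nbhs dL)[h Lh /= hP].
  have mm := measurable_moved _ mA.
  have mt := measurable_rmul (t * h^-1)%g (mm h).
  have : m ([set x | moved A h (x * (t * h^-1))%g] `|` moved A (t * h^-1)%g) <= 0 + e.
    by apply: prUle => //; rewrite /pr haar_rmul // -/(m _) AL.
  rewrite add0r; apply: le_trans; apply: pr_le => //; first exact: measurableU.
  move=> x; rewrite /moved /setU /=.
  have -> : (x * (t * h^-1) * h = x * t)%g by rewrite !mulgA mulgVK.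
  have [] := pselect (A x); have [] := pselect (A (x * t)%g);
  have [] := pselect (A (x * (t * h^-1))%g); tauto.
have mE : measurable [set p : borel G * borel G | A (p.2 * p.1 : G)%g /\ ~ A p.2].
  exact: measurableI (measurable_mul2C pG mA) (measurable_pre2 mA').
have /(ae_ysection _ _ mE) : (mG \x mG)%E [set p | A (p.2 * p.1 : G)%g /\ ~ A p.2] = 0%E.
  apply/(ae_xsection _ _ mE); apply/aeW => t.
  apply/negligibleP; first exact: measurable_xsection.
  apply: negligibleS (_ : mG.-negligible (moved A t)).
    move=> x; rewrite /xsection /= inE /moved /=; tauto.
  have mm := measurable_moved t mA.
  by apply/negligibleP => //; apply/pr_eq0.
have [A0|A0] := pselect (mG A = 0%E); first by left; apply/pr_eq0.
move=> H; right; apply/pr_aeP => //; apply: filterS H => x xP.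
apply: contrapT => nAx; apply: A0; rewrite -xP -(haar_lmul hG x mA).
congr (mG _); apply/seteqP; split => t; rewrite /ysection /= inE //=.
by case.
Qed.

(** Local form of the same argument: no u in [W] carries a non-null part of [E] into the rest of
    [N], first for u in [L], then by density for all u. Since every point of [N] is reached from
    every other through [W], Fubini finishes. *)
Lemma local_ergodic (L N W E : set G) : dense L -> open N -> open W -> M E ->
  (forall x y, N x -> N y -> W (y * x^-1)%g) ->
  (forall u, L u -> W u -> m [set x | E x /\ (N `\` E) (u * x)%g] = 0) ->
  E `<=` N -> m E = 0 \/ m (N `\` E) = 0.
Proof.
move=> dL oN oW mE NW EL EN.
have mN := open_borel oN.
have mB : M (N `\` E) by exact: measurableD.
set B := N `\` E in mB EL *.
have mEB u : M [set x | E x /\ B (u * x)%g].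
  by apply: measurableI => //; exact: measurable_lmul.
have Eu u : W u -> m [set x | E x /\ B (u * x)%g] = 0.
  move=> Wu; apply/eqP; rewrite eq_le pr_ge0 andbT; apply/ler_addgt0Pl => e e0; rewrite addr0.
  have [_ /(_ e e0) vB] := measurable_lvanishes mB.
  have : nbhs u [set g | m [set x | ~ (B (u * g^-1 * x)%g <-> B x)] <= e].
    have : nbhs u^-1%g [set g | m [set x | ~ (B (u * g * x)%g <-> B x)] <= e].
      by apply/(nbhs_lmul u _ [set t | m [set x | ~ (B (t * x)%g <-> B x)] <= e]); rewrite mulgV.
    by move=> /nbhs_inv.
  move=> /(filterI (open_nbhs_nbhs (conj oW Wu))) /(dense_nbhs dL)[g Lg [Wg /= gP]].
  have mm := measurable_lmul g (measurable_lmoved (u * g^-1)%g mB).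
  have : m ([set x | E x /\ B (g * x)%g] `|`
      [set x | ~ (B (u * g^-1 * (g * x))%g <-> B (g * x)%g)]) <= 0 + e.
    by apply: prUle => //; [rewrite EL|rewrite /pr (haar_lmul hG g (measurable_lmoved (u * g^-1)%g mB))].
  rewrite add0r; apply: le_trans; apply: pr_le => //; first exact: measurableU.
  move=> x; rewrite /setU /= => -[Ex Bux].
  have -> : (u * g^-1 * (g * x) = u * x)%g by rewrite !mulgA mulgVK.
  have [] := pselect (B (g * x)%g); tauto.
have mF : measurable [set p : borel G * borel G |
    W p.1 /\ (E p.2 /\ B (p.1 * p.2 : G)%g)].
  have mW := @measurable_pre1 _ _ (borel G) (borel G) W (open_borel oW).
  have m2 := @measurable_pre2 _ _ (borel G) (borel G) E mE.
  exact: (measurableI _ _ mW (measurableI _ _ m2 (measurable_mul2 pG mB))).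
have /(ae_ysection _ _ mF) H : (mG \x mG)%E
    [set p : G * G | W p.1 /\ (E p.2 /\ B (p.1 * p.2 : G)%g)] = 0%E.
  apply/(ae_xsection _ _ mF); apply/aeW => u.
  apply/negligibleP; first exact: measurable_xsection.
  have [Wu|nWu] := pselect (W u).
    apply: negligibleS (_ : mG.-negligible [set x | E x /\ B (u * x)%g]).
      by move=> x; rewrite /xsection /= inE /= => -[].
    by apply/negligibleP => //; apply/pr_eq0 => //; exact: Eu.
  apply: negligibleS (negligible_set0 _).
  by move=> x; rewrite /xsection /= inE /= => -[].
have [B0|B0] := pselect (mG B = 0%E); first by right; apply/pr_eq0.
left; apply/pr_eq0 => //; apply/negligibleP => //.
apply: negligibleS H => x Ex /= xP; apply: B0; rewrite -xP -(haar_rmul pG hG x mB).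
congr (mG _); apply/seteqP; split => u; rewrite /ysection /= inE //=; last by case=> _ [].
move=> Bu; split => //; have [Nux _] := Bu.
by have := NW _ _ (EN _ Ex) Nux; rewrite mulgK.
Qed.

(** If a fibre of [f] has positive measure in [N], local ergodicity makes it fill [N]. *)
Lemma local_constant (D : groupType) (L N W : set G) (f : G -> D) :
  countable [set: D] -> @dmeas _ (borel G) D f -> dense L -> open N -> open W ->
  (forall x y, N x -> N y -> W (y * x^-1)%g) ->
  (forall u, L u -> W u ->
    {ae mG, forall x : borel G, N x -> N (u * x : G)%g -> f (u * x)%g = f x}) ->
  exists d, {ae mG, forall x : borel G, N x -> f x = d}.
Proof.
move=> cD mf dL oN oW NW fL.
have mN := open_borel oN.
have [e es] := countable_group_enum cD.
have [[n /eqP n0]|/forallNP n0] := pselect (exists n, m (N `&` [set x | f x = e n]) != 0).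
  have mE : M (N `&` [set x | f x = e n]) by apply: measurableI => //; exact: mf.
  exists (e n); case: (@local_ergodic L N W (N `&` [set x | f x = e n])) => //.
  - move=> u Lu Wu; apply/pr_eq0.
      by apply: measurableI => //; apply: measurable_lmul; exact: measurableD.
    apply/negligibleP.
      by apply: measurableI => //; apply: measurable_lmul; exact: measurableD.
    apply: negligibleS (fL u Lu Wu) => x /= [[Nx fx] [Nux nf]] H.
    by apply: nf; split => //=; rewrite H.
  - have mB : M (N `\` (N `&` [set x | f x = e n])) by exact: measurableD.
    move=> /(pr_eq0 _ mB) /(negligibleP _ mB); apply: negligibleS => x /= H.
    split; first by apply: contrapT => nN; apply: H.
    by move=> [_ fx]; apply: H.
(* All fibres are null in [N], so [N] is null and the constant is arbitrary. *)
exists 1%g; suff N0 : mG.-negligible N.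
  by apply: negligibleS N0 => x /= H; apply: contrapT => nN; apply: H.
apply/negligibleP => //; apply/pr_eq0 => //.
rewrite (_ : N = \bigcup_n (N `&` [set x | f x = e n])); last first.
  apply/seteqP; split => [x Nx|x [n _ []//]].
  by have [n en] := es (f x); exists n => //; split => //=; rewrite en.
apply: pr_cup0 => n; first by apply: measurableI => //; exact: mf.
by apply/eqP/negPn/negP; exact: n0.
Qed.

End translation2.

Section ae_lemmas.
Context d (T : measurableType d) (R : realType) (mu : {measure set T -> \bar R}).

Lemma ae_mono (P Q : T -> Prop) : (forall x, P x -> Q x) ->
  {ae mu, forall x, P x} -> {ae mu, forall x, Q x}.
Proof. by move=> PQ; apply: filterS. Qed.

Lemma ae_mono2 (P P' Q : T -> Prop) : (forall x, P x -> P' x -> Q x) ->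
  {ae mu, forall x, P x} -> {ae mu, forall x, P' x} -> {ae mu, forall x, Q x}.
Proof. by move=> PQ; apply: filterS2. Qed.

Lemma ae_mono3 (P P' P'' Q : T -> Prop) : (forall x, P x -> P' x -> P'' x -> Q x) ->
  {ae mu, forall x, P x} -> {ae mu, forall x, P' x} -> {ae mu, forall x, P'' x} ->
  {ae mu, forall x, Q x}.
Proof. by move=> PQ; apply: filterS3. Qed.

Lemma ae_countable (I : Type) (S : set I) (P : I -> T -> Prop) : countable S ->
  (forall i, S i -> {ae mu, forall x, P i x}) ->
  {ae mu, forall x, forall i, S i -> P i x}.
Proof.
move=> cS H; have [S0|/existsNP[i0 /contrapT Si0]] := pselect (forall i, ~ S i).
  by apply/aeW => x i /S0.
have [e [eS es]] := countable_enum cS Si0.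
have : mu.-negligible (\bigcup_n ~` [set x | P (e n) x]).
  by apply: negligible_bigcup => n; exact: H.
apply: negligibleS => x /= /existsNP[i /not_implyP[Si nP]].
by have [n en] := es i Si; exists n => //=; rewrite en.
Qed.

End ae_lemmas.

Section ae_haar.
Variables (R : realType) (G : topGroupType) (mG : probability (borel G) R).
Hypotheses (cG : compact [set: G]) (pG : polish_space R G) (hG : haar_measure mG).

Lemma ae_lmul g (P : G -> Prop) : {ae mG, forall x : borel G, P x} ->
  {ae mG, forall x : borel G, P (g * x : G)}.
Proof.
move=> [B [mB B0 PB]]; exists [set x | B (g * x)]; split.
- exact: measurable_lmul.
- by rewrite haar_lmul.
- by move=> x /= nP; apply: PB.
Qed.

Lemma ae_rmul g (P : G -> Prop) : {ae mG, forall x : borel G, P x} ->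
  {ae mG, forall x : borel G, P (x * g : G)}.
Proof.
move=> [B [mB B0 PB]]; exists [set x | B (x * g)]; split.
- exact: measurable_rmul.
- by rewrite haar_rmul.
- by move=> x /= nP; apply: PB.
Qed.

Lemma ae_act s (P : G -> Prop) : {ae mG, forall x : borel G, P x} ->
  {ae mG, forall x : borel G, P (lr_act s x : G)}.
Proof.
move=> /(ae_rmul s.2^-1) /(ae_lmul s.1).
by apply: filterS.
Qed.

End ae_haar.

Lemma lr_actM (G : groupType) (s t : G * G) x :
  lr_act (s * t) x = lr_act s (lr_act t x).
Proof. by rewrite /lr_act /= invgM !mulgA. Qed.

(** * Strict cocycles *)

Section strict.
Variables (R : realType) (G : topGroupType) (mG : probability (borel G) R).
Hypotheses (pG : polish_space R G) (hG : haar_measure mG).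
Variables (Gam Lam : set G) (Delta : groupType) (w : G * G -> G -> Delta).
Hypotheses (sGam : subgroup Gam) (cGam : countable Gam).
Hypotheses (sLam : subgroup Lam) (cLam : countable Lam).
Hypothesis cDelta : countable [set: Delta].
Local Notation S := (Gam `*` Lam).
Hypothesis cw : cocycle (X := borel G) S (@lr_act G) mG [set: G] w.

Lemma measurable_dmeas d (T : measurableType d) (f : T -> Delta) :
  measurable_fun [set: T] (f : T -> discrete_group Delta) -> dmeas f.
Proof.
move=> mf a; rewrite -(setTI [set _ | _]).
by apply: (mf measurableT [set a]).
Qed.

Lemma dmeas_measurable d (T : measurableType d) (f : T -> Delta) (Y : set T) :
  dmeas f -> measurable_fun Y (f : T -> discrete_group Delta).
Proof.
move=> mf mY A _; apply: measurableI => //.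
exact: dmeas_preimage.
Qed.

Lemma subgroup_pair s t : S s -> S t -> S (s * t).
Proof.
case: sGam sLam => _ GM _ [_ LM _] [Gs Ls] [Gt Lt].
by split; [exact: GM|exact: LM].
Qed.

Lemma lr_act_measurable (s : G * G) (A : set G) : @measurable _ (borel G) A ->
  @measurable _ (borel G) [set x | A (lr_act s x)].
Proof.
move=> mA; exact: (@measurable_lmul _ s.1 [set x | A (x * s.2^-1)] (measurable_rmul _ mA)).
Qed.

(** [w] is kept on the invariant conull set of points whose whole orbit satisfies the identities,
    and replaced by 1 elsewhere. From then on the cocycle identity can be evaluated at any point
    without tracking null sets. *)
Lemma strict_cocycle : exists w' : G * G -> G -> Delta,
  [/\ forall s, S s -> @dmeas _ (borel G) Delta (w' s),
      forall s t x, S s -> S t -> w' (s * t) x = w' s (lr_act t x) * w' t x &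
      forall s, S s -> {ae mG, forall x : borel G, w s x = w' s x}].
Proof.
have [mw caw] := cw.
have dw s : S s -> @dmeas _ (borel G) Delta (w s) by move=> /mw /measurable_dmeas.
have cS : countable S by exact: countableX.
(* [q.2] runs over the acting group: asking the identity for [q.1] all along the orbit is what makes
   [X] invariant. *)
pose Q (q : (G * G) * (G * G) * (G * G)) (x : G) :=
  w (q.1.1 * q.1.2) (lr_act q.2 x) = w q.1.1 (lr_act q.1.2 (lr_act q.2 x)) * w q.1.2 (lr_act q.2 x).
pose X := [set x : G | forall q, (S `*` S `*` S) q -> Q q x].
have dact s t : S s -> @dmeas _ (borel G) Delta (fun x => w s (lr_act t x)).
  by move=> Ss a; exact: (@lr_act_measurable t [set x | w s x = a] (dw _ Ss a)).
have mQ q : (S `*` S `*` S) q -> @measurable _ (borel G) [set x | Q q x].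
  move=> [[Ss St] Su]; apply: dmeas_eq => //.
    by apply: dact; exact: subgroup_pair.
  apply: dmeasM => //; last exact: dact.
  move=> a; have := @lr_act_measurable q.2 _ (dact q.1.1 q.1.2 Ss a); by [].
have cSSS : countable (S `*` S `*` S) by do 2 apply: countableX => //.
have mX : @measurable _ (borel G) X.
  have S1 : (S `*` S `*` S) ((1, 1), (1, 1), (1, 1)).
    by case: sGam sLam => ? _ _ [? _ _]; do !split.
  have [e [eS es]] := countable_enum cSSS S1.
  rewrite (_ : X = \bigcap_n [set x | Q (e n) x]).
    by apply: bigcapT_measurable => n; apply: mQ.
  apply/seteqP; split => [x Xx n _|x Xx q /es[n <-]]; first exact: Xx.
  exact: Xx.
have aeX : {ae mG, forall x : borel G, X x}.
  apply: ae_countable => // q [[Ss St] Su].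
  apply: (ae_act pG hG q.2
    (P := fun x => w (q.1.1 * q.1.2) x = w q.1.1 (lr_act q.1.2 x) * w q.1.2 x)).
  by apply: ae_mono (caw _ _ Ss St) => x; apply.
have Xact t x : S t -> X x <-> X (lr_act t x).
  move=> St; split => Xx q [Sq1 Sq2].
    have := Xx (q.1, q.2 * t) (conj Sq1 (subgroup_pair Sq2 St)).
    by rewrite /Q /= lr_actM.
  have St' : S t^-1 by case: sGam sLam St => _ _ GV [_ _ LV] [? ?]; split; [exact: GV|exact: LV].
  have := Xx (q.1, q.2 * t^-1) (conj Sq1 (subgroup_pair Sq2 St')).
  by rewrite /Q /= -!lr_actM mulgVK.
have X1 s t x : S s -> S t -> X x -> w (s * t) x = w s (lr_act t x) * w t x.
  move=> Ss St /(_ ((s, t), (1, 1))); rewrite /Q /=.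
  have -> : lr_act (1, 1) x = x by rewrite /lr_act /= mul1g invg1 mulg1.
  apply; do 2 split => //; rewrite /=; by case: sGam sLam => ? _ _ [].
exists (fun s x => if `[< X x >] then w s x else 1); split.
- move=> s Ss a.
  rewrite (_ : [set _ | _] = (X `&` [set x | w s x = a]) `|` (~` X `&` [set _ | (1 : Delta) = a])).
    apply: measurableU; first by apply: measurableI => //; exact: dw.
    apply: measurableI; first exact: measurableC.
    exact: (@dmeas_cst _ (borel G) Delta 1 a).
  apply/seteqP; split => x /=.
    by case: ifPn => /asboolP; [left|right].
  by move=> [[Xx <-]|[nX <-]]; [rewrite asboolT|rewrite asboolF].
- move=> s t x Ss St; have XX := Xact t x St.
  case: ifPn => /asboolP Xx; last first.
    by rewrite asboolF ?mulg1 //; move=> /XX.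
  by rewrite asboolT; [exact: X1|apply/XX].
- move=> s Ss; apply: ae_mono aeX => x Xx.
  by rewrite asboolT.
Qed.

End strict.

(** The points all of whose conjugates lie in [U] form a neighbourhood of 1; its interior is
    conjugation invariant because conjugations are homeomorphisms. *)
Lemma nbhs1_conj_open (G : topGroupType) (U : set G) : compact [set: G] -> nbhs 1 U ->
  exists V, [/\ open V, V 1, forall g y, V y -> V (g * y * g^-1) & V `<=` U].
Proof.
move=> cG U1; have U1' := nbhs1_conj_uniform cG U1.
exists [set y | forall g, U (g * y * g^-1)]°; split.
- exact: open_interior.
- exact: U1'.
- move=> g y Vy; rewrite /interior /=.
  have := @continuous_conj G g^-1 (g * y * g^-1).
  rewrite /continuous_at invgK !mulgA mulVg mul1g mulgVK => H.
  have := H _ Vy; rewrite nbhs_simpl /=; apply: filterS => z /= zU k.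
  by have := zU (k * g); rewrite invgM !mulgA !mulgK.
- by move=> y /interior_subset /(_ 1); rewrite mul1g invg1 mulg1.
Qed.

Lemma near_finite (T : topologicalType) (I : choiceType) (F : set I) (x : T)
    (P : I -> T -> Prop) :
  finite_set F -> (forall i, F i -> \forall y \near x, P i y) ->
  \forall y \near x, forall i, F i -> P i y.
Proof.
move=> /finite_seqP[s ->]; elim: s => [|i s IH] H; first by apply: nearW => y j.
have Hi : \forall y \near x, P i y by apply: H; rewrite /= mem_head.
have {}IH : \forall y \near x, forall j, [set` s] j -> P j y.
  by apply: IH => j js; apply: H; rewrite /= inE js orbT.
apply: filterS2 Hi IH => y Pi Ps j /=; rewrite inE => /orP[/eqP -> //|]; exact: Ps.
Qed.

(** * Uniform stability under small translations *)

Section uniform.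
Variables (R : realType) (G : topGroupType) (mG : probability (borel G) R).
Hypotheses (cG : compact [set: G]) (pG : polish_space R G) (hG : haar_measure mG).
Variables (Gam Lam : set G) (Delta : groupType) (a b : G -> G -> Delta).
Hypotheses (sGam : subgroup Gam) (sLam : subgroup Lam).
Hypothesis fLam : finitely_generated Lam.
Hypothesis se : strongly_ergodic (X := borel G) Gam (fun g x : G => g * x) mG.
Hypothesis cDelta : countable [set: Delta].
Hypothesis ma : forall g, Gam g -> @dmeas _ (borel G) Delta (a g).
Hypothesis mb : forall h, Lam h -> @dmeas _ (borel G) Delta (b h).
Hypothesis bM : forall h k x, Lam h -> Lam k -> b (h * k) x = b h (x * k^-1) * b k x.
Hypothesis ab : forall g h x, Gam g -> Lam h ->
  a g (x * h^-1) * b h x = b h (g * x) * a g x.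
Local Notation m := (pr mG).
Local Notation M := (@measurable _ (borel G)).

Definition unstable (f : G -> Delta) t := [set x : G | f (x * t) <> f x].

Lemma measurable_unstable f t : @dmeas _ (borel G) Delta f -> M (unstable f t).
Proof. by move=> mf; apply: dmeas_neq => //; exact: dmeas_rmul. Qed.

(** Compare [ab] at x and at x * t. If [a g] agrees at x and x * t, and at x * h^-1 and x * t *
    h^-1, then [b h] is stable at x exactly when it is stable at g * x. The last of these points is
    x * h^-1 translated by h * t * h^-1, whence the second term. *)
Lemma translate_unstable g h t : Gam g -> Lam h ->
  (m (((fun x : G => g * x)%g @` unstable (b h) t) `+` unstable (b h) t)
   <= m (unstable (a g) t) + m (unstable (a g) (h * t * h^-1)%g))%R.
Proof.
move=> Gg Lh.
have ma' := measurable_unstable _ (ma Gg); have mb' := measurable_unstable _ (mb Lh).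
have m1 := measurable_lmul g^-1 (ma' t).
have m2 := measurable_lmul g^-1 (measurable_rmul h^-1 (ma' (h * t * h^-1))).
have imE : (fun x : G => g * x)%g @` unstable (b h) t = [set x | unstable (b h) t (g^-1 * x)].
  apply/seteqP; split => [_ [x Ax <-]|x Ax]; first by rewrite /= mulKg.
  by exists (g^-1 * x) => //; rewrite mulVKg.
have : (m ([set x | unstable (a g) t (g^-1 * x)%g] `|`
    [set x | unstable (a g) (h * t * h^-1)%g (g^-1 * x * h^-1)%g])
    <= m (unstable (a g) t) + m (unstable (a g) (h * t * h^-1)%g))%R.
  apply: prUle => //; first by rewrite /pr haar_lmul.
  rewrite /pr (haar_lmul hG g^-1 (measurable_rmul h^-1 (ma' (h * t * h^-1)))).
  by rewrite haar_rmul.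
apply: le_trans; apply: pr_le.
- by rewrite imE; apply: measurableU; apply: measurableD => //; exact: measurable_lmul.
- exact: measurableU.
- rewrite imE => x; rewrite -(mulVKg g x).
  move: (g^-1 * x) => y; rewrite /unstable /setY /setU /setD /= mulKg => H.
  apply: contrapT => /not_orP[/contrapT e1 /contrapT e2].
  have e3 := ab y Gg Lh; have e4 := ab (y * t) Gg Lh.
  move: e2; rewrite !mulgA mulgVK => e2.
  rewrite e1 e2 in e4.
  have : b h (y * t) = b h y <-> b h (g * (y * t)) = b h (g * y).
    split => [e|e]; first by apply: (@mulIg _ (a g y)); rewrite -e3 -e4 e.
    by apply: (@mulgI _ (a g (y * h^-1))); rewrite e3 e4 e.
  rewrite !mulgA in H *; tauto.
Qed.

(** Otherwise there are t_n, with all their conjugates tending to 1, and h_n in [Lam] whose unstable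
    sets have measure between e and 1 - e. They are asymptotically [Gam]-invariant, against strong
    ergodicity. All conjugates of t_n are needed because h_n is not under control. *)
Lemma unstable_dichotomy (e : R) : (0 < e)%R -> \forall t \near (1 : G),
  forall h, Lam h -> (m (unstable (b h) t) <= e \/ 1 - e <= m (unstable (b h) t))%R.
Proof.
move=> e0; have [V [oV V1 Vd Vb]] := nbhs1_basis pG.
pose U n := [set t : G | forall g, V n (g * t * g^-1)].
apply: contrapT => nH.
have bad n : {p : G * G | [/\ Lam p.1, U n p.2 &
    (e < m (unstable (b p.1) p.2) < 1 - e)%R]}.
  apply: cid; apply: contrapT => /forallNP nb; apply: nH.
  have Un : nbhs 1 (U n) by apply: nbhs1_conj_uniform => //; exact: open_nbhs_nbhs.
  apply: filterS Un => t Ut h Lh; apply: contrapT => /not_orP[/negP h1 /negP h2].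
  by apply: (nb (h, t)); split => //=; rewrite !ltNge h1 h2.
pose A n := unstable (b (sval (bad n)).1) (sval (bad n)).2.
have mA n : M (A n).
  by rewrite /A; case: (bad n) => p /= [Lp _ _]; apply: measurable_unstable; exact: mb.
have Ainv s : Gam s -> (fun n => mG (((fun x : G => s * x) @` A n) `+` A n)) @ \oo --> 0%E.
  move=> Gs; have mS n : M (((fun x : G => s * x) @` A n) `+` A n).
    rewrite (_ : _ @` _ = [set x | A n (s^-1 * x)]).
      by apply: measurableU; apply: measurableD => //; exact: measurable_lmul.
    apply/seteqP; split => [_ [x Ax <-]|x Ax]; first by rewrite /= mulKg.
    by exists (s^-1 * x) => //; rewrite mulVKg.
  rewrite (_ : (fun _ => _) = (fun n => (m (((fun x : G => (s * x)%g) @` A n) `+` A n))%:E)); last first.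
    by apply/funext => n; rewrite prE.
  apply: cvg_EFin; first exact: nearW.
  apply/cvgrPdist_le => /= r r0.
  have r2 : (0 < r / 2)%R by rewrite divr_gt0.
  have [_ /(_ _ r2) /Vb[N VN]] := dmeas_rvanishes pG hG cDelta (ma Gs).
  exists N => // n /= Nn; rewrite sub0r normrN ger0_norm ?pr_ge0 //.
  rewrite /A; case: (bad n) => -[h t] /= [Lh Ut _].
  apply: le_trans (translate_unstable t Gs Lh) _.
  rewrite (splitr r); apply: lerD; apply: VN; apply: (Vd _ _ Nn); last exact: Ut.
  by have := Ut 1; rewrite mul1g invg1 mulg1.
(* A measure strictly between e and 1 - e has product with its complement at least e * e. *)
have /fine_cvgP[_ /cvgrPdist_lt /(_ (e * e))%R] := se mA Ainv.
rewrite mulr_gt0 // => /(_ isT)[n _ /(_ n (leqnn n))] /=.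
have -> : (mG (A n) * (1 - mG (A n)))%E = (m (A n) * (1 - m (A n)))%R%:E.
  by rewrite EFinM EFinB prE.
rewrite /= sub0r normrN; have : (e < m (A n) < 1 - e)%R.
  by rewrite /A; case: (bad n) => p /= [].
move=> /andP[e1 e2]; apply/negP; rewrite -leNgt ger0_norm; last first.
  by apply: mulr_ge0; lra.
by apply: ler_pM; lra.
Qed.

(** The h with the bound e for all t in [V] form a subgroup, so generators suffice: a product a
    priori has the bound 2 e, which is below 1 - e as e < 1/3, and the dichotomy brings it back to
    e. Conjugation invariance of [V] absorbs the l * t * l^-1 that arises from the product rule. *)
Lemma uniform_stability (e : R) : (0 < e)%R -> (e < 1 / 3)%R ->
  exists V, [/\ open V, V 1, forall g y, V y -> V (g * y * g^-1) &
    forall h t, Lam h -> V t -> (m (unstable (b h) t) <= e)%R].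
Proof.
move=> e0 e3; have [F fF LE] := fLam.
have LF h : F h -> Lam h by rewrite LE => Fh; exact: sub_gen_smallest.
have gen : \forall t \near (1 : G), forall h, F h -> (m (unstable (b h) t) <= e)%R.
  apply: near_finite => // h /LF Lh.
  by have [_ /(_ e e0)] := dmeas_rvanishes pG hG cDelta (mb Lh).
have [V [oV V1 Vc VU]] := nbhs1_conj_open cG (filterI gen (unstable_dichotomy e0)).
exists V; split => // h t Lh Vt; move: (t) Vt.
pose S := [set h | Lam h /\ forall t, V t -> (m (unstable (b h) t) <= e)%R].
suff : Lam `<=` S by move=> /(_ h Lh)[].
rewrite [X in X `<=` _]LE; apply: smallest_sub; last first.
  by move=> k Fk; split; [exact: LF|move=> u /VU[H _]; exact: H].
have [L1 LM LV] := sLam.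
have small k u : Lam k -> V u -> (m (unstable (b k) u) <= e + e)%R ->
    (m (unstable (b k) u) <= e)%R.
  by move=> Lk /VU[_ /(_ k Lk)[//|]]; lra.
have mU k u : Lam k -> M (unstable (b k) u).
  by move=> Lk; apply: measurable_unstable; exact: mb.
have b1 x : b 1 x = 1.
  by apply: (@mulgI _ (b 1 x)); rewrite mulg1 -[RHS](mulg1) -{3}(mul1g (1:G)) bM // invg1 mulg1 mulg1.
split.
- split => // u Vu; rewrite (_ : unstable _ _ = set0) ?pr0 ?ltW //.
  by apply/seteqP; split => // x; rewrite /unstable /= !b1.
- move=> k l [Lk Sk] [Ll Sl]; split => [|u Vu]; first exact: LM.
  apply: small => //; first exact: LM.
  have Vu' := Vc l _ Vu.
  have ml := measurable_rmul l^-1 (mU k (l * u * l^-1) Lk).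
  have : (m ([set x | unstable (b k) (l * u * l^-1)%g (x * l^-1)%g]
      `|` unstable (b l) u) <= e + e)%R.
    apply: prUle; [exact: ml|exact: mU| |exact: Sl].
    by rewrite /pr haar_rmul //; [exact: Sk|exact: mU].
  apply: le_trans; apply: pr_le; [exact: (mU _ u (LM _ _ Lk Ll))|exact: measurableU ml (mU _ _ Ll)|].
  move=> x; rewrite /unstable /setU /= => H.
  apply: contrapT => /not_orP[/contrapT e1 /contrapT e2]; apply: H.
  by rewrite !bM // e2 -e1 !mulgA mulgVK.
- move=> k [Lk Sk]; split => [|u Vu]; first exact: LV.
  have Vu' := Vc k^-1 _ Vu; rewrite invgK in Vu'.
  have bV x : b k^-1 x = (b k (x * k))^-1.
    by apply/esym/mulg1_eq; rewrite -(b1 x) -(mulgV k) bM ?invgK //; exact: LV.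
  rewrite (_ : unstable _ _ = [set x | unstable (b k) (k^-1 * u * k) (x * k)]).
    by rewrite /pr haar_rmul //; [exact: Sk|exact: mU].
  apply/seteqP; split => x; rewrite /unstable /= !bV !mulgA mulgK.
    by move=> H E; apply: H; rewrite E.
  by move=> H /invg_inj.
Qed.

End uniform.

(** * Convex combinations of discrete-valued functions *)

Section simple_sums.
Context d (T : measurableType d) (R : realType) (P : probability T R).
Local Open Scope ring_scope.
Local Notation m := (pr P).

Lemma simple_sum_integral (s : seq (R * set T)) :
  (forall i, i \in s -> measurable i.2) ->
  P.-integrable setT (EFin \o (fun x => \sum_(i <- s) i.1 * \1_(i.2) x)) /\
  (\int[P]_x (\sum_(i <- s) i.1 * \1_(i.2) x) = \sum_(i <- s) i.1 * m i.2)%R.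
Proof.
elim: s => [|i s IH] ms.
  rewrite big_nil; under eq_fun do rewrite big_nil; split.
    exact: integrable0.
  by rewrite Rintegral_cst // mul0r.
have mi : measurable i.2 by apply: ms; rewrite mem_head.
have [|is1 is2] := IH; first by move=> j js; apply: ms; rewrite inE js orbT.
have ii : P.-integrable setT (EFin \o (\1_(i.2) : T -> R)).
  by apply: integrable_indic => //; rewrite ltey_eq fin_num_measure.
have ii' : P.-integrable setT (EFin \o (fun x => i.1 * \1_(i.2) x)).
  rewrite (_ : _ \o _ = (fun x => i.1%:E * (EFin \o (\1_(i.2) : T -> R)) x)%E) //.
  exact: integrableZl.
rewrite big_cons; under eq_fun do rewrite big_cons; split.
  by rewrite (_ : _ \o _ = (EFin \o (fun x => i.1 * \1_(i.2) x)%R) \+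
    (EFin \o (fun x => \sum_(j <- s) j.1 * \1_(j.2) x)%R))%E //; exact: integrableD.
rewrite RintegralD // is2 RintegralZl //; congr (_ * _ + _).
by rewrite /Rintegral integral_indic // setIT.
Qed.

Lemma simple_sum_ge0 (s : seq (R * set T)) :
  (forall i, i \in s -> measurable i.2) ->
  (forall x, 0 <= \sum_(i <- s) i.1 * \1_(i.2) x) ->
  0 <= \sum_(i <- s) i.1 * m i.2.
Proof.
by move=> ms s0; have [_ <-] := simple_sum_integral ms; apply: Rintegral_ge0.
Qed.

(** Geometric series: the first n sets have total measure at most C (1 - 2^-n). *)
Lemma pr_bigcup_le (B : nat -> set T) (C : R) : (forall n, measurable (B n)) ->
  0 <= C -> (forall n, m (B n) <= C / 2 ^+ n.+1) -> m (\bigcup_n B n) <= C.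
Proof.
move=> mB C0 Bn; apply/ler_addgt0Pl => e e0.
pose H n := \bigcup_(i < n) B i.
have mH n : measurable (H n) by apply: bigcup_measurable.
have ndH i j : (i <= j)%N -> H i `<=` H j.
  by move=> ij x [k /= ki Bk]; exists k => //=; exact: leq_trans ij.
have Hc : \bigcup_n H n = \bigcup_n B n.
  apply/seteqP; split => [x [n _ [k _ Bk]]|x [n _ Bn']]; first by exists k.
  by exists n.+1 => //; exists n => /=.
have [n] := pr_cup P mH ndH e0; rewrite Hc => /le_trans; apply.
rewrite addrC lerD2l.
have : m (H n) <= C * (1 - (2 ^+ n)^-1).
  elim: n => [|n IH]; first by rewrite /H bigcup_mkord big_ord0 pr0 expr0 invr1 subrr mulr0.
  have -> : H n.+1 = H n `|` B n by rewrite /H !bigcup_mkord big_ord_recr.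
  apply: le_trans (prUle (mH n) (mB n) IH (Bn n)) _.
  rewrite exprS invfM; have : (2^-1 : R) = 1 / 2 by lra.
  by move=> ->; lra.
move=> /le_trans; apply; rewrite ler_piMr //.
Qed.

Lemma measurable_ge_set (f : T -> R) (r : R) : measurable_fun setT f ->
  measurable [set x | r <= f x].
Proof.
move=> mf; rewrite (_ : [set _ | _] = setT `&` f @^-1` `[r, +oo[%classic).
  by apply: mf.
by apply/seteqP; split => x /=; rewrite in_itv /= andbT => // -[].
Qed.

End simple_sums.

Section coincidence.
Local Open Scope ring_scope.

(** With f(e) the total weight of the entries carrying e, the right side is the sum of all f(e)^2,
    hence at least the single term f(d)^2. *)
Lemma sum_coincidence_ge (R : realDomainType) (D : eqType) (v : seq (R * D)) (d : D) :
  (\sum_(i <- v) i.1 * (i.2 == d)%:R) ^+ 2 <=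
   \sum_(i <- v) \sum_(j <- v) i.1 * j.1 * (i.2 == j.2)%:R.
Proof.
pose u := undup (d :: map snd v).
have uu : uniq u by exact: undup_uniq.
have vu i : i \in v -> i.2 \in u.
  by move=> iv; rewrite mem_undup inE map_f // orbT.
have du : d \in u by rewrite mem_undup mem_head.
have E i j : i \in v -> (i.2 == j.2)%:R = \sum_(e <- u) (i.2 == e)%:R * (j.2 == e)%:R :> R.
  move=> /vu iu; rewrite (bigD1_seq i.2) //= eqxx mul1r eq_sym big1 ?addr0 //.
  by move=> e; rewrite eq_sym => /negPf ->; rewrite mul0r.
rewrite [leRHS](_ : _ = \sum_(e <- u) (\sum_(i <- v) i.1 * (i.2 == e)%:R) ^+ 2).
  by rewrite (bigD1_seq d) //= lerDl sumr_ge0 // => e _; exact: sqr_ge0.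
transitivity (\sum_(i <- v) \sum_(j <- v) \sum_(e <- u)
    (i.1 * (i.2 == e)%:R) * (j.1 * (j.2 == e)%:R)).
  apply: eq_big_seq => i iv; apply: eq_bigr => j _.
  by rewrite (E _ _ _ iv) mulr_sumr; apply: eq_bigr => e _; ring.
under eq_bigr do rewrite exchange_big; rewrite exchange_big /=.
apply: eq_bigr => e _; rewrite expr2 mulr_suml; apply: eq_bigr => i _.
by rewrite mulr_sumr.
Qed.

End coincidence.

Section convex.
Context dT (T : measurableType dT) (R : realType) (P : probability T R).
Variables (Delta : groupType) (I : eqType) (D : I -> T -> Delta) (Z : set T).
Hypothesis cDelta : countable [set: Delta].
Hypothesis mD : forall i, dmeas (D i).
Hypothesis mZ : measurable Z.
Local Open Scope ring_scope.
Local Notation m := (pr P).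
Implicit Types c : seq (R * I).

(* A weighted list c encodes the function from points to signed measures on Delta
   with value [sum a * delta_(D i p)] at p; [coinc_form] is the scalar product
   in L^2(Z, l^2 Delta) of two such functions. *)
Definition combination c (p : T) (d : Delta) : R :=
  \sum_(i <- c) i.1 * (D i.2 p == d)%:R.

Definition coincidence (h k : I) : R := m (Z `&` [set p | D h p = D k p]).

Definition coinc_form c c' : R :=
  \sum_(i <- c) \sum_(j <- c') i.1 * j.1 * coincidence i.2 j.2.

Definition scale (r : R) c := [seq (r * i.1, i.2) | i <- c].

Lemma form_catl c1 c2 c : coinc_form (c1 ++ c2) c = coinc_form c1 c + coinc_form c2 c.
Proof. by rewrite /coinc_form big_cat. Qed.

Lemma form_catr c c1 c2 : coinc_form c (c1 ++ c2) = coinc_form c c1 + coinc_form c c2.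
Proof. by rewrite /coinc_form -big_split; apply: eq_bigr => i _; rewrite big_cat. Qed.

Lemma form_scalel r c c' : coinc_form (scale r c) c' = r * coinc_form c c'.
Proof.
rewrite /coinc_form /scale big_map mulr_sumr; apply: eq_bigr => i _.
by rewrite mulr_sumr; apply: eq_bigr => j _ /=; rewrite !mulrA.
Qed.

Lemma formC c c' : coinc_form c c' = coinc_form c' c.
Proof.
rewrite /coinc_form exchange_big; apply: eq_bigr => i _; apply: eq_bigr => j _.
rewrite [i.1 * _]mulrC; congr (_ * m (_ `&` _)).
by apply/seteqP; split => p /= ->.
Qed.

Lemma form_scaler r c c' : coinc_form c (scale r c') = r * coinc_form c c'.
Proof. by rewrite formC form_scalel formC. Qed.

Lemma combination_cat c c' p d :
  combination (c ++ c') p d = combination c p d + combination c' p d.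
Proof. by rewrite /combination big_cat. Qed.

Lemma combination_scale r c p d :
  combination (scale r c) p d = r * combination c p d.
Proof.
rewrite /combination /scale big_map mulr_sumr.
by apply: eq_bigr => i _; rewrite mulrA.
Qed.

Lemma measurable_combination c d : measurable_fun setT (fun p => combination c p d).
Proof.
apply: measurable_sum => i; apply: measurable_funM; first exact: measurable_cst.
rewrite (_ : (fun _ => _) = \1_[set p | D i.2 p = d]); last first.
  apply/funext => p; rewrite indicE; congr (_%:R); congr nat_of_bool.
  by apply/eqP/idP; rewrite inE.
by apply: measurable_indic; exact: mD.
Qed.

(** Chebyshev's inequality: the square of one coefficient is at most the squared l^2 norm, whose
    integral over [Z] is the form. *)
Lemma form_ge c d (t : R) : 0 < t ->
  t ^+ 2 * m (Z `&` [set p | t <= `|combination c p d|]) <= coinc_form c c.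
Proof.
move=> t0; set B := _ `&` _.
have mB : measurable B.
  apply: measurableI => //; apply: measurable_ge_set.
  by apply: measurableT_comp => //; exact: measurable_combination.
(* The difference of the two sides is the integral of this combination of indicators, which is
   nonnegative pointwise. *)
pose s := (- t ^+ 2, B) ::
  [seq (i.1 * j.1, Z `&` [set p | D i.2 p = D j.2 p]) | i <- c, j <- c].
have ms i : i \in s -> measurable i.2.
  rewrite inE => /orP[/eqP -> //|/allpairsP[[j k] [_ _ ->]] /=].
  by apply: measurableI => //; exact: dmeas_eq.
have -> : coinc_form c c = \sum_(i <- s) i.1 * m i.2 + t ^+ 2 * m B.
  rewrite big_cons /= mulNr addrAC addNr add0r big_allpairs_dep.
  by [].
rewrite lerDr; apply: simple_sum_ge0 => // p; rewrite big_cons /= mulNr.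
rewrite big_allpairs_dep /= addrC subr_ge0.
have [Zp|nZp] := pselect (Z p); last first.
  rewrite (_ : \1_B p = 0) ?mulr0; last by rewrite indicE memNset // => -[].
  rewrite big1 // => i _; rewrite big1 // => j _.
  by rewrite indicE memNset ?mulr0 // => -[].
have := sum_coincidence_ge [seq (i.1, D i.2 p) | i <- c] d.
rewrite !big_map; under [X in _ <= X -> _]eq_bigr do rewrite big_map.
rewrite -/(combination c p d) /= => H.
apply: (@le_trans _ _ (combination c p d ^+ 2)); last first.
  apply: le_trans H _; rewrite le_eqVlt; apply/orP; left; apply/eqP.
  apply: eq_bigr => i _; apply: eq_bigr => j _; congr (_ * _).
  rewrite indicE; congr (_%:R); congr nat_of_bool.
  by apply/eqP/idP; rewrite inE => // -[].
rewrite indicE; have [|_] := boolP (p \in B); last by rewrite mulr0 sqr_ge0.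
rewrite inE mulr1 => -[_ /= tc]; rewrite -[leRHS]real_normK ?num_real //.
by rewrite ler_sqr ?nnegrE // ltW.
Qed.

Variables (L : set I) (i0 : I).
Hypothesis Li0 : L i0.

Definition convex_weights c :=
  (forall i, i \in c -> 0 <= i.1 /\ L i.2) /\ \sum_(i <- c) i.1 = 1.

Lemma form_ge0 c : convex_weights c -> 0 <= coinc_form c c.
Proof.
move=> [Hc _]; rewrite /coinc_form big_seq sumr_ge0 // => i ic.
rewrite big_seq sumr_ge0 // => j jc; rewrite mulr_ge0 ?pr_ge0 //.
by rewrite mulr_ge0 //; [exact: (Hc i ic).1|exact: (Hc j jc).1].
Qed.

Lemma convex_midpoint c c' : convex_weights c -> convex_weights c' ->
  convex_weights (scale (1 / 2) c ++ scale (1 / 2) c').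
Proof.
move=> [Hc sc] [Hc' sc']; split.
  by move=> i; rewrite mem_cat => /orP[] /mapP[j jc ->] /=;
    [have [j0 Lj] := Hc _ jc|have [j0 Lj] := Hc' _ jc]; split => //; rewrite mulr_ge0.
by rewrite big_cat !big_map -!mulr_sumr /= sc sc'; lra.
Qed.

Lemma form_infimum : exists q, (forall c, convex_weights c -> q <= coinc_form c c) /\
  forall e, 0 < e -> exists2 c, convex_weights c & coinc_form c c < q + e.
Proof.
pose E := [set coinc_form c c | c in convex_weights].
have hE : has_inf E.
  split; last by exists 0 => _ [c cc <-]; exact: form_ge0.
  exists (coinc_form [:: (1, i0)] [:: (1, i0)]), [:: (1, i0)] => //.
  by split; [move=> i; rewrite inE => /eqP ->|rewrite big_seq1].
exists (inf E); split=> [c cc|e e0].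
  by apply: ge_inf; [case: hE|exists c].
by have [_ [c cc <-] ce] := inf_adherent e0 hE; exists c.
Qed.

(** Parallelogram law: the midpoint also has form at least q, so the form of c - c' is at most 2 (q
    + e) + 2 (q + e) - 4 q = 4 e. *)
Lemma near_minimizers_close q c c' (e t : R) d :
  (forall c, convex_weights c -> q <= coinc_form c c) ->
  convex_weights c -> convex_weights c' -> coinc_form c c < q + e -> coinc_form c' c' < q + e ->
  0 < t ->
  t ^+ 2 * m (Z `&` [set p | t <= `|combination c p d - combination c' p d|]) <= 4 * e.
Proof.
move=> qP cc cc' qc qc' t0.
have := form_ge (c ++ scale (- 1) c') d t0.
rewrite (_ : [set p | _] = [set p | t <= `|combination c p d - combination c' p d|]); last first.
  by apply/seteqP; split => p /=; rewrite combination_cat combination_scale mulN1r.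
move=> /le_trans; apply.
have := qP _ (convex_midpoint cc cc').
rewrite !(form_catl, form_catr, form_scalel, form_scaler) (formC c' c); lra.
Qed.

End convex.

(** * Conjugating translated cocycles *)

Section fixed_point.
Variables (R : realType) (G : topGroupType) (mG : probability (borel G) R).
Hypotheses (cG : compact [set: G]) (pG : polish_space R G) (hG : haar_measure mG).
Variables (Lam : set G) (Delta : groupType) (b : G -> G -> Delta).
Hypothesis sLam : subgroup Lam.
Hypothesis cDelta : countable [set: Delta].
Hypothesis mb : forall h, @dmeas _ (borel G) Delta (b h).
Hypothesis bM : forall h k x, Lam h -> Lam k -> b (h * k) x = b h (x * k^-1) * b k x.
Local Notation m := (pr mG).
Local Notation M := (@measurable _ (borel G)).
Local Notation T := (borel G * borel G)%type.
Local Notation m2 := (pr (mG \x mG)%E).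

(** Right translation twisted by [b] acts on [Delta]-valued functions of p, and this is the image of
    the constant 1 under h^-1. A fixed point of that action conjugates the translated cocycle to
    [b]. *)
Definition discrepancy (h : G) (p : T) : Delta := (b h p.2)^-1 * b h (p.1 * p.2 : G).

Lemma measurable_discrepancy h : dmeas (discrepancy h).
Proof.
apply: dmeasM => //.
  apply: dmeasV => //; exact: (@dmeas_comp _ _ T (borel G) _ (b h) snd).
apply: (@dmeas_comp _ _ T (borel G) _ (b h) (fun p => (p.1 * p.2 : G))) => //.
apply: (continuous2_borel pG).
by apply: continuous_mulg => x; [exact: cvg_fst|exact: cvg_snd].
Qed.

Definition pair_rmul (k : G) (p : T) : T := (p.1, p.2 * k^-1 : G).

Definition twist (k : G) (p : T) (d : Delta) : Delta :=
  b k p.2 * d * (b k (p.1 * p.2 : G))^-1.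

Lemma discrepancy_pair_rmul h k p : Lam h -> Lam k ->
  discrepancy h (pair_rmul k p) = twist k p (discrepancy (h * k) p).
Proof.
move=> Lh Lk; rewrite /discrepancy /pair_rmul /twist /= !bM // invgM !mulgA mulgV mul1g.
by rewrite mulgK.
Qed.

Lemma twist_inj k p : injective (twist k p).
Proof. by move=> d d' /mulIg /mulgI. Qed.

Lemma pair_rmul_preserving k (E : set T) : measurable E ->
  (mG \x mG)%E (pair_rmul k @^-1` E) = (mG \x mG)%E E.
Proof.
move=> mE; rewrite !prod_xE; apply: eq_integral => s _.
rewrite -[RHS](haar_rmul pG hG k^-1); last exact: measurable_xsection.
by congr (mG _); apply/seteqP; split => x; rewrite /xsection /= !inE.
Qed.

Variables (V : set G) (e : R).
Hypotheses (oV : open V) (V1 : V 1) (e0 : (0 < e)%R).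
Let Z : set T := [set p | V p.1].
Hypothesis small : forall h, Lam h ->
  (m2 (Z `&` [set p | discrepancy h p <> 1%g]) <= e * m V)%R.
Local Open Scope ring_scope.

Let mZ : measurable Z.
Proof. exact: (@measurable_pre1 _ _ (borel G) (borel G) V (open_borel oV)). Qed.

Let mV0 : 0 < m V.
Proof. by apply: (@haar_open R G mG cG pG hG V 1%g); [exact: open_nbhs_nbhs|exact: open_borel]. Qed.

Let comb := combination (R := R) discrepancy.
Let frm := coinc_form (mG \x mG)%E discrepancy Z.
Let weights := @convex_weights R G Lam.

Definition translate (k : G) (c : seq (R * G)) := [seq (i.1, (i.2 * k)%g) | i <- c].

Lemma translate_weights k c : Lam k -> weights c -> weights (translate k c).
Proof.
move=> Lk [cP c1]; split; last by rewrite big_map.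
by move=> i /mapP[j /cP[j0 Lj] ->]; split => //=; case: sLam => _ LM _; exact: LM.
Qed.

(** Translating by k moves points by a measure preserving map that keeps [Z], and values by an
    injective one, so coincidences keep their measure. *)
Lemma form_translate k c : Lam k -> weights c -> frm (translate k c) (translate k c) = frm c c.
Proof.
move=> Lk [cP _]; rewrite /frm /coinc_form big_map.
apply: eq_big_seq => i /cP[_ Li]; rewrite big_map; apply: eq_big_seq => j /cP[_ Lj] /=.
congr (_ * _); rewrite /coincidence /pr; congr fine.
rewrite -[RHS](pair_rmul_preserving k); last first.
  by apply: measurableI => //; apply: dmeas_eq => //; exact: measurable_discrepancy.
congr ((mG \x mG)%E _); apply/seteqP; split => p [Zp] /=.
  by move=> H; split => //=; rewrite !discrepancy_pair_rmul // H.
by rewrite !discrepancy_pair_rmul // => /twist_inj H.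
Qed.

Lemma comb_translate k c p d : Lam k -> weights c ->
  comb (translate k c) p d = comb c (pair_rmul k p) (twist k p d).
Proof.
move=> Lk [cP _]; rewrite /comb /combination big_map.
apply: eq_big_seq => i /cP[_ Li] /=.
by rewrite discrepancy_pair_rmul // (inj_eq (@twist_inj k p)).
Qed.

(** This excludes two atoms of mass above 1/2, whence the uniqueness of the selected value. *)
Lemma comb_le1 c p d d' : weights c -> d <> d' -> comb c p d + comb c p d' <= 1.
Proof.
move=> [cP <-] dd'; rewrite /comb /combination -big_split big_seq [leRHS]big_seq.
apply: ler_sum => i /cP[i0 _] /=; rewrite -mulrDr ler_piMr // -natrD.
have [->|_] := eqVneq (discrepancy i.2 p) d; last by case: eqP.
by case: eqP => // /dd'.
Qed.

(* Near-minimizers of [coinc_form] on the convex hull of the orbit of 1 form a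
   Cauchy sequence; its limit is invariant and, being close to the constant
   point mass at 1, has for most points a unique atom of mass above 1/2. *)
Lemma fixed_point : exists A : Delta -> set T,
  [/\ forall d, measurable (A d),
      forall p d d', A d p -> A d' p -> d = d',
      forall k d, Lam k ->
        {ae (mG \x mG)%E, forall p, Z p -> (A d p <-> A (twist k p d) (pair_rmul k p))} &
      m2 (Z `\` A 1%g) <= 5 * e * m V].
Proof.
have quarter (x y : R) : 1 / 4 * x <= y -> x <= 4 * y by lra.
have L1 : Lam 1%g by case: sLam.
have mr := measurable_discrepancy.
have [q [qle qinf]] := form_infimum (mG \x mG)%E discrepancy Z L1.
pose eta := e * m V; have eta0 : 0 < eta by rewrite mulr_gt0.
(* The [tau n] sum to 1/8, the gap between the mass 3/4 that is available at the start and the mass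
   5/8 that is kept in the limit. *)
pose tau n : R := (2 ^+ (n + 4))^-1.
have tau0 n : 0 < tau n by rewrite invr_gt0 exprn_gt0.
(* Solves 4 * kap n = tau n ^+ 2 * (eta / 2 ^+ n.+1): combinations whose forms are both below q +
   kap n differ by [tau n] or more at d only on a set of measure eta / 2 ^+ n.+1. *)
pose kap n := tau n ^+ 2 * (eta / 2 ^+ n.+1) / 4.
have kap0 n : 0 < kap n.
  by rewrite divr_gt0 // mulr_gt0 ?exprn_gt0 // divr_gt0 // exprn_gt0.
have kapS n : kap n.+1 <= kap n.
  rewrite ler_pM2r ?invr_gt0 //; apply: ler_pM.
  - by rewrite sqr_ge0.
  - by rewrite divr_ge0 ?exprn_ge0 // ltW.
  - have tauS : tau n.+1 <= tau n.
      rewrite /tau lef_pV2 ?posrE ?exprn_gt0 //.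
      by rewrite addSn exprS ler_peMl ?exprn_ge0 //; lra.
    by rewrite ler_pXn2r // nnegrE; exact: ltW.
  - rewrite ler_pM2l // lef_pV2 ?posrE ?exprn_gt0 //.
    by rewrite [leRHS]exprS ler_peMl ?exprn_ge0 //; lra.
pose c n := sval (cid2 (qinf _ (kap0 n))).
have wc n : weights (c n) by rewrite /c; case: cid2.
have fc n : frm (c n) (c n) < q + kap n by rewrite /c; case: cid2.
have close n c' d : weights c' -> frm c' c' < q + kap n ->
    m2 (Z `&` [set p | tau n <= `|comb (c n) p d - comb c' p d|]) <= eta / 2 ^+ n.+1.
  move=> wc' fc'.
  have := near_minimizers_close cDelta mr mZ d qle (wc n) wc' (fc n) fc' (tau0 n).
  have -> : 4 * kap n = tau n ^+ 2 * (eta / 2 ^+ n.+1) by rewrite /kap mulrC divfK.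
  by rewrite ler_pM2l // exprn_gt0.
have mcomb c' d : measurable_fun setT (fun p => comb c' p d) by exact: measurable_combination.
have mclose c1 c2 d (t : R) :
    measurable (Z `&` [set p | t <= `|comb c1 p d - comb c2 p d|]).
  apply: measurableI => //; apply: measurable_ge_set.
  by apply: measurableT_comp => //; apply: measurable_funB.
(* Points where the mass at d is eventually above 1/2 by a fixed margin; the margin makes the
   condition insensitive to errors of size [tau n]. *)
pose A d := \bigcup_k \bigcup_N \bigcap_n
  [set p | (N <= n)%N -> 1 / 2 + k.+1%:R^-1 <= comb (c n) p d].
have AP d p : A d p <-> exists k N, forall n, (N <= n)%N ->
    1 / 2 + k.+1%:R^-1 <= comb (c n) p d.
  split; first by move=> [k _ [N _ H]]; exists k, N => n Nn; exact: H.
  by move=> [k [N H]]; exists k => //; exists N => // n _ /=; exact: H.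
have k0 k : 0 < (k.+1%:R^-1 : R) by rewrite invr_gt0.
exists A; split.
- move=> d; apply: bigcupT_measurable => k; apply: bigcupT_measurable => N.
  apply: bigcapT_measurable => n.
  have [Nn|nN] := boolP (N <= n)%N.
    rewrite (_ : [set _ | _] = [set p | 1 / 2 + k.+1%:R^-1 <= comb (c n) p d]).
      exact: measurable_ge_set.
    by apply/seteqP; split => p //= /(_ isT).
  by rewrite (_ : [set _ | _] = setT) //; apply/seteqP; split.
- move=> p d d' /AP[k [N H]] /AP[k' [N' H']]; apply: contrapT => dd'.
  have := H _ (leq_maxl N N'); have := H' _ (leq_maxr N N').
  have := comb_le1 p (wc (maxn N N')) dd'.
  have := k0 k; have := k0 k'.
  move: (k.+1%:R^-1) (k'.+1%:R^-1) (comb _ _ d) (comb _ _ d') => *; lra.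
- move=> k d Lk.
  pose B n := Z `&` [set p | tau n <= `|comb (c n) p d - comb (translate k (c n)) p d|].
  have mB n : measurable (B n) by exact: mclose.
  have Bn n : m2 (B n) <= eta / 2 ^+ n.+1.
    apply: close; first exact: translate_weights.
    by rewrite form_translate.
  (* Borel-Cantelli: almost every point lies in only finitely many [B n]. *)
  have mtail N : measurable (\bigcup_n B (N + n)%N) by exact: bigcupT_measurable.
  have tail N : m2 (\bigcup_n B (N + n)%N) <= eta / 2 ^+ N.
    apply: pr_bigcup_le => // [|n]; first by rewrite divr_ge0 ?exprn_ge0 // ltW.
    apply: le_trans (Bn _) _.
    by rewrite -mulrA -invfM -exprD -addnS.
  have mlim : measurable (\bigcap_N \bigcup_n B (N + n)%N) by exact: bigcapT_measurable.
  have lim0 : m2 (\bigcap_N \bigcup_n B (N + n)%N) = 0.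
    apply/eqP; rewrite eq_le pr_ge0 andbT; apply/ler_addgt0Pl => r r0; rewrite addr0.
    have [N NP] : exists N, eta / 2 ^+ N <= r.
      exists (Num.Def.truncn (eta / r)).+1; have NP := truncnS_gt (eta / r).
      move: (Num.Def.truncn _).+1 NP => N NP; rewrite ler_pdivrMr ?exprn_gt0 // mulrC -ler_pdivrMr //.
      apply: le_trans (ltW NP) _; rewrite -natrX ler_nat.
      exact: ltnW (ltn_expl _ _).
    apply: le_trans NP; apply: le_trans (tail N); apply: pr_le => //.
    by move=> p /(_ N I).
  have : {ae (mG \x mG)%E, forall p, ~ (\bigcap_N \bigcup_n B (N + n)%N) p}.
    apply: negligibleS (_ : negligible _ (\bigcap_N \bigcup_n B (N + n)%N)).
      by move=> p /= /contrapT.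
    by apply/negligibleP => //; apply/pr_eq0.
  apply: ae_mono => p nlim Zp.
  have {nlim}[N cl] : exists N, forall n, (N <= n)%N ->
      `|comb (c n) p d - comb (translate k (c n)) p d| < tau n.
    have /existsNP[N /not_implyP[_ nB]] := nlim.
    exists N => n Nn; rewrite ltNge; apply/negP => tn; apply: nB.
    by exists (n - N)%N => //; rewrite subnKC //; split.
  have conv f g : (forall n, (N <= n)%N -> `|f n - g n| < tau n) ->
      (exists k N, forall n, (N <= n)%N -> 1 / 2 + k.+1%:R^-1 <= f n) ->
      (exists k N, forall n, (N <= n)%N -> 1 / 2 + k.+1%:R^-1 <= g n).
    (* The margin shrinks from 1 / (j + 1) to 1 / (2 j + 3), and for n at least 2 (j + 1) the error
       [tau n] fits into the difference. *)
    move=> fg [j [N' fN']]; exists (2 * j.+1)%N.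
    exists (maxn (maxn N N') (2 * j.+1)%N) => n; rewrite !geq_max => /andP[/andP[Nn N'n] jn].
    have := fN' _ N'n; have := fg _ Nn.
    have tn : tau n <= (2 * j.+1)%:R^-1 * (1 / 8).
      rewrite /tau exprD invfM; apply: ler_pM; rewrite ?invr_ge0 ?exprn_ge0 //.
        rewrite lef_pV2 ?posrE ?exprn_gt0 ?ltr0n // -natrX ler_nat.
        by apply: leq_trans jn _; apply: ltnW; exact: ltn_expl.
      by rewrite (_ : 2 ^+ 4 = 16 :> R); [lra|ring].
    have jj : (2 * j.+1).+1%:R^-1 <= (2 * j.+1)%:R^-1 :> R.
      by rewrite lef_pV2 ?posrE ?ltr0n // ler_nat.
    have j2 : j.+1%:R^-1 = 2 * (2 * j.+1)%:R^-1 :> R.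
      by rewrite natrM invfM mulrA mulfV ?mul1r // pnatr_eq0.
    have := k0 (2 * j + 1)%N; rewrite (_ : (2 * j + 1).+1 = (2 * j.+1)%N); last by rewrite mulnS addn1 add2n.
    rewrite j2; move: tn jj.
    move: ((2 * j.+1)%:R^-1) ((2 * j.+1).+1%:R^-1) (tau n) (f n) (g n) => u u' t y z tq qq q0.
    rewrite ltr_norml => /andP[] *; lra.
  have E n : comb (translate k (c n)) p d = comb (c n) (pair_rmul k p) (twist k p d).
    exact: comb_translate.
  split=> [/AP/conv H|/AP/conv H]; apply/AP; apply: H => n Nn.
    by rewrite -E; exact: cl.
  by rewrite -E distrC; exact: cl.
- pose B n := Z `&` [set p | tau n <= `|comb (c n) p 1%g - comb (c n.+1) p 1%g|].
  have mB n : measurable (B n) by exact: mclose.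
  have Bn n : m2 (B n) <= eta / 2 ^+ n.+1.
    apply: close => //; apply: lt_le_trans (fc n.+1) _; by rewrite lerD2l.
  have mUB : measurable (\bigcup_n B n) by exact: bigcupT_measurable.
  have UB : m2 (\bigcup_n B n) <= eta by apply: pr_bigcup_le => //; exact: ltW.
  (* By Markov's inequality the first combination has mass at most 3/4 at 1 only on a set of measure
     4 eta. Together with the eta for the union of the [B n] this is the 5 of the statement. *)
  pose E := Z `&` [set p | 1 / 4 <= 1 - comb (c 0) p 1%g].
  have mE : measurable E.
    apply: measurableI => //; apply: measurable_ge_set.
    by apply: measurable_funB.
  have Ele : m2 E <= 4 * eta.
    have [cP c1] := wc 0.
    pose s := (- (1 / 4), E) :: [seq (i.1, Z `&` [set p | discrepancy i.2 p <> 1%g]) | i <- c 0].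
    have mn i : measurable (Z `&` [set p | discrepancy i p <> 1%g]).
      apply: measurableI => //; apply: dmeas_neq => //; exact: dmeas_cst.
    have : 0 <= \sum_(i <- s) i.1 * m2 i.2.
      apply: simple_sum_ge0.
        move=> i; rewrite inE => /orP[/eqP -> //|/mapP[j _ -> /=]]; exact: mn.
      move=> p; rewrite big_cons big_map /= mulNr addrC subr_ge0 indicE.
      have sum_ge0 : 0 <= \sum_(j <- c 0) j.1 * \1_(Z `&` [set p | discrepancy j.2 p <> 1%g]) p.
        by rewrite big_seq sumr_ge0 // => i /cP[i0 _]; rewrite mulr_ge0.
      have [|_] := boolP (p \in E); last by rewrite mulr0.
      rewrite inE mulr1 => -[Zp /= /le_trans]; apply.
      rewrite -c1 /comb /combination -sumrB big_seq [leRHS]big_seq ler_sum // => i /cP[i0 _].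
      rewrite -[X in X - _]mulr1 -mulrBr ler_pM //; first by case: eqP => _; rewrite ?subrr ?subr0.
      rewrite indicE; case: eqP => [|ne]; first by rewrite subrr.
      by rewrite subr0 mem_set.
    rewrite big_cons big_map /= mulNr addrC subr_ge0 => h.
    have : \sum_(i <- c 0) i.1 * m2 (Z `&` [set p | discrepancy i.2 p <> 1%g]) <= eta.
      rewrite -[leRHS]mul1r -c1 mulr_suml big_seq [leRHS]big_seq ler_sum // => i /cP[i0 Li].
      by rewrite ler_pM ?pr_ge0 //; exact: small.
    by move=> /(le_trans h) /quarter.
  have : m2 (E `|` \bigcup_n B n) <= 4 * eta + eta by exact: prUle.
  rewrite (_ : 4 * eta + eta = 5 * e * m V); last by rewrite /eta; ring.
  apply: le_trans; apply: pr_le.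
  + apply: measurableD => //.
    apply: bigcupT_measurable => k; apply: bigcupT_measurable => N.
    apply: bigcapT_measurable => n.
    have [Nn|nN] := boolP (N <= n)%N.
      rewrite (_ : [set _ | _] = [set p | 1 / 2 + k.+1%:R^-1 <= comb (c n) p 1%g]).
        exact: measurable_ge_set.
      by apply/seteqP; split => p //= /(_ isT).
    by rewrite (_ : [set _ | _] = setT) //; apply/seteqP; split.
  + exact: measurableU.
  + move=> p [Zp nA]; apply: contrapT => /not_orP[nE nB]; apply: nA; apply/AP.
    have c0p : 3 / 4 < comb (c 0) p 1%g.
      by rewrite ltNge; apply/negP => h; apply: nE; split => //=; lra.
    (* The margin is 1/8, since 1/2 + 1/8 = 5/8. The mass that can still be lost from step n on is
       at most tau n + tau n / 2 + ... = 2 tau n, which is why the induction carries this term. *)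
    exists 7%N, 0%N => n _.
    have : 5 / 8 + 2 * tau n <= comb (c n) p 1%g; last by have := tau0 n; lra.
    elim: n => [|n IH].
      rewrite /tau add0n (_ : 2 ^+ 4 = 16 :> R); [lra|ring].
    have : `|comb (c n) p 1%g - comb (c n.+1) p 1%g| < tau n.
      by rewrite ltNge; apply/negP => h; apply: nB; exists n.
    rewrite (_ : tau n.+1 = tau n * (1 / 2)); last first.
      by rewrite /tau addSn exprS invfM; field.
    rewrite ltr_norml => /andP[] *; lra.
Qed.

End fixed_point.

Section product_sections.
Context d1 d2 (T1 : measurableType d1) (T2 : measurableType d2) (R : realType).
Variables (P1 : probability T1 R) (P2 : probability T2 R).
Local Notation m2 := (pr (P1 \x P2)%E).
Local Open Scope ring_scope.

Lemma xsection_slice (E : set (T1 * T2)) s : xsection E s = [set x | E (s, x)].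
Proof. by apply/seteqP; split => x; rewrite /xsection /= inE. Qed.

Lemma measurable_slice (E : set (T1 * T2)) s : measurable E ->
  measurable [set x | E (s, x)].
Proof. by rewrite -xsection_slice; exact: measurable_xsection. Qed.

Lemma ysection_slice (E : set (T1 * T2)) x : ysection E x = [set s | E (s, x)].
Proof. by apply/seteqP; split => s; rewrite /ysection /= inE. Qed.

Lemma pr_prod_xE (E : set (T1 * T2)) : measurable E ->
  (m2 E)%:E = (\int[P1]_x P2 (xsection E x))%E.
Proof. by move=> mE; rewrite prE. Qed.

Lemma pr_prod_yE (E : set (T1 * T2)) : measurable E ->
  (m2 E)%:E = (\int[P2]_y P1 (ysection E y))%E.
Proof. by move=> mE; rewrite prE //; exact: prod_yE. Qed.

Let indic_integral (U : set T1) (r : R) : measurable U -> 0 <= r ->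
  (\int[P1]_s (r * \1_U s)%:E = (r * pr P1 U)%:E)%E.
Proof.
move=> mU r0; under eq_integral do rewrite EFinM.
rewrite ge0_integralZl_EFin //; last first.
  by apply/measurable_EFinP; exact: measurable_indic.
by rewrite integral_indic // setIT EFinM prE.
Qed.

Lemma section_ge (E : set (T1 * T2)) (U : set T1) (r : R) :
  measurable E -> measurable U -> 0 <= r ->
  (forall s, U s -> r <= pr P2 [set x | E (s, x)]) -> r * pr P1 U <= m2 E.
Proof.
move=> mE mU r0 UE; rewrite -lee_fin pr_prod_xE // -indic_integral //.
apply: ge0_le_integral => //.
- by move=> s _; rewrite lee_fin mulr_ge0.
- by apply/measurable_EFinP; apply: measurable_funM => //; exact: measurable_indic.
- exact: measurable_fun_xsection.
- move=> s _; rewrite xsection_slice -prE; last exact: measurable_slice.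
  rewrite lee_fin indicE; have [|_] := boolP (s \in U); last by rewrite mulr0 pr_ge0.
  by rewrite inE mulr1 => /UE.
Qed.

Lemma section_le (E : set (T1 * T2)) (U : set T1) (r : R) :
  measurable E -> measurable U -> 0 <= r ->
  (forall s x, E (s, x) -> U s) ->
  (forall s, U s -> pr P2 [set x | E (s, x)] <= r) -> m2 E <= r * pr P1 U.
Proof.
move=> mE mU r0 EU UE; rewrite -lee_fin pr_prod_xE // -indic_integral //.
apply: ge0_le_integral => //.
- exact: measurable_fun_xsection.
- by apply/measurable_EFinP; apply: measurable_funM => //; exact: measurable_indic.
- move=> s _; rewrite xsection_slice -prE; last exact: measurable_slice.
  rewrite lee_fin indicE; have [Us|nUs] := pselect (U s).
    by rewrite mem_set // mulr1; exact: UE.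
  rewrite memNset // mulr0 (_ : [set _ | _] = set0) ?pr0 //.
  by apply/seteqP; split => // x /EU.
Qed.

Lemma ae_slices (Q : T1 * T2 -> Prop) : {ae (P1 \x P2)%E, forall p, Q p} ->
  {ae P1, forall s, {ae P2, forall x, Q (s, x)}}.
Proof.
move=> [B [mB B0 QB]]; have /(ae_xsection _ _ mB) := B0.
apply: ae_mono => s; rewrite xsection_slice => Bs.
exists [set x | B (s, x)]; split => //; first exact: measurable_slice.
by move=> x /= nQ; apply: QB.
Qed.

Lemma ae_swap (Q : T1 * T2 -> Prop) : measurable [set p | Q p] ->
  {ae P1, forall s, {ae P2, forall x, Q (s, x)}} ->
  {ae P2, forall x, {ae P1, forall s, Q (s, x)}}.
Proof.
move=> mQ H; have mC := measurableC mQ.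
have : (P1 \x P2)%E (~` [set p | Q p]) = 0%E.
  apply/(ae_xsection _ _ mC); apply: ae_mono H => s Qs.
  rewrite xsection_slice; apply/negligibleP => //; exact: measurable_slice.
move=> /(ae_ysection _ _ mC); apply: ae_mono => x; rewrite ysection_slice => Bx.
exists [set s | (~` [set p | Q p]) (s, x)]; split => //.
by rewrite -ysection_slice; exact: measurable_ysection.
Qed.

End product_sections.

(** * Solutions for a set of translates of positive measure *)

Section local_solutions.
Variables (R : realType) (G : topGroupType) (mG : probability (borel G) R).
Hypotheses (cG : compact [set: G]) (pG : polish_space R G) (hG : haar_measure mG).
Variables (Lam : set G) (Delta : groupType) (b : G -> G -> Delta).
Hypotheses (sLam : subgroup Lam) (cLam : countable Lam) (dLam : dense Lam).
Hypothesis cDelta : countable [set: Delta].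
Hypothesis mb : forall h, @dmeas _ (borel G) Delta (b h).
Hypothesis bM : forall h k x, Lam h -> Lam k -> b (h * k) x = b h (x * k^-1) * b k x.
Local Notation m := (pr mG).
Local Notation M := (@measurable _ (borel G)).
Local Notation T := (borel G * borel G)%type.
Local Notation m2 := (pr (mG \x mG)%E).

(** Equivalently b h x = f (x * h^-1) * b h (s * x) * (f x)^-1: [f] is a cohomology between [b] and
    its left translate by [s]. *)
Definition solution (s : G) (f : G -> Delta) :=
  @dmeas _ (borel G) Delta f /\ forall h, Lam h -> {ae mG, forall x : borel G,
    f (x * h^-1 : G) = b h x * f x * (b h (s * x : G))^-1}.

(** [kap] preserves the product measure and, [V] being conjugation invariant, the condition on the
    first coordinate. It turns left translation by x t x^-1 into right translation by t, where the
    stability bound applies. *)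
Lemma discrepancy_small (V : set G) (e : R) : open V ->
  (forall g y, V y -> V (g * y * g^-1)) -> (0 <= e)%R ->
  (forall h t, Lam h -> V t -> (m (unstable (b h) t) <= e)%R) ->
  forall h, Lam h ->
  (m2 ([set p | V p.1] `&` [set p | discrepancy b h p <> 1%g]) <= e * m V)%R.
Proof.
move=> oV Vc e0 Vs h Lh; set E : set T := _ `&` _.
have mE : measurable (E : set T).
  apply: measurableI; first exact: (@measurable_pre1 _ _ (borel G) (borel G) V (open_borel oV)).
  apply: dmeas_neq => //; [exact: (measurable_discrepancy pG cDelta mb)|exact: dmeas_cst].
pose kap (p : T) : T := (p.2 * p.1 * p.2^-1 : G, p.2).
have mkap : measurable_fun setT kap.
  apply/measurable_fun_pairP; split => /=; last exact: measurable_snd.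
  apply: (continuous2_borel pG); apply: continuous_mulg.
    by apply: continuous_mulg => x; [exact: cvg_snd|exact: cvg_fst].
  by apply: continuous_invg => x; exact: cvg_snd.
have mkE : measurable (kap @^-1` E).
  by rewrite -[_ @^-1` _]setTI; exact: mkap.
have -> : m2 E = m2 (kap @^-1` E).
  apply: EFin_inj; rewrite !pr_prod_yE //; apply: eq_integral => x _.
  have mEx := measurable_ysection x mE.
  rewrite -(haar_rmul pG hG x^-1 mEx) -[LHS](haar_lmul hG x (measurable_rmul x^-1 mEx)).
  congr (mG _); apply/seteqP; split => t; rewrite /ysection /= !inE /kap /=;
  by rewrite !mulgA.
apply: section_le => //; first exact: open_borel.
  move=> t x [/= Vt _]; have := Vc x^-1 _ Vt.
  by rewrite invgK !mulgA mulVg mul1g mulgVK.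
move=> t Vt; apply: le_trans (Vs h t Lh Vt); apply: pr_le.
- exact: measurable_slice.
- exact: measurable_unstable.
- move=> x [/= _]; rewrite /kap /discrepancy /unstable /= mulgVK => H Eq; apply: H.
  by rewrite Eq mulVg.
Qed.

Lemma local_solutions (V : set G) (e : R) : open V -> V 1 ->
  (0 < e)%R -> (e <= 1 / 100)%R ->
  (forall h, Lam h ->
    (m2 ([set p | V p.1] `&` [set p | discrepancy b h p <> 1%g]) <= e * m V)%R) ->
  exists S (f : T -> Delta), [/\ M S, (0 < m S)%R, dmeas f &
    forall s, S s -> solution s (fun x => f (s, x)) /\
      (m [set x : G | f (s, x) <> 1%g] <= 1 / 10)%R].
Proof.
move=> oV V1 e0 e1 small; have mV := open_borel oV.
have [A [mA Auniq Aeq Asmall]] := fixed_point cG pG hG sLam cDelta mb bM oV V1 e0 small.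
have V0 : (0 < m V)%R.
  by apply: (@haar_open R G mG cG pG hG V 1 _ mV); exact: open_nbhs_nbhs.
have [f mf fA] := dmeas_pick cDelta mA.
have fE p d : A d p -> f p = d by move=> Ad; apply: (Auniq p) => //; exact: fA Ad.
pose Z : set T := [set p | V p.1].
have mZ : measurable Z by exact: (@measurable_pre1 _ _ (borel G) (borel G) V mV).
have mE : measurable (Z `\` A 1) by exact: measurableD.
(* The bad s. By Fubini and e <= 1/100 their measure is at most 50 e * m V, hence at most half of
   that of [V]. *)
pose U := V `&` [set s : G | ((1 / 10 : R)%:E <= mG (xsection (Z `\` A 1%g) s))%E].
have mU : M U.
  apply: measurableI => //; rewrite -[X in M X]setTI.
  by apply: emeasurable_fun_c_infty => //; exact: measurable_fun_xsection.
have Ule : (1 / 10 * m U <= 5 * e * m V)%R.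
  have r10 : (0 <= 1 / 10 :> R)%R by rewrite divr_ge0.
  apply: le_trans Asmall; apply: section_ge => //.
  move=> s [_ /=]; rewrite xsection_slice -prE ?lee_fin //.
  exact: (@measurable_slice _ _ (borel G) (borel G)).
have good : {ae mG, forall s : borel G, forall q : G * Delta, (Lam `*` setT) q ->
    {ae mG, forall x : borel G, V s ->
    (A q.2 (s, x) <-> A (twist b q.1 (s, x) q.2) (pair_rmul q.1 (s, x)))}}.
  apply: ae_countable; first exact: countableX.
  move=> [k d] [Lk _]; have := ae_slices (Aeq k d Lk).
  by apply: ae_mono => s; apply: ae_mono.
have [B [mB B0 gB]] := good.
pose S := (V `\` U) `\` B.
have mVU : M (V `\` U) by exact: measurableD.
have mS : M S by exact: measurableD.
have S0 : (0 < m S)%R.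
  have : (m V <= m U + m (V `\` U))%R.
    by have := prU mG mU mVU; rewrite setDUK // => x [].
  have : (m (V `\` U) <= m S + 0)%R.
    have mSB : M (S `|` B) by exact: measurableU.
    have -> : (0 = m B)%R by rewrite (pr_eq0 _ _).2.
    apply: le_trans (prU mG mS mB); apply: pr_le => //.
    by move=> x VUx; have [Bx|nBx] := pselect (B x); [right|left].
  move=> h1 h2; rewrite ltNge; apply/negP => h3; nra.
exists S, f; split => // s [[Vs nUs] nBs].
have mAs d : M [set x : G | A d (s, x)] by exact: (@measurable_slice _ _ (borel G) (borel G)).
have {gB} good_s k d : Lam k -> {ae mG, forall x : borel G,
    A d (s, x) <-> A (twist b k (s, x) d) (pair_rmul k (s, x))}.
  move=> Lk; apply: contrapT => nH; apply: nBs; apply: gB => /= H; apply: nH.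
  by have := H (k, d) (conj Lk I); apply: ae_mono => x; apply.
have A1s : (m [set x : G | ~ A 1%g (s, x)] <= 1 / 10)%R.
  have nU : ~ ((1 / 10 : R)%:E <= mG (xsection (Z `\` A 1%g) s))%E by move=> H; apply: nUs.
  move: nU; rewrite xsection_slice -prE; last exact: (@measurable_slice _ _ (borel G) (borel G)).
  rewrite lee_fin => /negP; rewrite -ltNge => /ltW; apply: le_trans.
  apply: pr_le; [by apply: measurableC; exact: mAs|exact: (@measurable_slice _ _ (borel G) (borel G))|].
  by move=> x nA; split.
have mfs : @dmeas _ (borel G) Delta (fun x => f (s, x)).
  by move=> d; exact: (@measurable_slice _ _ (borel G) (borel G) _ s (mf d)).
split; last first.
  apply: le_trans A1s; apply: pr_le.
  - by apply: dmeas_neq => //; exact: dmeas_cst.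
  - by apply: measurableC; exact: mAs.
  - by move=> x /= ne /fE.
split => // h Lh.
have goodall k : Lam k -> {ae mG, forall x : borel G, forall d,
    A d (s, x) <-> A (twist b k (s, x) d) (pair_rmul k (s, x))}.
  move=> Lk; have := @ae_countable _ _ _ mG Delta setT (fun d x =>
    A d (s, x) <-> A (twist b k (s, x) d) (pair_rmul k (s, x))) cDelta (fun d _ => good_s k d Lk).
  by apply: ae_mono => x H d; exact: H.
have LV k : Lam k -> Lam k^-1 by case: sLam => _ _; apply.
(* The points that have an atom form an almost [Lam]-invariant set. It contains those with atom 1,
   so its measure is at least 9/10, and ergodicity makes it conull. *)
pose X := [set x : G | exists d, A d (s, x)].
have mX : M X.
  have [en es] := countable_group_enum cDelta.
  rewrite (_ : X = \bigcup_n [set x : G | A (en n) (s, x)]).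
    by apply: bigcupT_measurable => n; exact: mAs.
  apply/seteqP; split => [x [d Ad]|x [n _ An]]; last by exists (en n).
  by have [n en_] := es d; exists n => //=; rewrite en_.
have [X0|X1] : m X = 0%R \/ m X = 1%R.
  apply: (dense_ergodic pG hG dLam mX) => k Lk.
  have mm := measurable_moved k mX.
  apply/pr_eq0 => //; apply/negligibleP => //.
  apply: negligibleS (goodall _ (LV _ Lk)) => x /= nX H; apply: nX.
  rewrite /pair_rmul /= invgK in H; split.
    move=> [d Ad]; exists ((b k^-1 x)^-1 * d * b k^-1 (s * x)); apply/H.
    by rewrite /twist /= mulgA mulgA mulgV mul1g mulgK.
  by move=> [d /H Ad]; eexists; exact: Ad.
- have : (m X >= 1 - 1 / 10)%R; last by rewrite X0; lra.
  apply: (@le_trans _ _ (m [set x : G | A 1%g (s, x)])).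
    by have := prC mG (mAs 1); rewrite /setC /=; lra.
  by apply: pr_le => // x A1x; exists 1.
have aeX : {ae mG, forall x : borel G, X x} by apply/(pr_aeP _ mX).
apply: ae_mono2 (goodall h Lh) aeX => x H [d Ad].
have /H := Ad; move=> /fE; rewrite /pair_rmul /twist /= => ->.
by rewrite (fE _ _ Ad).
Qed.

End local_solutions.

(** * Uniqueness of solutions and extension to a neighbourhood of 1 *)

Section extension.
Variables (R : realType) (G : topGroupType) (mG : probability (borel G) R).
Hypotheses (cG : compact [set: G]) (pG : polish_space R G) (hG : haar_measure mG).
Variables (Lam : set G) (Delta : groupType) (b : G -> G -> Delta).
Hypotheses (sLam : subgroup Lam) (dLam : dense Lam).
Hypothesis cDelta : countable [set: Delta].
Local Notation m := (pr mG).
Local Notation M := (@measurable _ (borel G)).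
Local Notation T := (borel G * borel G)%type.
Local Notation m2 := (pr (mG \x mG)%E).
Local Notation solution := (solution mG Lam b).
Local Notation dmeasG := (@dmeas _ (borel G) Delta).

Lemma solution_comp s r f f' : solution s f -> solution r f' ->
  solution (r * s) (fun x => f x * f' (s * x)).
Proof.
move=> [mf sf] [mf' sf']; split.
  apply: dmeasM => //; exact: dmeas_lmul.
move=> h Lh; apply: ae_mono2 (sf h Lh) (ae_lmul hG s (sf' h Lh)) => x -> H.
by rewrite mulgA H !mulgA mulgVK.
Qed.

Lemma solution_inv s f : solution s f -> solution s^-1 (fun x => (f (s^-1 * x))^-1).
Proof.
move=> [mf sf]; split.
  apply: dmeasV => //; exact: dmeas_lmul.
move=> h Lh; apply: ae_mono (ae_lmul hG s^-1 (sf h Lh)) => x.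
by rewrite mulVKg mulgA => ->; rewrite !invgM invgK mulgA.
Qed.

Lemma solution_ae s f f' : solution s f -> dmeasG f' ->
  {ae mG, forall x : borel G, f' x = f x} -> solution s f'.
Proof.
move=> [mf sf] mf' ff'; split => // h Lh.
have := ae_rmul pG hG h^-1 ff'.
by apply: ae_mono3 ff' (sf h Lh) => x -> H ->.
Qed.

(** Both functions transform by the same bijection of [Delta], so the set where they agree is almost
    [Lam]-invariant, hence null or conull. *)
Lemma solution_uniq s f f' : solution s f -> solution s f' ->
  (m [set x : G | f x <> f' x] < 1)%R -> {ae mG, forall x : borel G, f x = f' x}.
Proof.
move=> [mf sf] [mf' sf'] lt1.
have mE : M [set x : G | f x = f' x] by exact: dmeas_eq.
have : m [set x : G | f x = f' x] = 0%R \/ m [set x : G | f x = f' x] = 1%R.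
  apply: (dense_ergodic pG hG dLam mE) => h Lh.
  have mm := measurable_moved h mE.
  have Lh' : Lam h^-1 by case: sLam => _ _; apply.
  apply/pr_eq0 => //; apply/negligibleP => //.
  have : {ae mG, forall x : borel G, f (x * h)%g = f' (x * h)%g <-> f x = f' x}.
    apply: ae_mono2 (sf _ Lh') (sf' _ Lh') => x; rewrite invgK => -> ->.
    by split => [/mulIg /mulgI //|->].
  by apply: negligibleS => x; rewrite /moved /=.
case => [E0|/(pr_aeP _ mE)//].
have := prC mG mE; rewrite /setC /= E0; lra.
Qed.

Lemma pr_ne1_mul f f' (r r' : R) : dmeasG f -> dmeasG f' ->
  (m [set x : G | f x <> 1%g] <= r)%R -> (m [set x : G | f' x <> 1%g] <= r')%R ->
  (m [set x : G | f x * f' x <> 1]%g <= r + r')%R.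
Proof.
move=> mf mf' fr fr'.
have m1 : M [set x : G | f x <> 1] by apply: dmeas_neq => //; exact: dmeas_cst.
have m1' : M [set x : G | f' x <> 1] by apply: dmeas_neq => //; exact: dmeas_cst.
apply: le_trans (prUle m1 m1' fr fr'); apply: pr_le.
- by apply: dmeas_neq => //; [exact: dmeasM|exact: dmeas_cst].
- exact: measurableU.
- move=> x /= H; apply: contrapT => /not_orP[/contrapT e /contrapT e'].
  by apply: H; rewrite e e' mulg1.
Qed.

Lemma pr_ne1_lmul f s : dmeasG f ->
  m [set x : G | f (s * x)%g <> 1%g] = m [set x : G | f x <> 1%g].
Proof.
move=> mf; congr fine.
have m1 : M [set x : G | f x <> 1] by apply: dmeas_neq => //; exact: dmeas_cst.
exact: (haar_lmul hG s m1).
Qed.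

Lemma pr_ne1_inv (f : G -> Delta) : m [set x : G | (f x)^-1%g <> 1%g] = m [set x : G | f x <> 1%g].
Proof.
congr (fine (mG _)); apply/seteqP; split => x /= H E; apply: H.
  by rewrite E invg1.
by rewrite -[f x]invgK E invg1.
Qed.

Lemma pr_ne_sub f f' : dmeasG f -> dmeasG f' ->
  (m [set x : G | f x <> f' x] <=
   m [set x : G | f x <> 1%g] + m [set x : G | f' x <> 1%g])%R.
Proof.
move=> mf mf'.
have m1 : M [set x : G | f x <> 1] by apply: dmeas_neq => //; exact: dmeas_cst.
have m1' : M [set x : G | f' x <> 1] by apply: dmeas_neq => //; exact: dmeas_cst.
apply: le_trans (prU mG m1 m1'); apply: pr_le.
- exact: dmeas_neq.
- exact: measurableU.
- move=> x /= H; apply: contrapT => /not_orP[/contrapT e /contrapT e'].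
  by apply: H; rewrite e e'.
Qed.

Lemma extend_solutions (S : set G) (f : T -> Delta) :
  M S -> (0 < m S)%R -> dmeas f ->
  (forall s, S s -> solution s (fun x => f (s, x)) /\
      (m [set x : G | f (s, x) <> 1%g] <= 1 / 10)%R) ->
  exists W (phi : T -> Delta), [/\ open W, W 1, dmeas phi &
    forall u, W u -> solution u (fun x => phi (u, x)) /\
      (m [set x : G | phi (u, x) <> 1%g] <= 1 / 5)%R].
Proof.
move=> mS S0 mf Sf.
(* [quot u _ s] solves the equation for u, so by uniqueness it does not depend
   on s; Steinhaus' theorem provides admissible s for all u near 1. *)
pose quot (u x s : G) := f (s, x) * (f (s * u^-1, u * x))^-1.
pose E d : set (T * borel G) :=
  [set q | [/\ S q.2, S (q.2 * q.1.1^-1) & quot q.1.1 q.1.2 q.2 = d]].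
have m11 : measurable_fun setT (fun q : T * borel G => q.1.1).
  exact: (measurableT_comp (@measurable_fst _ _ (borel G) (borel G)) measurable_fst).
have m12 : measurable_fun setT (fun q : T * borel G => q.1.2).
  exact: (measurableT_comp (@measurable_snd _ _ (borel G) (borel G)) measurable_fst).
have mq2 : measurable_fun setT (fun q : T * borel G => q.2) by exact: measurable_snd.
have mop (h : G * G -> G) (f1 f2 : T * borel G -> borel G) : continuous h ->
    measurable_fun setT f1 -> measurable_fun setT f2 ->
    measurable_fun setT (fun q => h (f1 q, f2 q) : borel G).
  move=> ch m1 m2; apply: (measurableT_comp (continuous2_borel pG ch)).
  exact/measurable_fun_pairP.
have msu : measurable_fun setT (fun q : T * borel G => q.2 * q.1.1^-1 : borel G).
  apply: (mop (fun p => p.1 * p.2^-1)) => //.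
  by apply: continuous_mulg; [move=> ?; exact: cvg_fst|apply: continuous_invg => ?; exact: cvg_snd].
have mux : measurable_fun setT (fun q : T * borel G => q.1.1 * q.1.2 : borel G).
  apply: (mop (fun p => p.1 * p.2)) => //.
  by apply: continuous_mulg => ?; [exact: cvg_fst|exact: cvg_snd].
have mquot : dmeas (fun q : T * borel G => quot q.1.1 q.1.2 q.2).
  apply: dmeasM => //.
    apply: (@dmeas_comp _ _ _ T Delta f (fun q : T * borel G => (q.2, q.1.2))) => //.
    exact/measurable_fun_pairP.
  apply: dmeasV => //.
  apply: (@dmeas_comp _ _ _ T Delta f
    (fun q : T * borel G => (q.2 * q.1.1^-1 : G, q.1.1 * q.1.2 : G))) => //.
  exact/measurable_fun_pairP.
have mE d : measurable (E d).
  rewrite (_ : E d = (setT `&` (fun q : T * borel G => q.2) @^-1` S) `&`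
    ((setT `&` (fun q : T * borel G => q.2 * q.1.1^-1 : borel G) @^-1` S) `&`
    [set q : T * borel G | quot q.1.1 q.1.2 q.2 = d])).
    apply: measurableI; first exact: mq2.
    by apply: measurableI; [exact: msu|exact: mquot].
  by apply/seteqP; split => q; rewrite /E /=; [case|case=> -[_ ?] [[_ ?] ?]].
(* The value of [quot u x s] common to almost all admissible s is recognized as the one taken on a
   set of s of positive measure; this makes the choice measurable in u and x jointly. *)
pose A d := [set p : T | (0 < mG [set s | E d (p, s)])%E].
have mA d : measurable (A d).
  rewrite (_ : A d = setT `&` [set p | (0 < mG (xsection (E d) p))%E]).
    by apply: emeasurable_fun_o_infty => //; exact: measurable_fun_xsection.
  by rewrite setTI; apply/seteqP; split => p; rewrite /A /= xsection_slice.
have [phi mphi phiA] := dmeas_pick cDelta mA.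
have quot_sol u s : S s -> S (s * u^-1) -> solution u (quot u ^~ s) /\
    (m [set x : G | quot u x s <> 1%g] <= 1 / 5)%R.
  move=> Ss Ssu; have [s1 n1] := Sf _ Ss; have [s2 n2] := Sf _ Ssu.
  have := solution_comp s1 (solution_inv s2).
  have -> : (s * u^-1)^-1 * s = u by rewrite invgM invgK mulgVK.
  have E1 : (fun x => f (s, x) * (f (s * u^-1, (s * u^-1)^-1 * (s * x)))^-1) = quot u ^~ s.
    by apply/funext => x; rewrite /quot invgM invgK -!mulgA mulKg.
  rewrite E1 => sq; split => //.
  have mV2 : dmeasG (fun x => (f (s * u^-1, u * x))^-1).
    apply: dmeasV => //; exact: (dmeas_lmul (proj1 s2) u).
  rewrite (_ : 1 / 5 = 1 / 10 + 1 / 10)%R; last lra.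
  apply: (pr_ne1_mul (proj1 s1) mV2 n1).
  by rewrite (pr_ne1_inv (fun x => f (s * u^-1, u * x))) (pr_ne1_lmul u (proj1 s2)).
have ext u : (0 < m [set s : G | S s /\ S (s * u^-1)%g])%R ->
    solution u (fun x => phi (u, x)) /\ (m [set x : G | phi (u, x) <> 1%g] <= 1 / 5)%R.
  move=> I0; have mI : M [set s : G | S s /\ S (s * u^-1)].
    by apply: measurableI => //; exact: measurable_rmul.
  have [s0 [Ss0 Ssu0]] : exists s, S s /\ S (s * u^-1).
    apply: contrapT => /forallNP nS; move: I0.
    rewrite (_ : [set _ | _] = set0) ?pr0 ?ltxx //.
    by apply/seteqP; split => // s /nS.
  have [sol0 near0] := quot_sol u s0 Ss0 Ssu0.
  have eq0 s : S s -> S (s * u^-1) ->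
      {ae mG, forall x : borel G, quot u x s = quot u x s0}.
    move=> Ss Ssu; have [sol1 near1] := quot_sol u s Ss Ssu.
    apply: (solution_uniq sol1 sol0).
    have := pr_ne_sub (proj1 sol1) (proj1 sol0); lra.
  have mslice d : measurable [set p : T | S p.1 /\ S (p.1 * u^-1) /\ quot u p.2 p.1 = d].
    have mg : measurable_fun setT (fun p : T => ((u : borel G, p.2), p.1) : T * borel G).
      apply/measurable_fun_pairP; split => /=; last exact: measurable_fst.
      by apply/measurable_fun_pairP; split => /=; [exact: measurable_cst|exact: measurable_snd].
    have := mg measurableT _ (mE d); rewrite setTI.
    congr measurable; apply/seteqP; split => p; rewrite /E /=; first by case.
    by case=> ? [].
  (* Uniqueness gives, for each s, almost every x; the selection of [phi] needs, for almost every x,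
     almost every s. *)
  have swap : {ae mG, forall x : borel G, {ae mG, forall s : borel G,
      S s -> S (s * u^-1) -> quot u x s = quot u x s0}}.
    pose Q (p : T) := S p.1 -> S (p.1 * u^-1) -> quot u p.2 p.1 = quot u p.2 s0.
    apply: (@ae_swap _ _ _ _ _ mG mG Q).
      have [en es] := countable_group_enum cDelta.
      rewrite (_ : [set p | Q p] = ~` \bigcup_n (
        [set p : T | S p.1 /\ S (p.1 * u^-1) /\ quot u p.2 p.1 = en n] `&`
        [set p : T | quot u p.2 s0 <> en n])).
        apply: measurableC; apply: bigcupT_measurable => n; apply: measurableI => //.
        apply: (@measurable_pre2 _ _ (borel G) (borel G) [set x : G | quot u x s0 <> en n]).
        apply: dmeas_neq => //; [exact: (proj1 sol0)|exact: dmeas_cst].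
      apply/seteqP; split => p.
        by move=> Qp [n _ [/= [S1 [S2 <-]]]]; apply; rewrite Qp.
      move=> nU S1 S2; apply: contrapT => ne; apply: nU.
      have [n en_] := es (quot u p.2 p.1); exists n => //; split => //=.
      by rewrite en_ => E1; apply: ne.
    apply/aeW => s; have [Ss|nSs] := pselect (S s /\ S (s * u^-1)).
      by apply: ae_mono (eq0 s Ss.1 Ss.2) => x H.
    by apply/aeW => x S1 S2; exfalso; apply: nSs.
  have phiE : {ae mG, forall x : borel G, phi (u, x) = quot u x s0}.
    apply: ae_mono swap => x aes.
    have A0 : A (quot u x s0) (u, x).
      rewrite /A /=; have : (0 < mG [set s | S s /\ S (s * u^-1)%g])%E.
        by rewrite -prE // lte_fin.
      move=> /lt_le_trans; apply.
      have [B [mB B0 QB]] := aes.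
      have mEs : M [set s | E (quot u x s0) ((u, x), s)].
        exact: (@measurable_slice _ _ T (borel G)).
      have mEB : M ([set s | E (quot u x s0) ((u, x), s)] `|` B) by exact: measurableU.
      rewrite -!prE // lee_fin; apply: (@le_trans _ _ (m ([set s | E (quot u x s0) ((u, x), s)] `|` B))).
        apply: pr_le => // s [S1 S2]; have [Bs|nBs] := pselect (B s); [by right|left].
        split => //=; apply: contrapT => nq; apply: nBs; apply: QB => /= H; exact: nq (H S1 S2).
      apply: le_trans (prU mG mEs mB) _.
      by rewrite (_ : m B = 0%R) ?addr0 //; apply/pr_eq0.
    have := phiA _ _ A0; rewrite {1}/A /= lt0e => /andP[/eqP ne _].
    apply: contrapT => np; apply: ne.
    apply/negligibleP; first exact: (@measurable_slice _ _ T (borel G)).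
    apply: negligibleS aes => s [/= S1 S2 E1] H; apply: np.
    by rewrite -E1; exact: H.
  have mphiu : dmeasG (fun x => phi (u, x)).
    by move=> d; exact: (@measurable_slice _ _ (borel G) (borel G) _ u (mphi d)).
  have solp := solution_ae sol0 mphiu phiE.
  split => //.
  have mne : M [set x : G | phi (u, x) <> 1] by apply: dmeas_neq => //; exact: dmeas_cst.
  have mne0 : M [set x : G | quot u x s0 <> 1].
    by apply: dmeas_neq => //; [exact: (proj1 sol0)|exact: dmeas_cst].
  have [B [mB B0 QB]] := phiE.
  apply: le_trans near0; apply: (@le_trans _ _ (m ([set x : G | quot u x s0 <> 1%g] `|` B))).
    apply: pr_le => //; first exact: measurableU.
    move=> x /= np; have [Bx|nBx] := pselect (B x); [by right|left => /= E1].
    by apply: nBx; apply: QB => /= E2; apply: np; rewrite E2.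
  apply: le_trans (prU mG mne0 mB) _.
  by rewrite (_ : m B = 0%R) ?addr0 //; apply/pr_eq0.
have : nbhs 1 [set u | (0 < m [set s : G | S s /\ S (s * u^-1)%g])%R].
  have := steinhaus pG hG mS S0; rewrite -{1}invg1 => /nbhs_inv.
  by apply: filterS => u.
rewrite nbhsE => -[W [oW W1] WP].
by exists W, phi; split => // u /WP; exact: ext.
Qed.

(** Both sides solve the equation for v. They differ from 1 on measure at most 1/5 and 2/5, so they
    agree on positive measure and uniqueness applies. *)
Lemma solution_cocycle (W : set G) (phi : T -> Delta) u v :
  (forall u, W u -> solution u (fun x => phi (u, x)) /\
      (m [set x : G | phi (u, x) <> 1%g] <= 1 / 5)%R) ->
  W u -> W v -> W (v * u^-1) ->
  {ae mG, forall x : borel G, phi (v, x) = phi (u, x) * phi (v * u^-1, u * x)}.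
Proof.
move=> WP Wu Wv Wvu; have [su nu] := WP _ Wu; have [sv nv] := WP _ Wv.
have [sw nw] := WP _ Wvu.
have := solution_comp su sw; rewrite mulgVK => sc.
apply: (solution_uniq sv sc).
have := pr_ne_sub (proj1 sv) (proj1 sc).
have nw' : (m [set x : G | phi (v * u^-1, u * x)%g <> 1%g] <= 1 / 5)%R.
  by rewrite (pr_ne1_lmul u (proj1 sw)).
have := pr_ne1_mul (proj1 su) (dmeas_lmul (proj1 sw) u) nu nw'; lra.
Qed.

Variables (Gam : set G) (a : G -> G -> Delta).
Hypothesis ma : forall g, Gam g -> @dmeas _ (borel G) Delta (a g).
Hypothesis ab : forall g h x, Gam g -> Lam h ->
  a g (x * h^-1) * b h x = b h (g * x) * a g x.

(** By [ab], [a g] intertwines [b h] at x and at g * x, so it carries a solution for g * u * g^-1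
    back to one for u. *)
Lemma solution_translate g u f : Gam g -> solution (g * u * g^-1) f ->
  solution u (fun x => (a g x)^-1 * f (g * x) * a g (u * x)).
Proof.
move=> Gg [mf sf]; split.
  apply: dmeasM => //; last exact: (dmeas_lmul (ma Gg) u).
  by apply: dmeasM => //; [apply: dmeasV => //; exact: ma|exact: dmeas_lmul].
move=> h Lh; apply: ae_mono (ae_lmul hG g (sf h Lh)) => x.
rewrite !mulgA mulgVK => ->.
have E1 : (a g (x * h^-1))^-1 * b h (g * x) = b h x * (a g x)^-1.
  apply: (@mulIg _ (a g x)); rewrite mulgVK -mulgA -ab // mulKg //.
have E2 : (b h (g * u * x))^-1 * a g (u * x * h^-1) = a g (u * x) * (b h (u * x))^-1.
  by apply: (@mulIg _ (b h (u * x))); rewrite mulgVK -[LHS]mulgA ab // (mulgA g u x) mulKg.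
by rewrite !mulgA E1 -!mulgA; do 3 congr (_ * _); rewrite !mulgA in E2 *.
Qed.

(** For u near 1, [a g] hardly changes under left translation by u, so the transported solution
    differs from 1 on measure at most 2/5 and uniqueness identifies it with [phi]. How near u has to
    be depends on g. *)
Lemma near_translate (W : set G) (phi : T -> Delta) g : open W -> W 1 ->
  (forall u, W u -> solution u (fun x => phi (u, x)) /\
      (m [set x : G | phi (u, x) <> 1%g] <= 1 / 5)%R) ->
  Gam g ->
  \forall u \near (1 : G), [/\ W u, W (g * u * g^-1) & {ae mG, forall x : borel G,
    a g x * phi (u, x) = phi (g * u * g^-1, g * x) * a g (u * x)}].
Proof.
move=> oW W1 WP Gg.
have Wn : nbhs 1 W by exact: open_nbhs_nbhs.
have [_ /(_ (1 / 5)%R)] := dmeas_lvanishes pG hG cDelta (ma Gg).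
rewrite divr_gt0 // => /(_ isT) an.
apply: filterS3 Wn (nbhs1_conj g Wn) an => u Wu Wgu au; split => //.
have [su nu] := WP _ Wu; have [sg ng] := WP _ Wgu.
have st := solution_translate Gg sg.
have : {ae mG, forall x : borel G, phi (u, x) =
    (a g x)^-1 * phi (g * u * g^-1, g * x) * a g (u * x)}.
  apply: (solution_uniq su st).
  have := pr_ne_sub (proj1 su) (proj1 st).
  suff : (m [set x : G | (a g x)^-1 * phi (g * u * g^-1, g * x) * a g (u * x) <> 1]%g
    <= 1 / 5 + 1 / 5)%R by lra.
  have m1 : M [set x : G | phi (g * u * g^-1, g * x) <> 1].
    by apply: dmeas_neq => //; [exact: (dmeas_lmul (proj1 sg) g)|exact: dmeas_cst].
  have m2' : M [set x : G | a g (u * x) <> a g x].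
    by apply: dmeas_neq => //; [exact: (dmeas_lmul (ma Gg) u)|exact: ma].
  have n1 : (m [set x : G | phi (g * u * g^-1, g * x)%g <> 1%g] <= 1 / 5)%R.
    by rewrite (pr_ne1_lmul g (proj1 sg)).
  apply: le_trans (prUle m1 m2' n1 au); apply: pr_le.
  - by apply: dmeas_neq => //; [exact: (proj1 st)|exact: dmeas_cst].
  - exact: measurableU.
  - move=> x /= H; apply: contrapT => /not_orP[/contrapT e1 /contrapT e2].
    by apply: H; rewrite e1 e2 mulg1 mulVg.
by apply: ae_mono => x ->; rewrite !mulgA mulgV mul1g.
Qed.

End extension.

(** * Local trivializations *)

Section trivialization.
Variables (R : realType) (G : topGroupType) (mG : probability (borel G) R).
Hypotheses (cG : compact [set: G]) (pG : polish_space R G) (hG : haar_measure mG).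
Variables (Gam Lam : set G) (Delta : groupType) (w : G * G -> G -> Delta).
Hypotheses (sGam : subgroup Gam) (cGam : countable Gam) (dGam : dense Gam).
Hypotheses (sLam : subgroup Lam).
Hypothesis cDelta : countable [set: Delta].
Hypothesis mw : forall s, (Gam `*` Lam) s -> @dmeas _ (borel G) Delta (w s).
Hypothesis wM : forall s t x, (Gam `*` Lam) s -> (Gam `*` Lam) t ->
  w (s * t) x = w s (lr_act t x) * w t x.
Variables (W : set G) (phi : borel G * borel G -> Delta).
Hypotheses (oW : open W) (mphi : dmeas phi).
Local Notation M := (@measurable _ (borel G)).
Local Notation T := (borel G * borel G)%type.
Local Notation dmeasG := (@dmeas _ (borel G) Delta).

Hypothesis phi_solution : forall u h, W u -> Lam h -> {ae mG, forall x : borel G,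
  phi (u, x * h^-1 : G) = w (1, h) x * phi (u, x) * (w (1, h) (u * x))^-1}.
Hypothesis phi_cocycle : forall u v, W u -> W v -> W (v * u^-1) ->
  {ae mG, forall x : borel G, phi (v, x) = phi (u, x) * phi (v * u^-1, u * x)}.

Definition equivariant (g u : G) := [/\ W u, W (g * u * g^-1) &
  {ae mG, forall x : borel G,
    w (g, 1) x * phi (u, x) = phi (g * u * g^-1, g * x) * w (g, 1) (u * x)}].

Let G1 : Gam 1. Proof. by case: sGam. Qed.
Let L1 : Lam 1. Proof. by case: sLam. Qed.

Lemma equivariantM g k u : Gam g -> Gam k -> equivariant k u ->
  equivariant g (k * u * k^-1) -> equivariant (g * k) u.
Proof.
move=> Gg Gk [Wu Wku ek] [_ Wgku eg].
have E1 : g * (k * u * k^-1) * g^-1 = g * k * u * (g * k)^-1 by rewrite invgM !mulgA.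
rewrite /equivariant -E1; split => //.
apply: ae_mono2 ek (ae_lmul hG k eg) => x ekx egx.
have wgk y : w (g * k, 1) y = w (g, 1) (k * y) * w (k, 1) y.
  have -> : ((g * k, 1) : G * G) = (g, 1) * (k, 1).
    by congr pair; rewrite /= mul1g.
  rewrite wM //; congr (w _ _ * _).
  by rewrite /lr_act /= invg1 mulg1.
have E2 : k * u * k^-1 * (k * x) = k * (u * x) by rewrite !mulgA mulgVK.
rewrite E2 in egx.
by rewrite !wgk -[LHS]mulgA ekx [LHS]mulgA egx (mulgA g k x) [RHS]mulgA.
Qed.

Lemma equivariantV g u : Gam g -> equivariant g (g^-1 * u * g) -> equivariant g^-1 u.
Proof.
move=> Gg []; have -> : g * (g^-1 * u * g) * g^-1 = u by rewrite !mulgA mulgV mul1g mulgK.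
move=> Wu Wgu eg; rewrite /equivariant invgK; split => //.
have GV : Gam g^-1 by case: sGam => _ _; apply.
apply: ae_mono (ae_lmul hG g^-1 eg) => x; rewrite mulVKg.
have wV y : w (g^-1, 1) y = (w (g, 1) (g^-1 * y))^-1.
  apply/esym/mulg1_eq.
  have W1 z : w (1, 1) z = 1.
    apply: (@mulgI _ (w (1, 1) z)); rewrite mulg1.
    have := @wM (1, 1) (1, 1) z (conj G1 L1) (conj G1 L1).
    have -> : lr_act (1, 1) z = z by rewrite /lr_act /= mul1g invg1 mulg1.
    by move=> <-; congr (w _ _); congr pair; rewrite /= mul1g.
  have := @wM (g, 1) (g^-1, 1) y (conj Gg L1) (conj GV L1).
  have -> : (g, 1) * (g^-1, 1) = (1, 1) :> G * G by congr pair; rewrite /= ?mulgV ?mul1g.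
  by rewrite W1 /lr_act /= invg1 mulg1.
rewrite !wV; have -> : g^-1 * u * g * (g^-1 * x) = g^-1 * (u * x).
  by rewrite !mulgA mulgK.
move=> H; apply: (@mulgI _ (w (g, 1) (g^-1 * x))); rewrite mulVKg.
by apply: (@mulIg _ (w (g, 1) (g^-1 * (u * x)))); rewrite (mulgA (w (g, 1) (g^-1 * x))) mulgVK H.
Qed.

(** Since z * x^-1 carries x to z, this compares the cocycle near x with the cocycle near the fixed
    point z. *)
Definition trivialize (z x : G) : Delta := phi (z * x^-1, x).

Lemma measurable_trivialize z : dmeasG (trivialize z).
Proof.
apply: (@dmeas_comp _ _ (borel G) T Delta phi (fun x => (z * x^-1 : G, x))) => //.
apply/measurable_fun_pairP; split => /=; last exact: measurable_id.
apply: continuous_borel; apply: continuous_mulg => x; first exact: cvg_cst.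
exact: invg_continuous.
Qed.

(** The cocycle identity of [phi] at v = z * x^-1. For a fixed z it only involves one slice of
    pairs, possibly null, and so it may fail for exceptional z. *)
Definition regular (z : G) := forall u, (Gam `&` W) u -> {ae mG, forall x : borel G,
  W (z * x^-1) -> W (z * (u * x)^-1) -> trivialize z x = phi (u, x) * trivialize z (u * x)}.

(** Fubini in the coordinates (v, x), followed by the change of variable z = v * x, which preserves
    null sets for each x. *)
Lemma ae_regular : {ae mG, forall z : borel G, regular z}.
Proof.
apply: ae_countable.
  by apply: sub_countable cGam; apply: subset_card_le => x [].
move=> u [Gu Wu].
pose Q (p : T) := W p.1 -> W (p.1 * u^-1) ->
  phi p = phi (u, p.2) * phi (p.1 * u^-1 : G, u * p.2 : G).
have mQ : measurable [set p | Q p].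
  have mW : M W by exact: open_borel.
  have m1 := @measurable_pre1 _ _ (borel G) (borel G) _ mW.
  have m2 := @measurable_pre1 _ _ (borel G) (borel G) _ (measurable_rmul u^-1 mW).
  have md : dmeas (fun p : T => phi (u, p.2) * phi (p.1 * u^-1 : G, u * p.2 : G)).
    apply: dmeasM => //.
      apply: (@dmeas_comp _ _ T T Delta phi (fun p => (u, p.2))) => //.
      by apply/measurable_fun_pairP; split => /=; [exact: measurable_cst|exact: measurable_snd].
    apply: (@dmeas_comp _ _ T T Delta phi (fun p => (p.1 * u^-1 : G, u * p.2 : G))) => //.
    apply/measurable_fun_pairP; split => /=.
      apply: (@measurableT_comp _ _ _ T (borel G) (borel G) (fun x : G => x * u^-1) _ fst).
        exact: (continuous_borel (@continuous_rmul G u^-1)).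
      exact: measurable_fst.
    apply: (@measurableT_comp _ _ _ T (borel G) (borel G) (fun x : G => u * x) _ snd).
      exact: (continuous_borel (@continuous_lmul G u)).
    exact: measurable_snd.
  have me := dmeas_eq cDelta mphi md.
  rewrite (_ : [set p | Q p] = (~` [set p : T | W p.1]) `|`
     ((~` [set p : T | [set x | W (x * u^-1)] p.1]) `|`
     [set p | phi p = phi (u, p.2) * phi (p.1 * u^-1 : G, u * p.2 : G)])).
    apply: measurableU; first exact: measurableC.
    by apply: measurableU => //; exact: measurableC.
  apply/seteqP; split => p; rewrite /Q /setU /setC /=.
    have [] := pselect (W p.1); have [] := pselect (W (p.1 * u^-1)); tauto.
  by tauto.
have aeQ : {ae mG, forall v : borel G, {ae mG, forall x : borel G, Q (v, x)}}.
  apply/aeW => v; have [Wv|nWv] := pselect (W v); last by apply/aeW => x /nWv.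
  have [Wvu|nWvu] := pselect (W (v * u^-1)); last by apply/aeW => x _ /nWvu.
  by apply: ae_mono (phi_cocycle Wu Wv Wvu) => x H.
have {}aeQ := ae_swap mQ aeQ.
pose Q' (p : T) := Q (p.2 * p.1^-1 : G, p.1).
have mQ' : measurable [set p | Q' p].
  have mk : measurable_fun setT (fun p : T => (p.2 * p.1^-1 : G, p.1) : T).
    apply/measurable_fun_pairP; split => /=; last exact: measurable_fst.
    apply: (continuous2_borel pG); apply: continuous_mulg => [x|]; first exact: cvg_snd.
    by apply: continuous_invg => x; exact: cvg_fst.
  by have := mk measurableT _ mQ; rewrite setTI.
have aeQ' : {ae mG, forall x : borel G, {ae mG, forall z : borel G, Q' (x, z)}}.
  apply: ae_mono aeQ => x; exact: (ae_rmul pG hG x^-1).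
have := ae_swap mQ' aeQ'; apply: ae_mono => z; apply: ae_mono => x.
by rewrite /Q' /Q /trivialize /= invgM !mulgA.
Qed.

Lemma wE g h x : Gam g -> Lam h -> w (g, h) x = w (g, 1) (x * h^-1) * w (1, h) x.
Proof.
move=> Gg Lh; have := @wM (g, 1) (1, h) x (conj Gg L1) (conj G1 Lh).
have -> : (g, 1) * (1, h) = (g, h) :> G * G by congr pair; rewrite /= ?mulg1 ?mul1g.
by move=> ->; rewrite /lr_act /= mul1g.
Qed.

Lemma equivariant_lr g h u : Gam g -> Lam h -> equivariant g u ->
  {ae mG, forall x : borel G, w (g, h) x * phi (u, x) =
    phi (g * u * g^-1, g * x * h^-1) * w (g, h) (u * x)}.
Proof.
move=> Gg Lh [Wu Wgu eg].
apply: ae_mono2 (ae_rmul pG hG h^-1 eg) (phi_solution Wu Lh) => x e1 e2.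
rewrite (wE x Gg Lh) (wE (u * x) Gg Lh) -[LHS]mulgA.
have -> : w (1, h) x * phi (u, x) = phi (u, x * h^-1) * w (1, h) (u * x).
  by rewrite e2 mulgVK.
by rewrite [LHS]mulgA e1 (mulgA g x) (mulgA u x) [RHS]mulgA.
Qed.

(** The candidate for d, as a function of x, does not change when x is replaced by u * x with u in
    [Gam] small: regularity multiplies the two trivializations by values of [phi], which
    [equivariant_lr] cancels. Density of [Gam] then makes it constant on [N]. *)
Lemma locally_constant (g h z z' : G) (N O : set G) : Gam g -> Lam h ->
  regular z -> regular z' -> open N -> open O ->
  (forall u, O u -> equivariant g u) ->
  (forall x, N x -> W (z * x^-1)) ->
  (forall x, N x -> W (z' * (g * x * h^-1)^-1)) ->
  (forall x y, N x -> N y -> O (y * x^-1)) ->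
  exists d, {ae mG, forall x : borel G, N x ->
    w (g, h) x = trivialize z' (g * x * h^-1) * d * (trivialize z x)^-1}.
Proof.
move=> Gg Lh rz rz' oN oO Oeq Nz Nz' NO.
pose f x := (trivialize z' (g * x * h^-1))^-1 * w (g, h) x * trivialize z x.
have mf : dmeasG f.
  apply: dmeasM => //; last exact: measurable_trivialize.
  apply: dmeasM => //; last by apply: mw; split.
  apply: dmeasV => // d.
  have := measurable_lmul g (measurable_rmul h^-1 (@measurable_trivialize z' d)).
  by [].
have [|d fd] := local_constant pG hG cDelta mf dGam oN oO NO.
  move=> u Gu Ou; have eu := Oeq u Ou; have [Wu Wgu _] := eu.
  have Ggu : (Gam `&` W) (g * u * g^-1).
    by split => //; case: sGam => _ GM GV; apply: (GM); [exact: GM|exact: GV].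
  apply: ae_mono3 (equivariant_lr Gg Lh eu) (rz u (conj Gu Wu))
    (ae_lmul hG g (ae_rmul pG hG h^-1 (rz' _ Ggu))) => x e1 e2 e3 Nx Nux.
  have E1 : g * u * g^-1 * (g * x * h^-1) = g * (u * x) * h^-1 by rewrite !mulgA mulgVK.
  rewrite /f e2; [|exact: Nz|exact: Nz].
  rewrite [trivialize z' (g * x * h^-1)]e3; [|exact: Nz'|rewrite E1; exact: Nz'].
  rewrite E1 invgM -!mulgA; congr (_ * _).
  by rewrite [w (g, h) x * _]mulgA e1 -!mulgA mulKg.
exists d; apply: ae_mono fd => x H /H <-.
by rewrite /f !mulgA mulgV mul1g mulgK.
Qed.

End trivialization.

(** * Profinite groups *)

Section profinite.
Variables (R : realType) (G : topGroupType).
Hypothesis prG : profinite G.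

Lemma profinite_clopen_avoid (x : G) (K : set G) : closed K ->
  (forall y, K y -> exists D, [/\ clopen D, D x & ~ D y]) ->
  exists D, [/\ clopen D, D x & D `&` K = set0].
Proof.
move=> cK KD; have [cG _ _] := prG.
have : compact K by apply: subclosed_compact cG _.
rewrite compact_cover => /(_ (set G) [set D | clopen D /\ D x] (fun D => ~` D)) [].
- by move=> D [[_ cD] _]; exact: closed_openC.
- by move=> y /KD[D [cD Dx nDy]]; exists D.
move=> F FP cov.
have FP' D : D \in finmap.enum_fset F -> clopen D /\ D x.
  by move=> h; have := FP D h; rewrite inE.
exists (\big[setI/setT]_(D <- finmap.enum_fset F) D).
have H (s : seq (set G)) : {subset s <= finmap.enum_fset F} ->
    clopen (\big[setI/setT]_(D <- s) D) /\ (\big[setI/setT]_(D <- s) D) x.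
  elim: s => [|D s IH] sF; first by rewrite big_nil; split => //; exact: clopenT.
  have [|h1 h2] := IH; first by move=> E Es; apply: sF; rewrite inE Es orbT.
  have [cD Dx] : clopen D /\ D x by apply/FP'/sF; rewrite mem_head.
  by rewrite big_cons; split => //; exact: clopenI.
have [h1 h2] := H _ (fun _ => id); split => //.
apply/seteqP; split => // y [+ Ky]; rewrite -bigcap_seq => Fy.
have [D /= DF nD] := cov y Ky; exact: nD (Fy D DF).
Qed.

(** In a compact Hausdorff space the intersection [Q] of the clopen neighbourhoods of x is
    connected, hence reduced to x here; compactness of the complement of [U] then needs only
    finitely many of them. *)
Lemma profinite_clopen (x : G) (U : set G) : nbhs x U ->
  exists D, [/\ clopen D, D x & D `<=` U].
Proof.
have [cG hG tG] := prG; move=> Ux.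
pose Q := [set y | forall D, clopen D -> D x -> D y].
have cQ : closed Q.
  rewrite (_ : Q = \bigcap_(D in [set D | clopen D /\ D x]) D).
    by apply: closed_bigI => D [[_ cD] _].
  by apply/seteqP; split => y Qy; [move=> D [cD Dx]; exact: Qy|move=> D cD Dx; exact: Qy].
have Qconn : connected Q.
  move=> B [b Bb] [C1 oO BO] [C2 cF BF].
  have cB : closed B by rewrite BF; exact: closedI.
  have cB' : closed (Q `\` B).
    rewrite (_ : Q `\` B = Q `&` ~` C1); first by apply: closedI => //; exact: open_closedC.
    by rewrite BO setDE setCI setIUr setICr set0U.
  (* If [Q] splits, normality separates the two pieces by open sets. Some clopen [D] around x lies
     in their union and is cut by them into two clopen parts; [Q] lies in the one that contains
     x. *)
  have [V1 [V2 [oV1 oV2 BV1 BV2 V12]]] := (@normal_openP R G).1 (compact_normal hG cG) _ _ cB cB' (setDIK _ _).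
  have [||D [[oD cD] Dx DK]] := @profinite_clopen_avoid x (~` (V1 `|` V2)).
  - by apply: open_closedC; exact: openU.
  - move=> y nV; have nQ : ~ Q y.
      by move=> Qy; apply: nV; have [By|nBy] := pselect (B y); [left; exact: BV1|right; exact: BV2].
    move/existsNP: nQ => [D /not_implyP[cD /not_implyP[Dx nDy]]].
    by exists D.
  have DV : D `<=` V1 `|` V2.
    move=> y Dy; apply: contrapT => nV.
    have : (D `&` ~` (V1 `|` V2)) y by [].
    by rewrite DK.
  have clop A A' : open A -> open A' -> A `&` A' = set0 -> D `<=` A `|` A' -> clopen (D `&` A).
    move=> oA oA' AA' DA; split; first exact: openI.
    rewrite (_ : D `&` A = D `&` ~` A'); first by apply: closedI => //; exact: open_closedC.
    apply/seteqP; split => y [Dy].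
      move=> Ay; split => // A'y.
      by have : (A `&` A') y by []; rewrite AA'.
    by move=> nA'; split => //; have [//|/nA'] := DA _ Dy.
  have D1 := clop _ _ oV1 oV2 V12 DV.
  have D2 : clopen (D `&` V2) by apply: (clop _ V1) => //; [rewrite setIC|rewrite setUC].
  have Qb : Q b by move: Bb; rewrite BO => -[].
  have [V1x|V2x] := DV _ Dx.
    apply/seteqP; split => [y|y Qy]; first by rewrite BO => -[].
    apply: contrapT => nBy; have [_ V1y] := Qy _ D1 (conj Dx V1x).
    have : (V1 `&` V2) y by split => //; exact: BV2.
    by rewrite V12.
  have [_ V2b] := Qb _ D2 (conj Dx V2x).
  have : (V1 `&` V2) b by split => //; exact: BV1.
  by rewrite V12.
have Qx : Q `<=` [set x].
  rewrite -(tG x I); apply: connected_component_max => //.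
have [oU oUx] : open U° /\ U° x by split; [exact: open_interior|exact: Ux].
have [||D [cD Dx DK]] := @profinite_clopen_avoid x (~` U°).
- exact: open_closedC.
- move=> y nU; have nQ : ~ Q y by move=> /Qx yx; apply: nU; rewrite yx.
  by move/existsNP: nQ => [D /not_implyP[cD /not_implyP[Dx nDy]]]; exists D.
- exists D; split => // y Dy; apply: interior_subset; apply: contrapT => nU.
  by have : (D `&` ~` U°) y by []; rewrite DK.
Qed.

(** The t with t * D inside the compact open set [D] include a neighbourhood of 1. Imposing this on
    all conjugates of t and of t^-1 gives a normal subgroup, and it lies in [D] because [D] contains
    1. *)
Lemma profinite_normal_subgroup (U : set G) : nbhs 1 U ->
  exists N, [/\ open N, subgroup N, forall g y, N y -> N (g * y * g^-1) & N `<=` U].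
Proof.
move=> /profinite_clopen[D [[oD cD] D1 DU]]; have [cG hG _] := prG.
have cD' : compact D by apply: subclosed_compact cG _.
pose P := [set t : G | forall c, D c -> D (t * c)].
have P1 : nbhs 1 P.
  move: cD' => /compact_near_coveringP /(_ G (nbhs (1 : G)) (fun t c => D (t * c)) _) H.
  have {}H : \forall t \near (1 : G), D `<=` (fun c => D (t * c)).
    apply: H => c Dc; near_simpl.
    have c2 : continuous (fun p : G * G => p.2 * p.1).
      by apply: continuous_mulg => p; [exact: cvg_snd|exact: cvg_fst].
    have := c2 (c, 1); rewrite /continuous_at /= mul1g; apply.
    exact: open_nbhs_nbhs.
  by apply: filterS H => t.
have [V [oV V1 Vc VP]] := nbhs1_conj_open cG (filterI P1
  ((nbhs_inv 1 P).1 (eq_ind_r (fun z => nbhs z P) P1 (invg1 G)))).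
pose N := [set t : G | forall g, P (g * t * g^-1) /\ P (g * t^-1 * g^-1)].
have VN : V `<=` N.
  move=> t Vt g; split; first by have [] := VP _ (Vc g _ Vt).
  by have [_] := VP _ (Vc g _ Vt); rewrite /= !invgM invgK mulgA.
have sN : subgroup N.
  split.
  - by move=> g; rewrite invg1 mulg1 mulgV; split => c; rewrite mul1g.
  - move=> s t Ns Nt g; have [s1 s2] := Ns g; have [t1 t2] := Nt g; split => c Dc.
      rewrite (_ : g * (s * t) * g^-1 * c = (g * s * g^-1) * ((g * t * g^-1) * c)).
        by apply: s1; exact: t1.
      by rewrite !mulgA mulgVK.
    rewrite (_ : g * (s * t)^-1 * g^-1 * c = (g * t^-1 * g^-1) * ((g * s^-1 * g^-1) * c)).
      by apply: t2; exact: s2.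
    by rewrite invgM !mulgA mulgVK.
  - by move=> t Nt g; have [t1 t2] := Nt g; rewrite invgK.
exists N; split => //.
- rewrite openE => t Nt; have [_ NM _] := sN.
  rewrite /interior -[t]mulg1; apply/nbhs_lmul.
  apply: filterS (open_nbhs_nbhs (conj oV V1)) => v /VN Nv /=; exact: NM.
- move=> g y Ny k; have [y1 y2] := Ny (k * g); split => c Dc.
    rewrite (_ : k * (g * y * g^-1) * k^-1 = k * g * y * (k * g)^-1); first exact: y1.
    by rewrite invgM !mulgA.
  rewrite (_ : k * (g * y * g^-1)^-1 * k^-1 = k * g * y^-1 * (k * g)^-1); first exact: y2.
  by rewrite !invgM invgK !mulgA.
- move=> t Nt; apply: DU; have [t1 _] := Nt 1.
  by have := t1 1 D1; rewrite invg1 !mulg1 mul1g.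
Qed.

End profinite.

(** * Construction of the local trivializations, and the profinite case *)

Section core.
Variables (R : realType) (G : topGroupType) (mG : probability (borel G) R).
Hypotheses (cG : compact [set: G]) (pG : polish_space R G) (hG : haar_measure mG).
Variables (Gam Lam : set G) (Delta : groupType) (w : G * G -> G -> Delta).
Hypotheses (sGam : subgroup Gam) (cGam : countable Gam) (dGam : dense Gam).
Hypotheses (sLam : subgroup Lam) (cLam : countable Lam) (dLam : dense Lam).
Hypothesis fLam : finitely_generated Lam.
Hypothesis se : strongly_ergodic (X := borel G) Gam (fun g x : G => g * x) mG.
Hypothesis cDelta : countable [set: Delta].
Hypothesis mw : forall s, (Gam `*` Lam) s -> @dmeas _ (borel G) Delta (w s).
Hypothesis wM : forall s t x, (Gam `*` Lam) s -> (Gam `*` Lam) t ->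
  w (s * t) x = w s (lr_act t x) * w t x.
Local Notation m := (pr mG).
Local Notation M := (@measurable _ (borel G)).

Lemma trivialization_exists : exists (W : set G) (phi : borel G * borel G -> Delta),
  [/\ open W, W 1, dmeas phi,
    forall u h, W u -> Lam h -> {ae mG, forall x : borel G,
      phi (u, x * h^-1 : G) = w (1, h) x * phi (u, x) * (w (1, h) (u * x))^-1} &
    (forall u v, W u -> W v -> W (v * u^-1) -> {ae mG, forall x : borel G,
      phi (v, x) = phi (u, x) * phi (v * u^-1, u * x)}) /\
    (forall g, Gam g -> \forall u \near (1 : G), equivariant mG w W phi g u)].
Proof.
have [G1 GM GV] := sGam; have [L1 LM LV] := sLam.
(* Outside [Lam], [b] is set to 1 so that it is measurable for every index. *)
pose a g := w (g, 1); pose b h := if `[< Lam h >] then w (1, h) else (fun _ => 1).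
have bE h : Lam h -> b h = w (1, h) by move=> Lh; rewrite /b asboolT.
have ma g : Gam g -> @dmeas _ (borel G) Delta (a g) by move=> Gg; apply: mw; split.
have mb h : @dmeas _ (borel G) Delta (b h).
  by rewrite /b; case: ifPn => [/asboolP Lh|_]; [apply: mw; split|exact: dmeas_cst].
have bM h k x : Lam h -> Lam k -> b (h * k) x = b h (x * k^-1) * b k x.
  move=> Lh Lk; rewrite !bE //; last exact: LM.
  have := @wM (1, h) (1, k) x (conj G1 Lh) (conj G1 Lk).
  have -> : (1, h) * (1, k) = (1, h * k) :> G * G by congr pair; rewrite /= ?mul1g.
  by move=> ->; rewrite /lr_act /= mul1g.
have ab g h x : Gam g -> Lam h -> a g (x * h^-1) * b h x = b h (g * x) * a g x.
  move=> Gg Lh; rewrite !bE // /a.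
  have := @wM (g, 1) (1, h) x (conj Gg L1) (conj G1 Lh).
  have := @wM (1, h) (g, 1) x (conj G1 Lh) (conj Gg L1).
  have -> : (g, 1) * (1, h) = (g, h) :> G * G by congr pair; rewrite /= ?mul1g ?mulg1.
  have -> : (1, h) * (g, 1) = (g, h) :> G * G by congr pair; rewrite /= ?mul1g ?mulg1.
  by rewrite /lr_act /= !mul1g invg1 mulg1 => -> ->.
(* This constant is below 1/3, as [uniform_stability] asks, and within the bound of
   [local_solutions]. *)
have e0 : (0 < 1 / 100 :> R)%R by rewrite divr_gt0.
have e3 : (1 / 100 < 1 / 3 :> R)%R by lra.
have [V [oV V1 Vc Vs]] := uniform_stability cG pG hG sLam fLam se cDelta ma
  (fun h _ => mb h) bM ab e0 e3.
have small := discrepancy_small pG hG cDelta mb oV Vc (ltW e0) Vs.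
have [S [f [mS S0 mf Sf]]] := local_solutions cG pG hG sLam cLam dLam cDelta mb bM
  oV V1 e0 (lexx _) small.
have [W [phi [oW W1 mphi Wphi]]] := extend_solutions pG hG sLam dLam cDelta mS S0 mf Sf.
exists W, phi; split => //; last split.
- move=> u h Wu Lh; have [[_ su] _] := Wphi u Wu.
  by have := su h Lh; rewrite bE.
- by move=> u v Wu Wv Wvu; exact: (solution_cocycle pG hG sLam dLam cDelta Wphi Wu Wv Wvu).
- by move=> g Gg; exact: (near_translate pG hG sLam dLam cDelta ma ab oW W1 Wphi Gg).
Qed.

(** Because [N] is normal, the g that are equivariant for all u in [N] form a subgroup, so finitely
    many generators of [Gam] decide. Because [N] is a subgroup of G inside [W], a single z in [N]
    serves all x in [N]. *)
Lemma trivial_on_open_subgroup : profinite G -> finitely_generated Gam ->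
  exists G0 : set G, [/\ open G0, subgroup G0 &
    exists2 psi : G -> Delta, @dmeas _ (borel G) Delta psi &
      forall s, ((Gam `&` G0) `*` (Lam `&` G0)) s -> exists d,
        {ae mG, forall x : borel G, G0 x ->
          w s x = psi (lr_act s x) * d * (psi x)^-1}].
Proof.
move=> prG [F fF GE].
have [W [phi [oW W1 mphi phis [phic phie]]]] := trivialization_exists.
have GF g : F g -> Gam g by rewrite GE => Fg; exact: sub_gen_smallest.
have genF : \forall u \near (1 : G), forall g, F g -> equivariant mG w W phi g u.
  by apply: near_finite => // g Fg; apply: phie; exact: GF.
have Wn : nbhs 1 W by exact: open_nbhs_nbhs.
have [N [oN sN Nc NU]] := profinite_normal_subgroup R prG (filterI Wn genF).
have [N1 NM NV] := sN; have [G1 GM GV] := sGam; have [L1 LM LV] := sLam.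
have NW u : N u -> W u by move=> /NU[].
pose E := [set g | Gam g /\ forall u, N u -> equivariant mG w W phi g u].
have allE g u : Gam g -> N u -> equivariant mG w W phi g u.
  move=> Gg; suff : Gam `<=` E by move=> /(_ g Gg)[_]; apply.
  rewrite [X in X `<=` _]GE; apply: smallest_sub; last first.
    by move=> k Fk; split; [exact: GF|move=> v /NU[_]; apply].
  have w11 x : w (1, 1) x = 1.
    apply: (@mulgI _ (w (1, 1) x)); rewrite mulg1.
    have := @wM (1, 1) (1, 1) x (conj G1 L1) (conj G1 L1).
    have -> : lr_act (1, 1) x = x by rewrite /lr_act /= mul1g invg1 mulg1.
    by move=> <-; congr (w _ _); congr pair; rewrite /= mul1g.
  split.
  - split => // v Nv; rewrite /equivariant mul1g invg1 mulg1; split; [exact: NW|exact: NW|].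
    by apply/aeW => x; rewrite !w11 mul1g mulg1 mul1g.
  - move=> k l [Gk Ek] [Gl El]; split=> [|v Nv]; first exact: GM.
    by apply: (equivariantM hG sLam wM Gk Gl (El _ Nv)); apply: Ek; exact: Nc.
  - move=> k [Gk Ek]; split=> [|v Nv]; first exact: GV.
    apply: (equivariantV hG sGam sLam wM Gk); apply: Ek.
    by have := Nc k^-1 _ Nv; rewrite invgK.
have [z [Nz rz]] : exists z, N z /\ regular mG Gam W phi z.
  have aer := ae_regular pG hG cGam cDelta oW mphi phic.
  apply: contrapT => /forallNP nz.
  have mN := open_borel oN.
  have : (0 < m N)%R by apply: (@haar_open R G mG cG pG hG N 1) => //; exact: open_nbhs_nbhs.
  rewrite (_ : m N = 0%R) ?ltxx //; apply/pr_eq0 => //; apply/negligibleP => //.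
  by apply: negligibleS aer => x Nx /= rx; apply: (nz x).
exists N; split => //; exists (trivialize phi z); first exact: (measurable_trivialize mphi).
move=> [g h] [[Gg Ng] [Lh Nh]].
apply: (locally_constant pG hG sGam dGam sLam cDelta mw wM mphi phis Gg Lh rz rz oN oN).
- by move=> u; exact: allE.
- by move=> x Nx; apply: (NW); apply: (NM) => //; exact: (NV).
- by move=> x Nx; apply: (NW); apply: (NM) => //; apply: (NV); apply: (NM); [exact: (NM)|exact: (NV)].
- by move=> x y Nx Ny; apply: (NM) => //; exact: (NV).
Qed.

End core.

(** * Monodromy on simply connected groups *)

Section holonomy.
Variables (T : Type) (Delta : groupType) (I : Type) (O : I -> set T).
Variable tau : T -> T -> Delta.
Hypothesis tauM : forall i x y z, O i x -> O i y -> O i z ->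
  tau x y * tau y z = tau x z.
Implicit Types g : nat -> T.

Lemma tau1 i x : O i x -> tau x x = 1.
Proof. by move=> Ox; apply: (@mulgI _ (tau x x)); rewrite mulg1 (tauM Ox). Qed.

(** Parallel transport, along a chain of points, of the flat local system with transitions [tau]. *)
Fixpoint hol g n := if n is k.+1 then hol g k * tau (g k) (g k.+1) else 1.

Lemma hol_add g p n : hol g (p + n) = hol g p * hol (fun j => g (p + j)%N) n.
Proof.
elim: n => [|n IH]; first by rewrite addn0 mulg1.
by rewrite addnS /= IH -mulgA addnS.
Qed.

Lemma eq_hol g g' n : (forall j, (j <= n)%N -> g j = g' j) -> hol g n = hol g' n.
Proof.
elim: n => //= n IH E; rewrite IH => [|j jn]; last by apply: E; exact: leq_trans jn _.
by rewrite !E.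
Qed.

Lemma hol_local g n i : (forall j, (j <= n)%N -> O i (g j)) -> hol g n = tau (g 0%N) (g n).
Proof.
elim: n => [|n IH] Og /=; first by rewrite (@tau1 i) //; exact: Og.
rewrite IH => [|j jn]; last by apply: Og; exact: leq_trans jn _.
by apply: (@tauM i); exact: Og.
Qed.

Lemma hol_rev g n : (forall j, (j < n)%N -> exists i, O i (g j) /\ O i (g j.+1)) ->
  hol (fun j => g (n - j)%N) n = (hol g n)^-1.
Proof.
elim: n => [|n IH] gO; first by rewrite /= invg1.
have -> : n.+1 = (1 + n)%N by [].
rewrite hol_add /= mul1g subn0 subn1 /=.
rewrite (@eq_hol _ (fun j => g (n - j)%N)); last by move=> j jn; rewrite !add1n subSS.
rewrite IH; last by move=> j jn; apply: gO; exact: leqW.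
have [i [Oi Oi']] := gO n (ltnSn n).
rewrite add1n /= invgM; congr (_ * _).
by apply/esym/mulg1_eq; rewrite (tauM Oi Oi' Oi) (tau1 Oi).
Qed.

(** A discrete homotopy: each square lies in one [O i], so the rung can be pushed across it. *)
Lemma hol_ladder g g' n :
  (forall j, (j < n)%N -> exists i, [/\ O i (g j), O i (g j.+1), O i (g' j) & O i (g' j.+1)]) ->
  (exists i, O i (g 0%N) /\ O i (g' 0%N)) ->
  hol g n * tau (g n) (g' n) = tau (g 0%N) (g' 0%N) * hol g' n.
Proof.
elim: n => [|n IH] gO g0; first by rewrite /= mul1g mulg1.
have [i [e1 e2 e3 e4]] := gO n (ltnSn n).
rewrite /= -mulgA (tauM e1 e2 e4) -(tauM e1 e3 e4) mulgA IH ?mulgA //.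
by move=> j jn; apply: gO; exact: leqW.
Qed.

Lemma hol_refine (f : nat -> T) k r :
  (forall j, (j < k)%N -> exists i, forall l, (l <= r)%N -> O i (f (j * r + l)%N)) ->
  hol f (k * r)%N = hol (fun j => f (j * r)%N) k.
Proof.
elim: k => // k IH fO; rewrite mulSn addnC hol_add /= IH; last first.
  by move=> j jk; apply: fO; exact: leqW.
have [i Oi] := fO k (ltnSn k).
by rewrite (hol_local Oi) addn0 mulSn [(r + _)%N]addnC.
Qed.

End holonomy.

Section lebesgue.
Variables (R : realType) (X : pseudoMetricType R) (T : topologicalType).
Variables (I : Type) (O : I -> set T).
Hypothesis oO : forall i, open (O i).
Hypothesis cO : forall x, exists i, O i x.

Lemma lebesgue_number (K : set X) (f : X -> T) : compact K -> continuous f ->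
  exists2 d : R, (0 < d)%R & forall x, K x -> exists i, forall y, ball x d y -> O i (f y).
Proof.
move=> /compact_near_coveringP cK cf.
have H x : K x -> \forall x' \near x & d \near (0%R : R),
    exists i, forall y, ball x' d y -> O i (f y).
  move=> Kx; have [i Oi] := cO (f x).
  have : nbhs x (f @^-1` O i) by apply: cf; exact: open_nbhs_nbhs.
  move=> /nbhs_ballP[r /= r0 rO].
  have r2 : (0 < r / 2)%R by rewrite divr_gt0.
  exists (ball x (r / 2), [set d | (d < r / 2)%R]).
    split; first exact: nbhsx_ballx.
    exact: lt_nbhsl.
  move=> [x' d] [/= xx' dr]; exists i => y x'y; apply: rO.
  rewrite [r]splitr; apply: ball_triangle xx' _.
  by apply: le_ball x'y; exact: ltW.
have : nbhs (0%R : R) [set d | K `<=` (fun x => exists i, forall y, ball x d y -> O i (f y))].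
  exact: (cK R (nbhs (0%R : R)) (fun d x => exists i, forall y, ball x d y -> O i (f y)) _ H).
move=> /nbhs_ballP[e /= e0 eP].
have e2 : (0 < e / 2)%R by rewrite divr_gt0.
exists (e / 2)%R => // x Kx; apply: (eP (e / 2)%R) => //.
rewrite /ball /= sub0r normrN gtr0_norm //.
by rewrite ltr_pdivrMr // ltr_pMr // ltr1n.
Qed.

End lebesgue.

Lemma within_comp (U X T : topologicalType) (A : set X) (c : U -> X) (f : X -> T) :
  continuous c -> (forall u, A (c u)) -> {within A, continuous f} ->
  continuous (fun u => f (c u)).
Proof.
move=> cc Ac /subspace_continuousP cf u V /(cf _ (Ac u)); rewrite /within /= => H.
by have := cc u _ H; rewrite nbhs_simpl /=; apply: filterS => v; apply.
Qed.

Lemma continuous_pair (U X T : topologicalType) (f : U -> X) (g : U -> T) :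
  continuous f -> continuous g -> continuous (fun u => (f u, g u)).
Proof. by move=> cf cg u; apply: cvg_pair; [exact: cf|exact: cg]. Qed.

Section clamp.
Variable R : realType.
Local Open Scope ring_scope.

(* Composition with [clamp] turns a function continuous within [0, 1] into a
   continuous function on R. *)
Definition clamp (t : R) : R := Num.max 0 (Num.min 1 t).

Lemma clamp01 t : `[0, 1]%classic (clamp t).
Proof. by rewrite /= in_itv /= le_max lexx /= ge_max ler01 ge_min lexx. Qed.

Lemma clampE t : 0 <= t -> t <= 1 -> clamp t = t.
Proof. by move=> t0 t1; rewrite /clamp (min_r t1) (max_r t0). Qed.

Lemma clamp_le0 t : t <= 0 -> clamp t = 0.
Proof. by move=> t0; rewrite /clamp min_r ?max_l // (le_trans t0). Qed.

Lemma clamp_ge1 t : 1 <= t -> clamp t = 1.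
Proof. by move=> t1; rewrite /clamp min_l // max_r. Qed.

Lemma continuous_clamp : continuous clamp.
Proof.
move=> t; apply: continuous_max; first exact: cvg_cst.
by apply: continuous_min; [exact: cvg_cst|exact: cvg_id].
Qed.

End clamp.

(** * Holonomy along continuous paths *)

Section monodromy.
Variables (R : realType) (T : topGroupType) (Delta : groupType).
Variables (I : Type) (O : I -> set T) (tau : T -> T -> Delta).
Hypothesis oO : forall i, open (O i).
Hypothesis cO : forall x, exists i, O i x.
Hypothesis tauM : forall i x y z, O i x -> O i y -> O i z ->
  tau x y * tau y z = tau x z.
Hypothesis scT : simply_connected_space R T.
Hypothesis lpcT : forall U : set T, nbhs 1 U -> nbhs (1 : T) [set s | exists f : R -> T,
  [/\ continuous f, f 0%R = 1, f 1%R = s & forall t, U (f t)]].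
Local Open Scope ring_scope.
Implicit Types f : R -> T.

Definition fine_mesh f k := (0 < k)%N /\ forall j, (j < k)%N -> exists i,
  forall t, j%:R / k%:R <= t <= j.+1%:R / k%:R -> O i (f t).

Definition path_hol f k := hol tau (fun j => f (j%:R / k%:R)) k.

Lemma unit_fraction j k : (0 < k)%N -> (j <= k)%N -> `[0, 1]%classic (j%:R / k%:R : R).
Proof.
move=> k0 jk; rewrite /= in_itv /= divr_ge0 //=.
by rewrite ler_pdivrMr ?ltr0n // mul1r ler_nat.
Qed.

Lemma mesh_eventually (d : R) : 0 < d -> exists K, forall k, (K <= k)%N ->
  (0 < k)%N /\ k%:R^-1 < d.
Proof.
move=> d0; exists (Num.Def.truncn d^-1).+1 => k Kk.
have k0 : (0 < k)%N by exact: leq_ltn_trans Kk.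
split => //; rewrite invf_plt ?posrE ?ltr0n //.
by apply: lt_le_trans (truncnS_gt _) _; rewrite ler_nat.
Qed.

Lemma fine_mesh_eventually f : continuous f ->
  exists K, forall k, (K <= k)%N -> fine_mesh f k.
Proof.
move=> cf; have [d d0 dP] := lebesgue_number oO cO (@segment_compact R 0 1) cf.
have [K KP] := mesh_eventually d0; exists K => k /KP[k0 kd]; split => // j jk.
have [i iP] := dP _ (unit_fraction k0 (ltnW jk)); exists i => t /andP[t1 t2].
apply: iP; rewrite /ball /= distrC ger0_norm ?subr_ge0 //.
apply: le_lt_trans kd; rewrite lerBlDr; apply: le_trans t2 _.
by rewrite -addn1 natrD mulrDl mul1r addrC.
Qed.

Lemma path_hol_refine f k r : fine_mesh f k -> (0 < r)%N ->
  path_hol f (k * r)%N = path_hol f k.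
Proof.
move=> [k0 kP] r0; rewrite /path_hol.
have kr0 : 0 < k%:R :> R by rewrite ltr0n.
have rr0 : 0 < r%:R :> R by rewrite ltr0n.
rewrite (hol_refine tauM); last first.
  move=> j /kP[i iP]; exists i => l lr; apply: iP.
  rewrite !natrM natrD natrM; apply/andP; split.
    rewrite ler_pdivlMr ?mulr_gt0 // mulrA divfK ?gt_eqF //.
    by rewrite lerDl.
  rewrite ler_pdivrMr ?mulr_gt0 // mulrA divfK ?gt_eqF //.
  by rewrite -natrM -natrD -natrM ler_nat mulSn addnC leq_add2r.
apply: eq_hol => j _; congr f; rewrite !natrM invfM mulrACA divff ?mulr1 //.
by rewrite gt_eqF.
Qed.

(** Two fine meshes k and K have the common refinement k * K. *)
Lemma path_hol_stable f : continuous f ->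
  exists K v, forall k, (K <= k)%N -> path_hol f k = v.
Proof.
move=> /fine_mesh_eventually[K KP]; exists K, (path_hol f K) => k Kk.
have [k0 _] := KP _ Kk; have [K0 _] := KP _ (leqnn K).
by rewrite -(path_hol_refine (KP _ Kk) K0) mulnC (path_hol_refine (KP _ (leqnn K)) k0).
Qed.

(** On a fine grid of the homotopy square consecutive rows have the same holonomy, since their ends
    are fixed, and the last row is constant. *)
Lemma path_hol_loop f : continuous f -> f 0 = f 1 ->
  exists K, forall k, (K <= k)%N -> path_hol f k = 1%g.
Proof.
move=> cf f01; have [_ /(_ f _ f01)] := scT.
have cf' : {within `[0, 1]%classic, continuous f} by exact: continuous_subspaceT.
move=> /(_ cf')[H [cH Ht Hs]].
pose H' (p : R * R) := H (clamp p.1, clamp p.2).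
have cH' : continuous H'.
  apply: within_comp cH => [p|p]; last by split; exact: clamp01.
  move: p; apply: continuous_pair => q.
    by apply: (@continuous_comp _ R R (fun p : R * R => p.1) (@clamp R) q);
      [exact: cvg_fst|exact: continuous_clamp].
  by apply: (@continuous_comp _ R R (fun p : R * R => p.2) (@clamp R) q);
    [exact: cvg_snd|exact: continuous_clamp].
have c2 : compact (`[0, 1] `*` `[0, 1] : set (R * R)).
  by apply: compact_setX; exact: segment_compact.
have [d d0 dP] := lebesgue_number oO cO c2 cH'.
have [K KP] := mesh_eventually d0; exists K => k /KP[k0 kd].
pose row a := hol tau (fun j => H' (a%:R / k%:R, j%:R / k%:R)) k.
have unit_le j : (j <= k)%N -> 0 <= (j%:R / k%:R : R) <= 1.
  by move=> /(unit_fraction k0); rewrite /= in_itv.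
have cl j : (j <= k)%N -> clamp (j%:R / k%:R : R) = j%:R / k%:R.
  by move=> /unit_le /andP[? ?]; exact: clampE.
have H0 a : (a <= k)%N -> H' (a%:R / k%:R, 0%:R / k%:R) = f 0.
  by move=> ak; rewrite /H' /= !cl // mul0r; have [] := Hs _ (unit_le _ ak).
have H1 a : (a <= k)%N -> H' (a%:R / k%:R, k%:R / k%:R) = f 0.
  move=> ak; rewrite /H' /= !cl // divff ?pnatr_eq0 -?lt0n //.
  by have [] := Hs _ (unit_le _ ak).
have [i0 Oi0] := cO (f 0).
have ball_step (x : R) (a : nat) : `|x - a%:R / k%:R| <= k%:R^-1 -> ball (a%:R / k%:R : R) d x.
  by move=> h; rewrite /ball /= distrC; exact: le_lt_trans kd.
have near0 a : `|a%:R / k%:R - a%:R / k%:R| <= k%:R^-1 :> R.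
  by rewrite subrr normr0 invr_ge0.
have near1 a : `|a.+1%:R / k%:R - a%:R / k%:R| <= k%:R^-1 :> R.
  by rewrite -mulrBl -natrB // subSnn mul1r ger0_norm // invr_ge0.
have rowS a : (a < k)%N -> row a = row a.+1.
  move=> ak.
  have := @hol_ladder _ _ _ O tau tauM (fun j => H' (a%:R / k%:R, j%:R / k%:R))
    (fun j => H' (a.+1%:R / k%:R, j%:R / k%:R)) k.
  rewrite !H0 ?H1 ?(ltnW ak) // (tau1 tauM Oi0) mulg1 mul1g; apply.
  - move=> j jk; have [|i iP] := dP (a%:R / k%:R, j%:R / k%:R).
      by split; apply: unit_fraction => //; exact: ltnW.
    by exists i; split; apply: iP; split => /=; exact: ball_step.
  - by exists i0.
have row0 a : (a <= k)%N -> row a = row 0%N.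
  elim: a => // a IH ak; rewrite -rowS // IH //; exact: ltnW.
have -> : path_hol f k = row 0%N.
  apply: eq_hol => j jk; rewrite /H' /= !cl // mul0r.
  by have [->] := Ht _ (unit_le _ jk).
rewrite -(row0 k) // /row (@eq_hol _ _ _ _ (fun=> f 0)); last first.
  move=> j jk; rewrite /H' /= !cl // divff ?pnatr_eq0 -?lt0n //.
  by have [] := Ht _ (unit_le _ jk).
by rewrite (hol_local tauM (i := i0)) // (tau1 tauM Oi0).
Qed.

Lemma path_to (y : T) : exists f, [/\ continuous f, f 0 = 1%g & f 1 = y].
Proof.
have [pc _] := scT; have [f [cf f0 f1]] := pc 1%g y.
exists (fun t => f (clamp t)); split.
- exact: within_comp (@continuous_clamp R) (@clamp01 R) cf.
- by rewrite clamp_le0.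
- by rewrite clamp_ge1.
Qed.

(** Applies [path_hol_loop] to f1, then g, then f2 backwards. In a group this concatenation can be
    written as a product whose factors are constant outside their own third of the interval, which
    gives continuity at once; a mesh of 3 k steps restricts to k steps on each third. *)
Lemma path_hol_triangle f1 (g : R -> T) f2 : continuous f1 -> continuous g -> continuous f2 ->
  f1 0 = 1%g -> f2 0 = 1%g -> f1 1 = g 0 -> g 1 = f2 1 ->
  exists K, forall k, (K <= k)%N -> (path_hol f1 k * path_hol g k = path_hol f2 k)%g.
Proof.
move=> cf1 cg cf2 f10 f20 fg gf.
pose l t : T := (f1 (clamp (3 * t)%R) * ((f1 1%R)^-1 * g (clamp (3 * t - 1)%R)) *
  ((f2 1%R)^-1 * f2 (1 - clamp (3 * t - 2))%R))%g.
have c3 (r : R) : continuous (fun t : R => clamp (3 * t - r)).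
  move=> t; apply: (@continuous_comp R R R (fun t : R => 3 * t - r) (@clamp R) t).
    apply: cvgB; last exact: cvg_cst.
    by apply: cvgM; [exact: cvg_cst|exact: cvg_id].
  exact: continuous_clamp.
have cl : continuous l.
  apply: continuous_mulg; first apply: continuous_mulg.
  - move=> t; apply: (@continuous_comp R R T (fun t : R => clamp (3 * t)) f1 t); last exact: cf1.
    by have := c3 0 t; rewrite (_ : (fun t => clamp (3 * t - 0)) = (fun t => clamp (3 * t))) //;
      apply/funext => u; rewrite subr0.
  - apply: continuous_mulg => t; first exact: cvg_cst.
    apply: (@continuous_comp R R T (fun t : R => clamp (3 * t - 1)) g t); last exact: cg.
    exact: c3.
  - apply: continuous_mulg => t; first exact: cvg_cst.
    apply: (@continuous_comp R R T (fun t : R => 1 - clamp (3 * t - 2)) f2 t); last exact: cf2.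
    by apply: cvgB; [exact: cvg_cst|exact: c3].
have l1 t : 3 * t <= 1 -> l t = f1 (clamp (3 * t)).
  move=> t1; rewrite /l (@clamp_le0 _ (3 * t - 1)); last lra.
  rewrite (@clamp_le0 _ (3 * t - 2)); last lra.
  by rewrite subr0 fg !mulVg !mulg1.
have l2 t : 1 <= 3 * t -> 3 * t <= 2 -> l t = g (clamp (3 * t - 1)).
  move=> t1 t2; rewrite /l (@clamp_ge1 _ (3 * t)) //.
  rewrite (@clamp_le0 _ (3 * t - 2)); last lra.
  by rewrite subr0 mulVg mulg1 mulVKg.
have l3 t : 2 <= 3 * t -> l t = f2 (1 - clamp (3 * t - 2)).
  move=> t1; rewrite /l (@clamp_ge1 _ (3 * t)); last lra.
  rewrite (@clamp_ge1 _ (3 * t - 1)); last lra.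
  by rewrite mulVKg gf mulVKg.
have l01 : l 0 = l 1.
  rewrite l1; last lra. rewrite l3; last lra.
  rewrite (@clamp_le0 _ (3 * 0)); last lra. rewrite (@clamp_ge1 _ (3 * 1 - 2)); last lra.
  by rewrite subrr f10 f20.
have [K KP] := path_hol_loop cl l01.
have [K2 KP2] := fine_mesh_eventually cf2.
exists (maxn K K2) => k; rewrite geq_max => /andP[Kk /KP2[k0 fine2]].
have kR : k%:R != 0 :> R by rewrite pnatr_eq0 -lt0n.
have k0R : 0 < k%:R :> R by rewrite ltr0n.
have t3 j : 3 * (j%:R / (3 * k)%:R) = j%:R / k%:R :> R.
  by rewrite natrM; field; exact: kR.
have := KP (3 * k)%N (leq_trans Kk (leq_pmull _ _)); rewrite /path_hol => /(_ isT).
have -> : (3 * k)%N = (k + (k + k))%N by rewrite !mulSn mul0n addn0.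
rewrite !hol_add.
have -> : (k + (k + k))%N = (3 * k)%N by rewrite !mulSn mul0n addn0.
have frac j : (j <= k)%N -> 0 <= (j%:R / k%:R : R) <= 1.
  by move=> jk; have := unit_fraction k0 jk; rewrite /= in_itv.
rewrite (@eq_hol _ _ tau (fun j => l (j%:R / (3 * k)%:R)) (fun j => f1 (j%:R / k%:R))); last first.
  by move=> j /frac /andP[j0 j1]; rewrite l1 t3 // clampE.
rewrite (@eq_hol _ _ tau (fun j => l ((k + j)%:R / (3 * k)%:R)) (fun j => g (j%:R / k%:R))); last first.
  move=> j /frac /andP[j0 j1]; have E : 3 * ((k + j)%:R / (3 * k)%:R) = 1 + j%:R / k%:R :> R.
    by rewrite t3 natrD mulrDl divff.
  rewrite l2 E; [|lra|lra].
  by rewrite (_ : 1 + j%:R / k%:R - 1 = j%:R / k%:R :> R) ?clampE //; lra.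
rewrite [X in (_ * (_ * X))%g](@eq_hol _ _ tau _ (fun j => f2 ((k - j)%:R / k%:R))); last first.
  move=> j jk; have /andP[j0 j1] := frac _ jk.
  have E : 3 * ((k + (k + j))%:R / (3 * k)%:R) = 2 + j%:R / k%:R :> R.
    by rewrite t3 !natrD !mulrDl divff //; lra.
  rewrite l3 E; last lra.
  rewrite (_ : 2 + j%:R / k%:R - 2 = j%:R / k%:R :> R); last lra.
  by rewrite clampE // natrB // mulrBl divff.
have := @hol_rev _ _ _ O tau tauM (fun j => f2 (j%:R / k%:R)) k.
rewrite /= => ->.
  by rewrite mulgA => /divg1_eq.
move=> j /fine2[i iP]; exists i; split; apply: iP; rewrite ?lexx ?andbT //=.
  by rewrite ler_pM2r ?invr_gt0 // ler_nat.
by rewrite ler_pM2r ?invr_gt0 // ler_nat.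
Qed.

(** kappa y is the holonomy along a chosen path from 1 to y. For y near x, the path to x followed by
    a short path inside one [O i] can replace it, and the holonomy of the short path is
    [tau x y]. *)
Lemma monodromy : exists kappa : T -> Delta, forall x : T,
  \forall y \near x, kappa y = (kappa x * tau x y)%g.
Proof.
pose path y := sval (cid (path_to y)).
have pathP y : [/\ continuous (path y), path y 0 = 1%g & path y 1 = y].
  by rewrite /path; case: cid.
have stable y : {v | exists K, forall k, (K <= k)%N -> path_hol (path y) k = v}.
  by apply: cid; have [cy _ _] := pathP y; have [K [v Kv]] := path_hol_stable cy; exists v, K.
exists (fun y => sval (stable y)) => x.
have [i Oi] := cO x.
have Ui : nbhs 1%g [set u | O i (x * u)%g].
  by apply/nbhs_lmul; rewrite mulg1; exact: open_nbhs_nbhs.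
have : nbhs x [set y | exists f, [/\ continuous f, f 0 = 1%g, f 1 = (x^-1 * y)%g &
    forall t, O i (x * f t)%g]].
  rewrite -{1}(mulg1 x); apply/nbhs_lmul.
  by apply: filterS (lpcT Ui) => s /= [f [? ? ? ?]]; exists f; rewrite mulKg.
apply: filterS => y [f [cf f0 f1 fO]].
have [cx x0 x1] := pathP x; have [cy y0 y1] := pathP y.
have cg : continuous (fun t => (x * f t)%g).
  by apply: continuous_mulg => // t; exact: cvg_cst.
have [||K KP] := path_hol_triangle cx cg cy x0 y0.
- by rewrite x1 f0 mulg1.
- by rewrite y1 f1 mulVKg.
case: (stable x) => vx /= [Kx vxP]; case: (stable y) => vy /= [Ky vyP].
pose k := (maxn (maxn K Kx) (maxn Ky 1)).
have [k1 k2 k3 k4] : [/\ (K <= k)%N, (Kx <= k)%N, (Ky <= k)%N & (1 <= k)%N].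
  by rewrite /k; split; rewrite !leq_max leqnn ?orbT.
rewrite -(vxP k k2) -(vyP k k3) -(KP k k1); congr (_ * _)%g.
rewrite /path_hol (hol_local tauM (i := i)) // mul0r f0 mulg1 divff ?pnatr_eq0 -?lt0n //.
by rewrite f1 mulVKg.
Qed.

End monodromy.

(** * Covering groups *)

Section locally_compact_group.
Variables (R : realType) (T : topGroupType).
Hypotheses (lcT : locally_compact [set: T]) (hT : hausdorff_space T).
Hypothesis pcT : path_connected_space R T.

Lemma closure_mul (A U : set T) x : closure A x -> nbhs 1 U ->
  exists a u, [/\ A a, U u & x = a * u].
Proof.
move=> cAx U1.
have : nbhs x [set y | U (y^-1 * x)].
  have c : continuous (fun y : T => y^-1 * x).
    by apply: continuous_mulg => y; [exact: invg_continuous|exact: cvg_cst].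
  by have := c x; rewrite /continuous_at mulVg; apply.
move=> /cAx[a [Aa Ua]]; exists a, (a^-1 * x); split => //.
by rewrite mulVKg.
Qed.

Lemma compact_nbhs1 (U : set T) : nbhs 1 U ->
  exists K, [/\ compact K, nbhs 1 K & K `<=` U].
Proof.
move=> /nbhs1_sym2[V [oV V1 Vi VU]].
have [K0 nK0 [cK0 _]] := lcT I : compact_near (within [set: T] (nbhs (1 : T))).
have {}nK0 : nbhs 1 K0 by move: nK0; rewrite /within /=; apply: filterS => x; apply.
have Vn : nbhs 1 V by exact: open_nbhs_nbhs.
exists (closure V `&` K0); split.
- apply: (@subclosed_compact T (closure V `&` K0) K0) => //.
  by apply: closedI; [exact: closed_closure|exact: (compact_closed hT cK0)].
- by apply: filterI => //; apply: filterS Vn; exact: subset_closure.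
- by move=> x [/closure_mul /(_ Vn)[a [u [Va Vu ->]]] _]; exact: VU.
Qed.

Lemma clopen_path (X : set T) : open X -> closed X -> X 1 -> X = setT.
Proof.
move=> oX cX X1; apply/seteqP; split => // y _.
have [f [cf f0 f1]] := pcT 1 y.
pose g t := f (clamp t).
have cg : continuous g by exact: within_comp (@continuous_clamp R) (@clamp01 R) cf.
have g0 : g 0%R = 1 by rewrite /g clamp_le0.
have g1 : g 1%R = y by rewrite /g clamp_ge1.
have : `[0%R, 1%R]%classic `&` g @^-1` X = `[0%R, 1%R]%classic.
  apply: (@segment_connected R 0%R 1%R).
  - by exists 0%R; split; rewrite /= ?g0 // in_itv /= lexx ler01.
  - by exists (g @^-1` X) => //; apply: (open_comp _ oX) => t _; exact: cg.
  - by exists (g @^-1` X) => //; apply: (closed_comp _ cX) => t _; exact: cg.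
move=> E; have : `[0%R, 1%R]%classic (1%R : R) by rewrite /= in_itv /= lexx ler01.
by rewrite -E => -[_]; rewrite /= g1.
Qed.

(** [V * V] lies in a compact set, which finitely many translates of [V] cover. The translates of
    [V] by words in their centres have an open union, which is also closed, hence everything; and
    there are countably many words. *)
Lemma lindelof_translates (U : set T) : nbhs 1 U ->
  exists c : nat -> T, forall x, exists n, U ((c n)^-1 * x).
Proof.
move=> U1; have [K [cK nK _]] := compact_nbhs1 (@filterT _ (nbhs (1 : T)) _).
have [V [oV V1 Vi VUK]] := nbhs1_sym (filterI U1 nK).
have cKK : compact ((fun q : T * T => q.1 * q.2) @` (K `*` K)).
  apply: continuous_compact; last exact: compact_setX.
  by apply: continuous_subspaceT; exact: mulg_continuous.
move: cKK; rewrite compact_cover => /(_ T setT (fun c => [set x | V (c^-1 * x)])) [].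
- by move=> c _; exact: open_lmul.
- by move=> x _; exists x => //=; rewrite mulVg.
move=> F _ cov; pose l := finmap.enum_fset F.
pose prod (s : seq nat) := foldr (fun i x => nth 1 l i * x) 1 s.
have prod_rcons s i : prod (rcons s i) = prod s * nth 1 l i.
  elim: s => [|j s IH]; rewrite /prod /= ?mulg1 ?mul1g //.
  by rewrite -/(prod (rcons s i)) IH mulgA.
pose X := [set x | exists s, V ((prod s)^-1 * x)].
have VK : V `<=` K by move=> v /VUK[].
have XVV s v v' : V v -> V v' -> X (prod s * v * v').
  move=> Vv Vv'; have [|f /= fF Vf] := cov (v * v').
    by exists (v, v') => //; split; exact: VK.
  have /(nthP 1)[i il fi] : f \in l by [].
  exists (rcons s i); rewrite prod_rcons fi invgM -!mulgA mulKg.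
  by rewrite mulgA; move: Vf; rewrite -?mulgA.
have XT : X = setT.
  apply: clopen_path.
  - rewrite (_ : X = \bigcup_s [set x | V ((prod s)^-1 * x)]).
      by apply: bigcup_open => s _; exact: open_lmul.
    by apply/seteqP; split => x [s]; [exists s|exists s].
  - move=> x /closure_mul /(_ (open_nbhs_nbhs (conj oV V1)))[a [v [[s Va] Vv ->]]].
    by rewrite -(mulVKg (prod s) a); exact: XVV.
  - by exists [::]; rewrite /= invg1 mulg1.
exists (fun n => prod (odflt [::] (unpickle n))) => x.
have [s Vs] : X x by rewrite XT.
by exists (pickle s); rewrite pickleK /=; have [] := VUK _ Vs.
Qed.

Definition paths_in (W : set T) : set T := [set s | exists f : R -> T,
  [/\ continuous f, f 0%R = 1, f 1%R = s & forall t, W (f t)]].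

Lemma paths_in_quotient (W U : set T) : (forall x y, U x -> U y -> W (x^-1 * y)) ->
  forall x y, paths_in U x -> paths_in U y -> paths_in W (x^-1 * y).
Proof.
move=> UW x y [f [cf f0 f1 fU]] [g [cg g0 g1 gU]].
exists (fun t => (f t)^-1 * g t); split.
- by apply: continuous_mulg => //; exact: continuous_invg.
- by rewrite f0 g0 mulVg.
- by rewrite f1 g1.
- by move=> t; exact: UW.
Qed.

(** A path is coded by the list of translates of [U] that it visits along a fine mesh. If f and g
    have the same code, f^-1 * g stays in [W]; the endpoints of one path per code serve as
    centres. *)
Lemma countable_paths (W : set T) : nbhs 1 W ->
  exists c : nat -> T, forall x, exists n, paths_in W ((c n)^-1 * x).
Proof.
move=> /nbhs1_sym2[U [oU U1 Ui UW]].
have [c cP] := lindelof_translates (open_nbhs_nbhs (conj oU U1)).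
pose data (s : seq nat) (f : R -> T) := [/\ continuous f, f 0%R = 1, (0 < size s)%N &
  forall j, (j < size s)%N -> forall t,
    (j%:R / (size s)%:R <= t <= j.+1%:R / (size s)%:R)%R ->
    U ((c (nth 0%N s j))^-1 * f t)].
have dataP s : {f : R -> T | (exists g, data s g) -> data s f}.
  apply: cid; have [[f df]|nd] := pselect (exists g, data s g); first by exists f.
  by exists (fun=> 1) => /nd.
exists (fun n => sval (dataP (odflt [::] (unpickle n))) 1%R) => x.
have [h [ch h0 h1]] := pcT 1 x.
pose f t := h (clamp t).
have cf : continuous f by exact: within_comp (@continuous_clamp R) (@clamp01 R) ch.
have f0 : f 0%R = 1 by rewrite /f clamp_le0.
have f1 : f 1%R = x by rewrite /f clamp_ge1.
have oO n : open [set y | U ((c n)^-1 * y)] by exact: open_lmul.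
have [k fk] := fine_mesh_eventually (O := fun n => [set y | U ((c n)^-1 * y)]) oO cP cf.
have [k0 kP] := fk _ (leqnn k).
have iP j : {i | (j < k)%N -> forall t, (j%:R / k%:R <= t <= j.+1%:R / k%:R)%R ->
    U ((c i)^-1 * f t)}.
  apply: cid; have [jk|nj] := boolP (j < k)%N; last by exists 0%N.
  by have [i iP] := kP j jk; exists i.
pose s := mkseq (fun j => sval (iP j)) k.
have sk : size s = k by rewrite size_mkseq.
have df : data s f.
  split => //; rewrite sk // => j jk t tj; rewrite nth_mkseq //.
  by case: (iP j) => i /= H; exact: H.
exists (pickle s); rewrite pickleK /=; case: (dataP s) => g /= dg.
have [cg g0 _ gP] := dg (ex_intro _ f df); have [_ _ _ fP] := df.
exists (fun t => (g (clamp t))^-1 * f (clamp t)); split.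
- apply: continuous_mulg.
    apply: continuous_invg => t; apply: (@continuous_comp R R T (@clamp R) g t); last exact: cg.
    exact: continuous_clamp.
  move=> t; apply: (@continuous_comp R R T (@clamp R) f t); last exact: cf.
  exact: continuous_clamp.
- by rewrite clamp_le0 // g0 f0 mulVg.
- by rewrite clamp_ge1 // f1.
- move=> t; have := clamp01 t; move: (clamp t) => {}t; rewrite /= in_itv /= => /andP[t0 t1].
  have kR : (0 < k%:R :> R)%R by rewrite ltr0n.
  have [j [jk tj]] : exists j, (j < size s)%N /\
      (j%:R / (size s)%:R <= t <= j.+1%:R / (size s)%:R)%R.
    (* The integer part of t * k names the interval of t, except for t = 1, which belongs to the
       last one. *)
    rewrite sk; have [t1'|t1'] := ltP t 1%R.
      exists (Num.Def.truncn (t * k%:R)%R).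
      have tk0 : (0 <= t * k%:R)%R by rewrite mulr_ge0.
      have tle : ((Num.Def.truncn (t * k%:R))%:R <= t * k%:R)%R by rewrite truncn_le.
      split; last first.
        by rewrite ler_pdivrMr // tle /= ler_pdivlMr // ltW // truncnS_gt.
      rewrite -(ltr_nat R); apply: (le_lt_trans tle).
      by rewrite gtr_pMl.
    have -> : t = 1%R by apply/eqP; rewrite eq_le t1 t1'.
    exists k.-1; rewrite prednK // divff ?gt_eqF // lexx andbT; split => //.
    by rewrite ler_pdivrMr // mul1r ler_nat leq_pred.
  have := UW _ _ (Ui _ (gP j jk t tj)) (fP j jk t tj).
  by rewrite invgM invgK -!mulgA mulVKg.
Qed.

End locally_compact_group.

(** * Infinite concatenation of shrinking paths *)

Section concatenation.
Variables (R : realType) (T : topGroupType).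
Local Open Scope ring_scope.
Variables (f : nat -> R -> T) (s : nat -> T) (U : nat -> set T).
Hypothesis cf : forall n, continuous (f n).
Hypothesis f0 : forall n, f n 0 = 1%g.
Hypothesis f1 : forall n, (f n 1 * s n.+1)%g = s n.
Hypothesis fU : forall n t, U n (f n t).
Hypothesis sU : forall n, U n (s n).
Hypothesis Ub : forall V : set T, nbhs (1%g : T) V -> exists n0, forall n, (n0 <= n)%N ->
  forall x y, U n x -> U n y -> V (x^-1 * y)%g.

Let theta (t : R) := t / (1 - t).

Let partial N (r : R) : T := foldr (fun n x => (f n (clamp (r - n%:R)%R) * x)%g) 1%g (iota 0 N).

Let partialS N r : partial N.+1 r = (partial N r * f N (clamp (r - N%:R)))%g.
Proof.
rewrite /partial -[N.+1]addn1 iotaD /= add0n foldr_cat /= mulg1.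
move: (iota 0 N) => l; elim: l => [|n l IH] /=; first by rewrite mul1g.
by rewrite IH mulgA.
Qed.

(** Completed factors telescope, as f n 1 = s n * (s n.+1)^-1. *)
Let partial_le N r : (forall n, (n < N)%N -> n.+1%:R <= r) -> partial N r = (s 0%N * (s N)^-1)%g.
Proof.
elim: N => [|N IH] Nr; first by rewrite mulgV.
rewrite partialS IH => [|n nN]; last by apply: Nr; exact: leqW.
have rN := Nr N (ltnSn N); rewrite -natr1 in rN.
by rewrite clamp_ge1 ?lerBrDr 1?addrC // -(f1 N) invgM !mulgA mulgVK.
Qed.

Let partial_ge N n r : r <= n%:R -> (n <= N)%N -> partial N r = partial n r.
Proof.
move=> rn; elim: N => [|N IH]; first by rewrite leqn0 => /eqP ->.
rewrite leq_eqVlt => /orP[/eqP -> //|]; rewrite ltnS => nN.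
rewrite partialS IH // clamp_le0 ?f0 ?mulg1 // subr_le0.
by apply: le_trans rn _; rewrite ler_nat.
Qed.

Let continuous_partial N : continuous (partial N).
Proof.
rewrite /partial; elim: (iota 0 N) => [|n l IH] /=; first by move=> r; exact: cvg_cst.
apply: continuous_mulg => // r.
apply: (@continuous_comp R R T (fun r : R => clamp (r - n%:R)) (f n) r); last exact: cf.
apply: (@continuous_comp R R R (fun r : R => r - n%:R) (@clamp R) r).
  by apply: cvgB; [exact: cvg_id|exact: cvg_cst].
exact: continuous_clamp.
Qed.

(* The infinite product of the paths f 0, f 1, ..; the n-th one is run through
   for t / (1 - t) in [n, n + 1]. *)
Definition concatenation (t : R) : T :=
  if t < 1 then partial (Num.Def.truncn (theta t)).+1 (theta t) else s 0%N.

Let theta_cont t : t < 1 -> {for t, continuous theta}.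
Proof.
move=> t1; apply: cvgM; first exact: cvg_id.
apply: cvgV; first by rewrite subr_eq0 eq_sym lt_eqF.
by apply: cvgB; [exact: cvg_cst|exact: cvg_id].
Qed.

Let concatenationE N t : t < 1 -> theta t <= N%:R -> concatenation t = partial N (theta t).
Proof.
move=> t1 tN; rewrite /concatenation t1; set n := (Num.Def.truncn _).+1.
have tn : theta t <= n%:R by rewrite ltW // truncnS_gt.
by rewrite -(partial_ge tn (leq_maxl n N)) (partial_ge tN (leq_maxr n N)).
Qed.

Let concatenation_form t : 0 <= t -> t < 1 ->
  exists n, [/\ n%:R <= theta t, theta t < n.+1%:R & exists r, concatenation t = (s 0%N * ((s n)^-1 * f n r))%g].
Proof.
move=> t0 t1; have th0 : 0 <= theta t by rewrite divr_ge0 // subr_ge0 ltW.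
exists (Num.Def.truncn (theta t)); split; [by rewrite truncn_le|exact: truncnS_gt|].
rewrite /concatenation t1 partialS partial_le; first by eexists; rewrite mulgA.
by move=> n nN; apply: (@le_trans _ _ (Num.Def.truncn (theta t))%:R); rewrite ?ler_nat // truncn_le.
Qed.

Lemma concatenation0 : concatenation 0 = 1%g.
Proof.
rewrite (@concatenationE 0) //; last by rewrite /theta mul0r.
Qed.

Lemma concatenation1 : concatenation 1 = s 0%N.
Proof. by rewrite /concatenation ltxx. Qed.

(** Before time 1 a fixed finite product describes the function nearby. Close to time 1 the value is
    s 0 * ((s n)^-1 * f n r) with large n, and both s n and f n r lie in the shrinking set [U n]. *)
Lemma continuous_concatenation : continuous concatenation.
Proof.
move=> t; have [t1|t1] := ltP t 1.
  pose N := (Num.Def.truncn (theta t)).+1.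
  have tN : theta t < N%:R by exact: truncnS_gt.
  have nearE : \forall u \near t, concatenation u = partial N (theta u).
    have h1 : \forall u \near t, u < 1 by exact: lt_nbhsl.
    have h2 : \forall u \near t, theta u < N%:R.
      exact: (theta_cont t1 (lt_nbhsl tN : nbhs (theta t) [set r | r < N%:R])).
    apply: filterS2 h1 h2 => u u1 uN; apply: concatenationE => //; exact: ltW.
  rewrite /continuous_at (@concatenationE N) //; last exact: ltW.
  have c : {for t, continuous (fun u => partial N (theta u))}.
    exact: (@continuous_comp R R T theta (partial N) t (theta_cont t1) (@continuous_partial N (theta t))).
  move=> V /c; rewrite !nbhs_simpl /= => H.
  by apply: filterS2 nearE H => u eu Hu; rewrite /preimage /= eu.
rewrite le_eqVlt in t1; case/orP: t1 => [/eqP <-|t1]; last first.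
  have h1 : \forall u \near t, 1 < u by exact: lt_nbhsr.
  rewrite /continuous_at {2}/concatenation ltNge (ltW t1) /=.
  move=> V Vs; rewrite nbhs_simpl /=; apply: filterS h1 => u u1.
  by rewrite /preimage /= /concatenation ltNge (ltW u1) /=; exact: nbhs_singleton.
rewrite /continuous_at concatenation1 => V Vs.
have /Ub[n0 n0P] : nbhs (1%g : T) [set v | V (s 0%N * v)%g].
  by apply/nbhs_lmul; rewrite mulg1.
(* [theta] sends this time to n0, so from then on only pieces of index at least n0 are running. *)
have d0 : (n0%:R / n0.+1%:R : R) < 1.
  by rewrite ltr_pdivrMr ?ltr0n // mul1r ltr_nat.
have h1 : \forall u \near (1 : R), n0%:R / n0.+1%:R < u by exact: lt_nbhsr.
rewrite nbhs_simpl /=; apply: filterS h1 => u u1.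
have [lt1|ge1] := ltP u 1; last first.
  by rewrite /preimage /= /concatenation ltNge ge1 /=; exact: nbhs_singleton.
rewrite /preimage /=.
have u0 : 0 <= u by apply: le_trans (ltW u1); rewrite divr_ge0.
have [n [n1 n2 [r ->]]] := concatenation_form u0 lt1.
suff nn : (n0 <= n)%N by exact: (n0P n nn _ _ (sU n) (fU n r)).
rewrite -ltnS -(ltr_nat R); apply: le_lt_trans n2.
rewrite /theta ler_pdivlMr ?subr_gt0 //.
move: u1; rewrite ltr_pdivrMr ?ltr0n // -natr1; lra.
Qed.

Lemma concatenation_in (V : set T) : V 1%g -> V (s 0%N) ->
  (forall n x y, U n x -> U n y -> V (s 0%N * (x^-1 * y))%g) ->
  forall t, V (concatenation (clamp t)).
Proof.
move=> V1 Vs VU t; have := clamp01 t; move: (clamp t) => {}t.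
rewrite /= in_itv /= => /andP[t0 t1].
have [lt1|ge1] := ltP t 1; last by rewrite /concatenation ltNge ge1.
by have [n [_ _ [r ->]]] := concatenation_form t0 lt1; exact: VU.
Qed.

End concatenation.

(** * Openness of the covering map and local path connectedness of the cover *)

Section covering.
Variables (R : realType) (G : topGroupType) (mG : probability (borel G) R).
Hypotheses (cG : compact [set: G]) (pG : polish_space R G) (hG : haar_measure mG).
Variables (T : topGroupType) (p : T -> G).
Hypotheses (lcT : locally_compact [set: T]) (hT : hausdorff_space T).
Hypothesis pcT : path_connected_space R T.
Hypotheses (pM : {morph p : x y / x * y}) (cp : continuous p) (sp : range p = [set: G]).
Hypothesis kp : p @^-1` [set 1] `<=` isolated (p @^-1` [set 1]).
Local Notation m := (pr mG).
Local Notation M := (@measurable _ (borel G)).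

Lemma cover1 : p 1 = 1.
Proof. by apply: (@mulgI _ (p 1)); rewrite -pM !mulg1. Qed.

Lemma coverV x : p x^-1 = (p x)^-1.
Proof. by apply/esym/mulg1_eq; rewrite -pM mulgV cover1. Qed.

Lemma cover_lift y : exists x, p x = y.
Proof. by have : range p y by [rewrite sp|]; move=> [x _ <-]; exists x. Qed.

Lemma cover_injective_near1 : exists U, [/\ open U, U 1 &
  forall x y, U x -> U y -> p x = p y -> x = y].
Proof.
have [_ [V V1 VK]] := kp cover1.
have [U [oU U1 Ui UV]] := nbhs1_sym2 V1; exists U; split => // x y Ux Uy pxy.
have : (V `&` p @^-1` [set 1]) (x^-1 * y).
  by split; [exact: UV (Ui _ Ux) Uy|rewrite /= pM coverV pxy mulVg].
by rewrite VK /= => /mulg1_eq; rewrite invgK.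
Qed.

(** Countably many images cover G, so one of them has positive measure, and by Steinhaus' theorem
    its quotients fill a neighbourhood of 1. *)
Lemma compact_images_cover (K : nat -> set T) :
  (forall n, compact (K n)) -> (forall x, exists n, K n x) ->
  exists n, nbhs 1 (p @` [set q.1^-1 * q.2 | q in K n `*` K n]).
Proof.
move=> cK covK.
have cpK n : compact (p @` K n).
  by apply: continuous_compact => //; apply: continuous_subspaceT; exact: cp.
have mpK n : M (p @` K n).
  by apply: closed_borel; apply: compact_closed => //; exact: polish_hausdorff pG.
have [n n0] : exists n, (0 < m (p @` K n))%R.
  apply: contrapT => /forallNP K0.
  have : m (\bigcup_n (p @` K n)) = 0%R.
    apply: pr_cup0 => // n; apply/eqP; rewrite eq_le pr_ge0 andbT leNgt.
    by apply/negP; exact: K0.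
  rewrite (_ : \bigcup_n _ = setT) ?prT; first by move/eqP; rewrite oner_eq0.
  apply/seteqP; split => // y _; have [x <-] := cover_lift y.
  by have [n Kx] := covK x; exists n => //; exists x.
exists n; have := steinhaus pG hG (mpK n) n0; apply: filterS => u u0.
have [t [[x Kx tx] [y Ky ty]]] : exists t, (p @` K n) t /\ (p @` K n) (t * u).
  apply: contrapT => /forallNP nt; move: u0.
  rewrite (_ : [set _ | _] = set0) ?pr0 ?ltxx //.
  by apply/seteqP; split => // t /nt.
exists (x^-1 * y); first by exists (x, y).
by rewrite pM coverV tx ty mulKg.
Qed.

(** Open mapping theorem: countably many translates of a small compact set [K] cover T, and
    translation does not change the quotients x^-1 * y. *)
Lemma cover_open1 (U : set T) : nbhs 1 U -> nbhs 1 (p @` U).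
Proof.
move=> /nbhs1_sym2[V [oV V1 Vi VU]].
have [K [cK nK KV]] := compact_nbhs1 lcT hT (open_nbhs_nbhs (conj oV V1)).
have [c cP] := lindelof_translates lcT hT pcT nK.
have [||n] := @compact_images_cover (fun n => [set x | K ((c n)^-1 * x)]).
- move=> n; rewrite (_ : [set _ | _] = (fun x => c n * x) @` K).
    by apply: continuous_compact => //; apply: continuous_subspaceT; exact: continuous_lmul.
  apply/seteqP; split => [x Kx|_ [x Kx <-]]; last by rewrite /= mulKg.
  by exists ((c n)^-1 * x) => //; rewrite mulVKg.
- by [].
apply: filterS => _ [_ [[x y] [/= Kx Ky] <-] <-]; exists (x^-1 * y) => //.
have := VU _ _ (Vi _ (KV _ Kx)) (KV _ Ky).
by rewrite invgM invgK -mulgA mulVKg.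
Qed.

(** As [p] is open at 1 and injective near 1, a countable basis at 1 in G pulls back to one in T. *)
Lemma cover_basis1 : exists B : nat -> set T, [/\ forall n, nbhs 1 (B n),
  forall n k, (n <= k)%N -> B k `<=` B n & forall U, nbhs 1 U -> exists n, B n `<=` U].
Proof.
have [V [oV V1 Vd Vb]] := nbhs1_basis pG.
have [U0 [oU0 U01 U0i]] := cover_injective_near1.
have nU0 : nbhs 1 U0 by exact: open_nbhs_nbhs.
exists (fun n => U0 `&` p @^-1` V n); split.
- move=> n; apply: filterI => //; apply: cp; rewrite cover1; exact: open_nbhs_nbhs.
- by move=> n k nk x [U0x /(Vd _ _ nk)].
- move=> U nU; have [n Vn] := Vb _ (cover_open1 (filterI nU nU0)).
  exists n => x [U0x /Vn[y [Uy U0y] yx]].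
  by rewrite -(U0i _ _ U0y U0x yx).
Qed.

(* Countably many translates of [paths_in W'] cover T; Baire's theorem is
   replaced by the fact that some image in G has positive measure. *)
Lemma closure_paths_nbhs (W : set T) : nbhs 1 W -> nbhs 1 (closure (paths_in R W)).
Proof.
move=> /nbhs1_sym2[W' [oW' W'1 W'i W'W]].
have [c cP] := countable_paths lcT hT pcT (open_nbhs_nbhs (conj oW' W'1)).
have [U0 [oU0 U01 U0i]] := cover_injective_near1.
have nU0 : nbhs 1 U0 by exact: open_nbhs_nbhs.
have [V [oV V1 Vi VU]] := nbhs1_sym2 nU0.
have [K [cK nK KV]] := compact_nbhs1 lcT hT (open_nbhs_nbhs (conj oV V1)).
have [d dP] := lindelof_translates lcT hT pcT nK.
pose C := closure (paths_in R W').
have ctrans (k : T) (A : set T) : [set x | A (k^-1 * x)] = (fun x => k * x) @` A.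
  apply/seteqP; split => [x Kx|_ [x Kx <-]]; last by rewrite /= mulKg.
  by exists (k^-1 * x) => //; rewrite mulVKg.
have C1C x y : C x -> C y -> closure (paths_in R W) (x^-1 * y).
  move=> Cx Cy B /= nB.
  have [B1 [B2 [nB1 nB2 BB]]] := nbhs_mul2 nB.
  have [a [Pa B1a]] := Cx _ ((nbhs_inv _ _).1 nB1).
  have [b [Pb B2b]] := Cy _ nB2.
  exists (a^-1 * b); split; last exact: BB.
  by apply: (paths_in_quotient (U := W')) => // u v Wu Wv; apply: W'W => //; exact: W'i.
pose Kn (q : nat * nat) := [set x | C ((c q.1)^-1 * x) /\ K ((d q.2)^-1 * x)].
have cKn q : compact (Kn q).
  apply: (@subclosed_compact _ _ [set x | K ((d q.2)^-1 * x)]); last by move=> x [].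
    apply: closedI; apply: closed_comp => [x _|].
    - exact: continuous_lmul.
    - exact: closed_closure.
    - exact: continuous_lmul.
    - exact: (compact_closed hT cK).
  rewrite ctrans; apply: continuous_compact => //.
  by apply: continuous_subspaceT; exact: continuous_lmul.
have [||n nK'] := @compact_images_cover (fun n => Kn (odflt (0, 0)%N (unpickle n))).
- by move=> n; exact: cKn.
- move=> x; have [i Pi] := cP x; have [j Kj] := dP x.
  exists (pickle (i, j)); rewrite pickleK /=; split => //.
  exact: subset_closure.
move: (odflt _ _) nK' => q nK'.
have nN : nbhs 1 (p @^-1` (p @` [set r.1^-1 * r.2 | r in Kn q `*` Kn q])).
  by apply: cp; rewrite cover1.
apply: filterS2 nU0 nN => y U0y [_ [[a b] [/= [Ca Ka] [Cb Kb]] <-] pab].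
have abE : a^-1 * b = ((c q.1)^-1 * a)^-1 * ((c q.1)^-1 * b).
  by rewrite invgM invgK -mulgA mulVKg.
have abE' : a^-1 * b = ((d q.2)^-1 * a)^-1 * ((d q.2)^-1 * b).
  by rewrite invgM invgK -mulgA mulVKg.
have <- : a^-1 * b = y.
  by apply: U0i => //; rewrite abE'; apply: VU; [apply: Vi; exact: KV|exact: KV].
by rewrite abE; exact: C1C.
Qed.

(** Successive approximation: the closure of the set of path endpoints is a neighbourhood of 1, so s
    is the end of a short path times a remainder closer to 1. The same applies to the remainder, and
    so on; concatenating all these paths reaches s itself. *)
Lemma locally_path_connected (W : set T) : nbhs 1 W -> nbhs 1 (paths_in R W).
Proof.
move=> nW; have [B [nB Bd Bb]] := cover_basis1.
have [U [oU U1 Ui UW]] := nbhs1_sym2 nW.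
have [U' [oU' U'1 U'i U'U]] := nbhs1_sym2 (open_nbhs_nbhs (conj oU U1)).
have Un n : {V : set T | [/\ nbhs 1 V, forall x, V x -> V x^-1 & V `<=` U' `&` B n]}.
  apply: cid; have nUB : nbhs 1 (U' `&` B n).
    by apply: filterI (nB n); exact: open_nbhs_nbhs.
  have [V [oV V1 Vi VUB]] := nbhs1_sym nUB.
  by exists V; split => //; exact: open_nbhs_nbhs.
pose V n := sval (Un n).
have VP n : [/\ nbhs 1 (V n), forall x, V n x -> V n x^-1 & V n `<=` U' `&` B n].
  by rewrite /V; case: (Un n).
pose N n := V n `&` closure (paths_in R (V n)).
have nN n : nbhs 1 (N n).
  by have [nV _ _] := VP n; apply: filterI => //; exact: closure_paths_nbhs.
have step n s : {q : T * (R -> T) | N n s -> [/\ N n.+1 q.1, continuous q.2, q.2 0%R = 1,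
    q.2 1%R * q.1 = s & forall t, V n (q.2 t)]}.
  apply: cid; have [[_ cs]|nNs] := pselect (N n s); last by exists (1, fun=> 1) => /nNs.
  have [a [u [[f [cf f0 f1 fV]] Nu sau]]] := closure_mul cs (nN n.+1).
  by exists (u, f) => _; split => //=; rewrite f1.
apply: filterS (nN 0%N) => s Ns.
pose sq := fix sq n := if n is k.+1 then (sval (step k (sq k))).1 else s.
pose fq n := (sval (step n (sq n))).2.
have stepP n s' : N n s' -> [/\ N n.+1 (sval (step n s')).1, continuous (sval (step n s')).2,
    (sval (step n s')).2 0%R = 1, (sval (step n s')).2 1%R * (sval (step n s')).1 = s' &
    forall t, V n ((sval (step n s')).2 t)].
  by move=> H; case: (step n s') => q /= /(_ H).
have Nsq n : N n (sq n) by elim: n => //= n /stepP[].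
have cfq n : continuous (fq n) by have [] := stepP _ _ (Nsq n).
have fq0 n : fq n 0%R = 1 by have [] := stepP _ _ (Nsq n).
have fq1 n : fq n 1%R * sq n.+1 = sq n by have [] := stepP _ _ (Nsq n).
have fqV n t : V n (fq n t) by have [_ _ _ _ H] := stepP _ _ (Nsq n); exact: H.
have Vsq n : V n (sq n) by have [] := Nsq n.
have Vb (A : set T) : nbhs (1 : T) A -> exists n0, forall n, (n0 <= n)%N ->
    forall x y, V n x -> V n y -> A (x^-1 * y).
  move=> /nbhs1_sym2[A' [oA' A'1 A'i A'A]].
  have [n0 Bn0] := Bb _ (open_nbhs_nbhs (conj oA' A'1)).
  exists n0 => n n0n x y Vx Vy; have [_ _ VB] := VP n.
  have VA v : V n v -> A' v by move=> /VB[_ Bv]; exact: Bn0 (Bd _ _ n0n _ Bv).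
  by apply: A'A; [apply: A'i|]; exact: VA.
exists (fun t => concatenation fq sq (clamp t)); split.
- move=> t; apply: (@continuous_comp R R T (@clamp R) (concatenation fq sq) t).
    exact: continuous_clamp.
  exact: (continuous_concatenation cfq fq0 fq1 fqV Vsq Vb).
- by rewrite clamp_le0 // (concatenation0 sq fq0).
- by rewrite clamp_ge1 // concatenation1.
- have VU' n x : V n x -> U' x by have [_ _ H] := VP n; move=> /H[].
  have U'W x : U' x -> U x.
    by move=> U'x; rewrite -(mulg1 x); exact: U'U.
  move=> t; apply: (concatenation_in fq1 fqV Vsq (V := W)).
  + by rewrite -(mulg1 1); apply: UW.
  + by rewrite -(mulg1 (sq 0%N)); apply: UW => //; apply: U'W; exact: (VU' 0%N).
  + move=> n x y Vx Vy; apply: UW; first by apply: U'W; exact: (VU' 0%N).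
    by apply: U'U; [apply: U'i; exact: (VU' n)|exact: (VU' n)].
Qed.

End covering.

(** * Null sets of G pull back to null sets of the cover *)

Section null_sets.
Variables (R : realType) (G : topGroupType) (mG : probability (borel G) R).
Hypotheses (cG : compact [set: G]) (pG : polish_space R G) (hG : haar_measure mG).

Lemma ae_nbhs (P : G -> Prop) (x : G) (U : set G) : {ae mG, forall x : borel G, P x} ->
  nbhs x U -> exists y, U y /\ P y.
Proof.
move=> [N [mN N0 PN]] nU; apply: contrapT => /forallNP H.
pose V := U^°; have oV : open V by exact: open_interior.
have mV := open_borel oV.
have VN : V `<=` N by move=> y /interior_subset Uy; apply: PN => Py; exact: (H y).
have := haar_open cG pG hG (open_nbhs_nbhs (conj oV (nU : V x))) mV.
suff -> : pr mG V = 0%R by rewrite ltxx.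
apply/(pr_eq0 _ mV); apply/eqP; rewrite eq_le measure_ge0 andbT -N0.
by apply: le_measure; rewrite ?inE.
Qed.

Variables (T : topGroupType) (p : T -> G) (mT : {measure set (borel T) -> \bar R}).
Hypotheses (lcT : locally_compact [set: T]) (hT : hausdorff_space T).
Hypotheses (pcT : path_connected_space R T) (hmT : haar_measure mT).
Hypotheses (pM : {morph p : x y / x * y}) (cp : continuous p) (sp : range p = [set: G]).
Hypothesis kp : p @^-1` [set 1] `<=` isolated (p @^-1` [set 1]).

(** For every y, right translation by [p y] preserves null sets of G; exchanging the quantifiers by
    Fubini gives the claim. For this, [mT] is restricted to [K] and normalized to a probability. *)
Lemma ae_cover_slice (K : set T) (P : G -> Prop) : compact K ->
  {ae mG, forall x : borel G, P x} ->
  {ae mG, forall g : borel G, {ae mT, forall y : borel T, K y -> P (g * p y : G)}}.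
Proof.
move=> cK [N [mN N0 PN]].
have mK : @measurable _ (borel T) K by exact: closed_borel (compact_closed hT cK).
have [_ /(_ _ cK) fK _] := hmT.
pose mu := mrestr mT mK.
(* The Dirac mass is the default when the mass of [K] is 0 or infinite. In the first case there is
   nothing to prove, the second is excluded since [K] is compact. *)
pose nu := mnormalize mu (\d_(1 : borel T) : probability (borel T) R).
pose Q (q : borel T * borel G) := ~ N (q.2 * p q.1).
have mQ : measurable [set q | Q q].
  apply: measurableC.
  have mk : measurable_fun setT (fun q : borel T * borel G => (q.2, p q.1) : borel G * borel G).
    apply/measurable_fun_pairP; split => /=; first exact: measurable_snd.
    apply: (@measurableT_comp _ _ _ _ (borel T) (borel G) p _ fst) => //.
    exact: (continuous_borel cp).
  have := mk measurableT _ (measurable_mul2 pG mN); rewrite setTI.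
  by [].
have H : {ae nu, forall y : borel T, {ae mG, forall g : borel G, Q (y, g)}}.
  apply/aeW => y; apply: (@ae_rmul _ _ _ pG hG (p y) (fun x => ~ N x)).
  by exists N; split => // x /= /contrapT.
have := ae_swap mQ H; apply: ae_mono => g [N' [mN' N'0 QN']].
have mNg : @measurable _ (borel T) [set y | N (g * p y)].
  apply: (@continuous_preimage_borel T G (fun y => g * p y) N) => //.
  by apply: continuous_mulg => // y; exact: cvg_cst.
have sub : [set y | N (g * p y)] `<=` N' by move=> y Ny; apply: QN' => /=; exact.
have nu0 : nu [set y | N (g * p y)] = 0%E.
  apply/eqP; rewrite eq_le measure_ge0 andbT -N'0.
  by apply: le_measure; rewrite ?inE.
have mu0 : mu [set y | N (g * p y)] = 0%E.
  move: nu0; rewrite /nu /mnormalize; have muT : mu setT = mT K by rewrite /mu /mrestr setTI.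
  case: ifPn => [/orP[/eqP mu0 _|/eqP moo]|/norP[mu0 muoo] /eqP].
  - apply/eqP; rewrite eq_le measure_ge0 andbT -mu0.
    by apply: le_measure; rewrite ?inE.
  - by move: fK; rewrite (_ : mT K = +oo%E) ?ltxx // -muT; exact: moo.
  - rewrite mule_eq0 => /orP[/eqP //|/eqP[] /eqP]; rewrite invr_eq0 fine_eq0 ?(negbTE mu0) //.
    by rewrite ge0_fin_numE //; exact: (eq_ind_r (fun z => (z < +oo)%E) fK muT).
exists ([set y | N (g * p y)] `&` K); split => //; first exact: measurableI.
by move=> y /not_implyP[Ky nP]; split => //; exact: PN.
Qed.

(** Near each of countably many centres there is a g for which the slice statement holds at [p g].
    Left invariance of [mT] transfers it from [K] to g K, and these sets cover T. *)
Lemma ae_cover (P : G -> Prop) : {ae mG, forall x : borel G, P x} ->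
  {ae mT, forall x : borel T, P (p x)}.
Proof.
move=> aeP.
have [K [cK nK _]] := compact_nbhs1 lcT hT (@filterT _ (nbhs (1 : T)) _).
have [V [oV V1 Vi VK]] := nbhs1_sym2 nK.
have nV : nbhs 1 V by exact: open_nbhs_nbhs.
have [c cP] := lindelof_translates lcT hT pcT nV.
have aeK := ae_cover_slice cK aeP.
have gP n : {g : T | V ((c n)^-1 * g) /\
    {ae mT, forall y : borel T, K y -> P (p g * p y : G)}}.
  apply: cid.
  have nU : nbhs (p (c n)) [set x | (p @` V) ((p (c n))^-1 * x)].
    apply/nbhs_lmul; rewrite mulVg.
    exact: (cover_open1 pG hG lcT hT pcT pM cp sp nV).
  have [x [[v Vv vx] Kx]] := ae_nbhs aeK nU.
  exists (c n * v); rewrite mulKg; split => //.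
  by rewrite pM vx mulVKg.
pose g n := sval (gP n).
have aeg n : {ae mT, forall x : borel T, K ((g n)^-1 * x) -> P (p x)}.
  have [_ [N [mN N0 PN]]] := svalP (gP n); rewrite -/(g n) in PN.
  exists [set x | N ((g n)^-1 * x)]; split.
  - exact: measurable_lmul.
  - have [inv _ _] := hmT; rewrite -N0 -(inv (g n) N mN); congr (mT _).
    apply/seteqP; split => [x Nx|_ [x Nx <-]]; last by rewrite /= mulKg.
    by exists ((g n)^-1 * x); rewrite // mulVKg.
  - move=> x /= /not_implyP[Kx nP]; apply: PN => /= /(_ Kx).
    by rewrite -pM mulVKg.
have := ae_countable (countableP setT) (fun n _ => aeg n).
apply: ae_mono => x H; have [n Vn] := cP x; apply: (H n I).
have [Vg _] := svalP (gP n); rewrite -/(g n) in Vg.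
have := VK _ _ (Vi _ Vg) Vn.
by rewrite invgM invgK -!mulgA mulVKg.
Qed.

End null_sets.

Section over.
Variables (R : realType) (G : topGroupType) (mG : probability (borel G) R).
Hypotheses (cG : compact [set: G]) (pG : polish_space R G) (hG : haar_measure mG).
Variables (T : topGroupType) (p : T -> G).
Hypotheses (lcT : locally_compact [set: T]) (hT : hausdorff_space T).
Hypothesis pcT : path_connected_space R T.
Hypotheses (pM : {morph p : x y / x * y}) (cp : continuous p) (sp : range p = [set: G]).
Hypothesis kp : p @^-1` [set 1] `<=` isolated (p @^-1` [set 1]).

(** The translates [c n k * B n] form a countable family that refines every choice of
    neighbourhoods; one x is kept for each member that fits into some [U x]. *)
Lemma countable_subcover (U : T -> set T) : (forall x, nbhs x (U x)) ->
  exists e : nat -> T, forall x, exists n, U (e n) x.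
Proof.
move=> nU; have [B [nB Bd Bb]] := cover_basis1 pG hG lcT hT pcT pM cp sp kp.
have cP n : {c : nat -> T | forall x, exists k, B n ((c k)^-1 * x)}.
  by apply: cid; exact: (lindelof_translates lcT hT pcT (nB n)).
pose c n := sval (cP n).
pose S (q : nat * nat) (x : T) := forall y, B q.1 ((c q.1 q.2)^-1 * y) -> U x y.
have eP q : {x : T | (exists x', S q x') -> S q x}.
  apply: cid; have [[x Sx]|nS] := pselect (exists x', S q x'); first by exists x.
  by exists 1 => /nS.
exists (fun n => sval (eP (odflt (0, 0)%N (unpickle n)))) => x.
have nUx : nbhs 1 [set y | U x (x * y)] by apply/nbhs_lmul; rewrite mulg1.
have [V [oV V1 Vi VU]] := nbhs1_sym2 nUx.
have [n Bn] := Bb _ (open_nbhs_nbhs (conj oV V1)).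
have [k Bk] := svalP (cP n) x; rewrite -/(c n) in Bk.
exists (pickle (n, k)); rewrite pickleK /=; case: (eP (n, k)) => x' /= Sx'.
apply: (Sx' _ x Bk); exists x => y /= By.
have := VU _ _ (Vi _ (Bn _ Bk)) (Bn _ By).
by rewrite /= invgM invgK -!mulgA !mulVKg.
Qed.

(* "Almost everywhere" with respect to the preimages of null sets of G. *)
Definition ae_over (P : T -> Prop) := {ae mG, forall q : borel G, forall y, p y = q -> P y}.

Lemma ae_over_nbhs (P : T -> Prop) (x : T) (U : set T) : ae_over P -> nbhs x U ->
  exists y, U y /\ P y.
Proof.
move=> aeP nU.
have nV : nbhs (p x) [set q | (p @` [set y | U (x * y)]) ((p x)^-1 * q)].
  apply/nbhs_lmul; rewrite mulVg; apply: (cover_open1 pG hG lcT hT pcT pM cp sp).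
  by apply/nbhs_lmul; rewrite mulg1.
have [q [[y Uy yq] /(_ (x * y)) Pq]] := ae_nbhs cG pG hG aeP nV.
by exists (x * y); split => //; apply: Pq; rewrite pM yq mulVKg.
Qed.

(** The sets [C d] are open, pairwise disjoint and cover T, so connectedness leaves only one. A
    countable subcover then reduces the exceptional set to a countable union of null sets. *)
Lemma ae_over_constant (D : Type) (f : T -> D) :
  (forall x : T, exists d V, nbhs x V /\ ae_over (fun y => V y -> f y = d)) ->
  exists d, ae_over (fun y => f y = d).
Proof.
move=> fl; pose C d := [set x : T | exists V, nbhs x V /\ ae_over (fun y => V y -> f y = d)].
have oC d : open (C d).
  rewrite openE => x [V [nV aeV]].
  move: nV; rewrite nbhsE => -[V' [oV' Vx] V'V].
  suff : V' `<=` C d by move=> /filterS; apply; exact: open_nbhs_nbhs.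
  by move=> y V'y; exists V; split => //; apply: filterS V'V _; exact: open_nbhs_nbhs.
have [d Cd] : exists d, C d 1 by have [d [V VP]] := fl 1; exists d, V.
have disj x d' : C d x -> C d' x -> d = d'.
  move=> [V [nV aV]] [V' [nV' aV']].
  have [||y [[Vy V'y] Q]] := @ae_over_nbhs (fun y => V y -> V' y -> d = d') x (V `&` V').
  - by apply: ae_mono2 aV aV' => q H H' y yq Vy V'y; rewrite -(H y) // (H' y).
  - exact: filterI.
  - exact: Q.
have CT : C d = setT.
  apply: (clopen_path pcT) => //.
  rewrite -openC (_ : ~` C d = \bigcup_(d' in [set d' | d' <> d]) C d').
    by apply: bigcup_open.
  apply/seteqP; split => [x nC|x [d' /= d'd Cd'] Cx]; last exact: d'd (esym (disj _ _ Cx Cd')).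
  have [d' [V VP]] := fl x; exists d'; last by exists V.
  by move=> dd; apply: nC; rewrite -dd; exists V.
have VP (x : T) : {V | nbhs x V /\ ae_over (fun y => V y -> f y = d)}.
  by apply: cid; have : C d x by rewrite CT.
pose V x := sval (VP x).
have [e eV] := countable_subcover (fun x => proj1 (svalP (VP x))).
exists d; have := ae_countable (countableP setT) (fun n _ => proj2 (svalP (VP (e n)))).
apply: ae_mono => q H y yq; have [n Vn] := eV y; exact: (H n I y yq).
Qed.

End over.

(** * Gluing the local trivializations on the cover *)

Section cover_trivialization.
Variables (R : realType) (G : topGroupType) (mG : probability (borel G) R).
Hypotheses (cG : compact [set: G]) (pG : polish_space R G) (hG : haar_measure mG).
Variables (Gam Lam : set G) (Delta : groupType) (w : G * G -> G -> Delta).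
Hypotheses (sGam : subgroup Gam) (cGam : countable Gam) (dGam : dense Gam).
Hypotheses (sLam : subgroup Lam) (cLam : countable Lam) (dLam : dense Lam).
Hypothesis fLam : finitely_generated Lam.
Hypothesis se : strongly_ergodic (X := borel G) Gam (fun g x : G => g * x) mG.
Hypothesis cDelta : countable [set: Delta].
Hypothesis mw : forall s, (Gam `*` Lam) s -> @dmeas _ (borel G) Delta (w s).
Hypothesis wM : forall s t x, (Gam `*` Lam) s -> (Gam `*` Lam) t ->
  w (s * t) x = w s (lr_act t x) * w t x.
Variables (T : topGroupType) (p : T -> G).
Hypotheses (lcT : locally_compact [set: T]) (hT : hausdorff_space T).
Hypothesis scT : simply_connected_space R T.
Hypotheses (pM : {morph p : x y / x * y}) (cp : continuous p) (sp : range p = [set: G]).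
Hypothesis kp : p @^-1` [set 1] `<=` isolated (p @^-1` [set 1]).

Lemma trivial_on_cover : exists2 psi : T -> Delta, @dmeas _ (borel T) Delta psi &
  forall s : T * T, Gam (p s.1) -> Lam (p s.2) -> exists d,
    ae_over mG p (fun y => w (p s.1, p s.2) (p y) = psi (lr_act s y) * d * (psi y)^-1).
Proof.
have [G1 GM GV] := sGam; have [L1 LM LV] := sLam; have [pcT _] := scT.
have w1 x : w (1, 1) x = 1.
  apply: (@mulgI _ (w (1, 1) x)); rewrite mulg1.
  have := @wM (1, 1) (1, 1) x (conj G1 L1) (conj G1 L1).
  have -> : lr_act (1, 1) x = x by rewrite /lr_act /= mul1g invg1 mulg1.
  by move=> <-; congr (w _ _); congr pair; rewrite /= mul1g.
have [W [phi [oW W1 mphi phis [phic phie]]]] :=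
  trivialization_exists cG pG hG sGam sLam cLam dLam fLam se cDelta mw wM.
pose E := [set u | W u /\ equivariant mG w W phi 1 u].
have nE : nbhs 1 E° by apply: nbhs_interior; apply: filterI; [exact: open_nbhs_nbhs|exact: phie].
have [B [oB B1 Bi BE]] := nbhs1_sym2 nE.
have BW x : B x -> W x.
  by move=> Bx; have /interior_subset[] := BE x 1 Bx B1; rewrite mulg1.
have [C [oC C1 Ci CB]] := nbhs1_sym2 (open_nbhs_nbhs (conj oB B1)).
have CsB x : C x -> B x by move=> Cx; rewrite -(mulg1 x); exact: CB.
have aereg := ae_regular pG hG cGam cDelta oW mphi phic.
(* [p y] itself may fail to be regular, so a regular point close to it is used as the base point of
   the trivialization. *)
have zP (y : T) : {z | C (z * (p y)^-1) /\ regular mG Gam W phi z}.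
  apply: cid; apply: (ae_nbhs cG pG hG aereg (x := p y)).
  by apply/(nbhs_rmul (p y)^-1); rewrite mulgV; exact: open_nbhs_nbhs.
pose z y := sval (zP y).
have zC y : C (z y * (p y)^-1) by have [] := svalP (zP y).
have zr y : regular mG Gam W phi (z y) by have [] := svalP (zP y).
(* The domain of the trivialization based at [z y]: there [z y * x^-1] lies in [B], hence in [W],
   and quotients of two points lie in [E]. *)
pose N y := [set x : G | B (z y * x^-1)].
have oN y : open (N y).
  rewrite (_ : N y = [set x | [set v | B (z y * v)] x^-1]) //.
  by apply: open_comp; [move=> v _; exact: invg_continuous|exact: open_lmul].
have NE y x x' : N y x -> N y x' -> E° (x' * x^-1).
  move=> Nx Nx'; have := BE _ _ (Bi _ Nx') Nx.
  by rewrite invgM invgK -!mulgA mulKg.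
pose f y := trivialize phi (z y).
(* For g = h = 1 the cocycle is trivial, and local constancy compares the two trivializations
   themselves. *)
have tP a b : {d | {ae mG, forall x : borel G, N a x -> N b x -> f b x = f a x * d}}.
  apply: cid.
  have [||||d dP] := locally_constant pG hG sGam dGam sLam cDelta mw wM mphi phis
    G1 L1 (zr b) (zr a) (openI (oN a) (oN b)) (@open_interior _ E).
  - by move=> u /interior_subset[].
  - by move=> x [_ /BW].
  - by move=> x [/BW]; rewrite mul1g invg1 mulg1.
  - by move=> x y [Nx _] [Ny _]; exact: NE Nx Ny.
  exists d; apply: ae_mono dP => x dP Na Nb; have := dP (conj Na Nb).
  by rewrite w1 mul1g invg1 mulg1 => /esym/divg1_eq ->.
pose t a b := sval (tP a b).
have aet a b : {ae mG, forall x : borel G, N a x -> N b x -> f b x = f a x * t a b}.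
  by rewrite /t; case: (tP a b).
(* An identity between constants that holds almost everywhere on a nonempty open set holds
   outright. *)
have tri a b c x : N a x -> N b x -> N c x -> t a b * t b c = t a c.
  move=> Na Nb Nc.
  have nN : nbhs x (N a `&` N b `&` N c).
    by apply: open_nbhs_nbhs; split => //; apply: openI => //; exact: openI.
  have [|y [[[Nay Nby] Ncy] Q]] := ae_nbhs cG pG hG (P := fun y => N a y -> N b y -> N c y ->
      t a b * t b c = t a c) _ nN; last exact: Q.
  apply: ae_mono3 (aet a b) (aet b c) (aet a c) => y ab bc ac Na' Nb' Nc'.
  by apply: (@mulgI _ (f a y)); rewrite mulgA -ab // -bc // -ac.
pose O c := [set y : T | C (p y * (p c)^-1)].
have oO c : open (O c).
  by apply: (@open_comp T G p [set x | C (x * (p c)^-1)]); [move=> y _; exact: cp|exact: open_rmul].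
have ON c y : O c y -> N y (p c).
  by move=> Oy; have := CB _ _ (zC y) Oy; rewrite mulgA mulgVK.
have ON' c y : O c y -> N c (p y).
  move=> Oy; have := CB _ _ (zC c) (Ci _ Oy).
  by rewrite invgM invgK mulgA mulgVK.
have Oid c : O c c by rewrite /O /= mulgV.
have [kappa kP] : exists kappa : T -> Delta, forall x : T,
    \forall y \near x, kappa y = kappa x * t x y.
  apply: (monodromy (O := O) oO _ _ scT).
  - by move=> c; exists c.
  - by move=> c a b e /ON Oa /ON Ob /ON Oe; exact: tri Oa Ob Oe.
  - move=> U nU; exact: (locally_path_connected pG hG lcT hT pcT pM cp sp kp nU).
(* Wherever [U x] and [U x'] meet, passing from x to x' multiplies both [f] and [kappa] on the right
   by [t x x'], which cancels in this quotient. *)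
pose sec x y := f x (p y) * (kappa x)^-1.
pose U x := [set y | kappa y = kappa x * t x y] `&` O x.
have nU x : nbhs x (U x).
  by apply: filterI (kP x) _; apply: open_nbhs_nbhs.
have agree x x' : ae_over mG p (fun y => U x y -> U x' y -> sec x y = sec x' y).
  apply: ae_mono (aet x x') => q H y yq [kx Ox] [kx' Ox'].
  have Nx := ON' _ _ Ox; have Nx' := ON' _ _ Ox'.
  rewrite /sec yq H -?yq //.
  have Ny : N y (p y) := CsB _ (zC y).
  have := tri _ _ _ _ Nx Nx' Ny.
  rewrite -mulgA; move=> tt; congr (_ * _).
  apply: invg_inj; rewrite invgM !invgK.
  apply: (@mulIg _ (t x y)); rewrite -kx kx' -tt !mulgA; congr (_ * _).
  by rewrite mulgVK.
have [e eU] := countable_subcover pG hG lcT hT pcT pM cp sp kp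
  (fun x => nbhs_interior (nU x)).
have msec x : @dmeas _ (borel T) Delta (sec x).
  apply: dmeasM => //; last exact: dmeas_cst.
  apply: (@dmeas_comp _ _ (borel T) (borel G) Delta (f x) p (continuous_borel cp)).
  exact: (measurable_trivialize mphi).
(* Countably many of the sections [sec] cover T; a value of any of them is selected measurably, and
   almost everywhere it does not matter which. *)
pose A a := [set y | exists n, (U (e n))° y /\ sec (e n) y = a].
have [|psi mpsi psiP] := dmeas_pick cDelta (A := A : Delta -> set (borel T)).
  move=> a; rewrite (_ : A a = \bigcup_n ((U (e n))° `&` [set y | sec (e n) y = a])).
    apply: bigcupT_measurable => n; apply: measurableI; last exact: msec.
    by apply: open_borel; exact: open_interior.
  by apply/seteqP; split => y [n]; [move=> H; exists n|move=> _ H; exists n].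
have psiE x : ae_over mG p (fun y => U x y -> psi y = sec x y).
  apply: ae_mono (ae_countable (countableP setT) (fun n _ => agree (e n) x)) => q H y yq Ux.
  have [n Un] := eU y; have [k [Uk <-]] := psiP y (sec (e n) y) (ex_intro _ n (conj Un erefl)).
  by apply: (H k I y yq) => //; exact: interior_subset.
exists psi => // s Gs Ls.
(* The candidate for the homomorphism at s: locally constant over G, hence constant on the connected
   group T. *)
pose F y := (psi (lr_act s y))^-1 * w (p s.1, p s.2) (p y) * psi y.
have pact y : p (lr_act s y) = lr_act (p s.1, p s.2) (p y).
  by rewrite /lr_act /= !pM (coverV pM).
suff [d dP] : exists d, ae_over mG p (fun y => F y = d).
  exists d; apply: ae_mono dP => q H y /H <-.
  by rewrite /F !mulgA mulgV mul1g mulgK.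
apply: (ae_over_constant cG pG hG lcT hT pcT pM cp sp kp) => x.
pose x' := lr_act s x.
have nEs : nbhs 1 [set u | equivariant mG w W phi (p s.1) u]° by apply: nbhs_interior; exact: phie.
have [K [oK K1 Ki KE]] := nbhs1_sym2 nEs.
(* Points near [p x] whose image under s stays in the domain of the trivialization at x'. [K]
   depends on s; this is harmless because only local constancy is asked here. *)
pose Nx := [set q | N x q /\ N x' (lr_act (p s.1, p s.2) q)] `&` [set q | K (q * (p x)^-1)].
have cact (H : topGroupType) (r : H * H) : continuous (lr_act r).
  move=> y; rewrite /lr_act; apply: continuous_mulg => [y'|y']; last exact: cvg_cst.
  exact: continuous_lmul.
have oNx : open Nx.
  apply: openI; last exact: open_rmul.
  by apply: openI => //; apply: (open_comp _ (oN x')) => q _; exact: cact.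
have [||||d dP] := locally_constant pG hG sGam dGam sLam cDelta mw wM mphi phis
    Gs Ls (zr x) (zr x') oNx (@open_interior _ [set u | equivariant mG w W phi (p s.1) u]).
- by move=> u /interior_subset.
- by move=> q [[/BW]].
- by move=> q [[_ /BW]].
- move=> a b [_ Ka] [_ Kb]; have := KE _ _ Kb (Ki _ Ka).
  by rewrite invgM invgK mulgA mulgVK.
exists (kappa x' * d * (kappa x)^-1).
exists (p @^-1` Nx `&` (U x `&` [set y | U x' (lr_act s y)])); split.
  apply: filterI.
    apply: (cp (x := x)); apply: open_nbhs_nbhs; split => //; split; last by rewrite /= mulgV.
    by split; [|rewrite -pact]; exact: ON' (Oid _).
  by apply: filterI => //; exact: (cact T s x _ (nU x')).
apply: ae_mono3 dP (psiE x) (ae_act pG hG (p s.1, p s.2) (psiE x')) => q dP Px Px' y yq.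
move=> [Ny [Uy Uy']]; rewrite /F (Px y yq Uy) (Px' (lr_act s y)) ?pact ?yq //.
rewrite /sec pact yq dP -?yq //.
rewrite /f !invgM !invgK /lr_act /=.
set a := trivialize phi (z x') _; set b := trivialize _ _ _.
by rewrite -!mulgA mulKg; congr (_ * (_ * _)); rewrite mulKg.
Qed.

End cover_trivialization.

(** delta s is the constant found for s. The cocycle identity at s * t gives multiplicativity almost
    everywhere, after cancelling psi at the three points involved; as it relates constants, one good
    point is enough. *)
Theorem theoremA (R : realType) (G : topGroupType)
  (mG : probability (borel G) R) (Gam Lam : set G)
  (Delta : groupType) (w : G * G -> G -> Delta) :
  compact [set: G] -> polish_space R G -> haar_measure mG ->
  subgroup Gam -> countable Gam -> dense Gam ->
  subgroup Lam -> countable Lam -> dense Lam ->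
  strongly_ergodic (X := borel G) Gam (fun g x : G => g * x) mG ->
  finitely_generated Lam ->
  countable [set: Delta] ->
  cocycle (X := borel G) (Gam `*` Lam) (@lr_act G) mG [set: G] w ->
  (profinite G -> finitely_generated Gam ->
   exists G0 : set G, [/\ open G0, subgroup G0 &
     exists delta : G * G -> Delta,
       homomorphism_on ((Gam `&` G0) `*` (Lam `&` G0)) delta /\
       cohomologous (X := borel G) ((Gam `&` G0) `*` (Lam `&` G0))
         (@lr_act G) mG G0 w (fun s _ => delta s)])
  /\
  (connected [set: G] ->
   forall (Gt : topGroupType) (mGt : {measure set (borel Gt) -> \bar R})
     (p : Gt -> G),
   locally_compact [set: Gt] -> hausdorff_space Gt ->
   simply_connected_space R Gt -> haar_measure mGt ->
   {morph p : x y / x * y} -> continuous p -> range p = [set: G] ->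
   p @^-1` [set 1] `<=` isolated (p @^-1` [set 1]) ->
   exists delta : Gt * Gt -> Delta,
     homomorphism_on ((p @^-1` Gam) `*` (p @^-1` Lam)) delta /\
     cohomologous (X := borel Gt) ((p @^-1` Gam) `*` (p @^-1` Lam))
       (@lr_act Gt) mGt [set: Gt]
       (fun s x => w (p s.1, p s.2) (p x)) (fun s _ => delta s)).
Proof.
move=> cG pG hG sGam cGam dGam sLam cLam dLam se fLam cDelta cw.
have [w' [mw wM ww']] := strict_cocycle pG hG sGam cGam sLam cLam cDelta cw.
have act_mul_psi (D : groupType) (a b c d d' e : D) :
    a * e * b^-1 = a * d * c^-1 * (c * d' * b^-1) -> e = d * d'.
  by rewrite -!mulgA mulKg => /mulgI; rewrite !mulgA => /mulIg.
split.
  move=> prG fGam.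
  have [G0 [oG0 sG0 [psi mpsi psiP]]] := trivial_on_open_subgroup cG pG hG
    sGam cGam dGam sLam cLam dLam fLam se cDelta mw wM prG fGam.
  exists G0; split => //; have [G01 G0M G0V] := sG0.
  (* The value 1 outside the acting group is a default that makes delta a total function. *)
  have dP s : {d | ((Gam `&` G0) `*` (Lam `&` G0)) s -> {ae mG, forall x : borel G, G0 x ->
      w' s x = psi (lr_act s x) * d * (psi x)^-1}}.
    apply: cid; have [Ss|nS] := pselect (((Gam `&` G0) `*` (Lam `&` G0)) s).
      by have [d dP] := psiP s Ss; exists d.
    by exists 1 => /nS.
  exists (fun s => sval (dP s)); split; last first.
    exists psi; first exact: dmeas_measurable.
    move=> s Ss; have Gs : (Gam `*` Lam) s by case: Ss => -[? _] [? _].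
    apply: ae_mono2 (ww' s Gs) (svalP (dP s) Ss) => x -> H; exact: H.
  move=> s t Ss St.
  have Gs : (Gam `*` Lam) s by case: Ss => -[? _] [? _].
  have Gt : (Gam `*` Lam) t by case: St => -[? _] [? _].
  have Sst : ((Gam `&` G0) `*` (Lam `&` G0)) (s * t).
    case: Ss St sGam sLam => -[? ?] [? ?] [[? ?] [? ?]] [_ GM _] [_ LM _].
    by split; split; [exact: GM|exact: G0M|exact: LM|exact: G0M].
  have aeP : {ae mG, forall x : borel G, G0 x ->
      sval (dP (s * t)) = sval (dP s) * sval (dP t)}.
    apply: ae_mono3 (svalP (dP (s * t)) Sst) (ae_act pG hG t (svalP (dP s) Ss))
      (svalP (dP t) St) => x est es et G0x.
    apply: (act_mul_psi _ (psi (lr_act (s * t) x)) (psi x) (psi (lr_act t x))).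
    rewrite -est // -et // wM // es ?lr_actM //.
    have [[_ t1] [_ t2]] := St.
    by apply: (G0M); [exact: G0M|exact: G0V].
  have [x [G0x /(_ G0x)]] := ae_nbhs cG pG hG aeP (open_nbhs_nbhs (conj oG0 G01)).
  exact.
move=> _ Gt mGt p lcT hT scT hmT pM cp sp kp.
have [pcT _] := scT.
have [psi mpsi psiP] := trivial_on_cover cG pG hG
  sGam cGam dGam sLam cLam dLam fLam se cDelta mw wM lcT hT scT pM cp sp kp.
pose S := (p @^-1` Gam) `*` (p @^-1` Lam).
have dP s : {d | S s -> ae_over mG p
    (fun y => w' (p s.1, p s.2) (p y) = psi (lr_act s y) * d * (psi y)^-1)}.
  apply: cid; have [[Gs Ls]|nS] := pselect (S s); last by exists 1 => /nS.
  by have [d dP] := psiP s Gs Ls; exists d.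
exists (fun s => sval (dP s)); split; last first.
  exists psi; first exact: dmeas_measurable.
  move=> s Ss.
  have := ae_cover cG pG hG lcT hT pcT hmT pM cp sp (svalP (dP s) Ss).
  have := ae_cover cG pG hG lcT hT pcT hmT pM cp sp (ww' (p s.1, p s.2) Ss).
  by apply: ae_mono2 => x -> H _; exact: H.
move=> s t Ss St.
have Sst : S (s * t).
  case: Ss St sGam sLam => ? ? [? ?] [_ GM _] [_ LM _].
  by split; rewrite /= pM; [exact: GM|exact: LM].
have aeP : ae_over mG p (fun y => sval (dP (s * t)) = sval (dP s) * sval (dP t)).
  apply: ae_mono3 (svalP (dP (s * t)) Sst) (ae_act pG hG (p t.1, p t.2) (svalP (dP s) Ss))
    (svalP (dP t) St) => q est es et y yq.
  have pact : p (lr_act t y) = lr_act (p t.1, p t.2) (p y).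
    by rewrite /lr_act /= !pM (coverV pM).
  apply: (act_mul_psi _ (psi (lr_act (s * t) y)) (psi y) (psi (lr_act t y))).
  rewrite -est // -et // !pM.
  rewrite (lr_actM s t) -es ?pact ?yq //.
  exact: (wM (p s.1, p s.2) (p t.1, p t.2)).
by have [y []] := ae_over_nbhs cG pG hG lcT hT pcT pM cp sp aeP (@filterT _ (nbhs (1 : Gt)) _).
Qed.
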